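(* Let $p$ be a prime and $\mathbb{Z}_p^n$ an elementary abelian group with $n \geq 2$. Let $\Gamma$ be a connected symmetric $\mathbb{Z}_p^n$-cover of the dipole $\mathrm{Dip}_5$. Then $2 \leq n \leq 4$ and: (1) For $n = 2$, $\Gamma \cong \mathcal{CGD}_{p^2}^1$ ($p = 5$ or $5 \mid (p-1)$) or $\Gamma \cong \mathcal{CGD}_{p^2}^2$ ($5 \mid (p \pm 1)$), and these graphs are unique for a given order. Moreover, $\mathrm{Aut}(\mathcal{CGD}_{5^2}^1) = (R(GD_{5^2}) \rtimes F_{20})\mathbb{Z}_4 \cong \mathbb{Z}_5 \cdot ((F_{20} \times F_{20}) \rtimes \mathbb{Z}_2)$ with $N_A(R(GD_{5^2})) = R(GD_{5^2}) \rtimes F_{20}$ (where $A=\mathrm{Aut}(\mathcal{CGD}_{5^2}^1)$); $\mathrm{Aut}(\mathcal{CGD}_{p^2}^1) = R(GD_{p^2}) \rtimes \mathbb{Z}_5$ for $5 \mid (p-1)$; and $\mathrm{Aut}(\mathcal{CGD}_{p^2}^2) = R(GD_{p^2}) \rtimes D_5$. (2) For $n = 3$, $\Gamma \cong \mathcal{CGD}_{p^3}$ ($p = 5$ or $5 \mid (p-1)$), unique for a given order; $\mathrm{Aut}(\mathcal{CGD}_{5^3}) = R(GD_{5^3}) \rtimes S_5$ and $\mathrm{Aut}(\mathcal{CGD}_{p^3}) = R(GD_{p^3}) \rtimes \mathbb{Z}_5$ for $5 \mid (p-1)$. (3) For $n = 4$, $\Gamma \cong \mathcal{CGD}_{p^4}$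 and $\mathrm{Aut}(\mathcal{CGD}_{p^4}) = R(GD_{p^4}) \rtimes S_5$.
   Context: $\mathrm{Dip}_5$ is the dipole: two vertices joined by five parallel edges. A regular $N$-cover $\tilde\Gamma$ of a graph $\Gamma$ is a graph with a covering projection $\tilde\Gamma\to\Gamma$ such that $\mathrm{Aut}(\tilde\Gamma)$ has a semiregular subgroup $N$ whose vertex, arc and edge orbits are exactly the vertex, arc and edge fibres; it is a symmetric cover if $\tilde\Gamma$ is arc-transitive under the fibre-preserving group $N_{\mathrm{Aut}(\tilde\Gamma)}(N)$. For a group $G$, $R(G)$ denotes its right regular representation, $N_A(H)$ the normalizer of $H$ in $A$, $D_n$ the dihedral group of order $2n$, $F_{20}$ the Frobenius group of order 20, $S_n$ the symmetric group. $\mathrm{Cay}(G,S)$ is the Cayley graph with vertex set $G$ and edges $\{g,sg\}$, $s\in S$. $GD_{p^k}$ ($k=2,3,4$) is the generalized dihedral group $\mathbb{Z}_p^k\rtimes\mathbb{Z}_2$ in which the involution $h$ inverts every element of $\mathbb{Z}_p^k$. Write $GD_{p^2}=\langle a,d,h\rangle$, $GD_{p^3}=\langle a,b,d,h\rangle$, $GD_{p^4}=\langle a,b,c,d,h\rangle$ with $a,b,c,d$ pairwise commuting of order $p$ and $h^2=1$, $h^{-1}xh=x^{-1}$. For $p=5$ let $\ell=1$; for $5\mid(p-1)$ let $\ell$ be an element of order 5 in $\mathbb{Z}_p^*$. Define $\mathcal{CGD}_{p^2}^1=\mathrm{Cay}(GD_{p^2},\{h, ah, a^{\ell(\ell+1)^{-1}}d^{\ell^{-1}}h,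 a^{\ell}d^{(\ell+1)^{-1}}h, dh\})$; $\mathcal{CGD}_{p^3}=\mathrm{Cay}(GD_{p^3},\{h, ah, bh, a^{-\ell^2}b^{-\ell}d^{-\ell^4}h, dh\})$. For $5\mid(p\pm1)$ let $\lambda\in\mathbb{Z}_p^*$ with $\lambda^2=5$ and define $\mathcal{CGD}_{p^2}^2=\mathrm{Cay}(GD_{p^2},\{h, ah, a^{2^{-1}(1+\lambda)}dh, ad^{2^{-1}(1+\lambda)}h, dh\})$. Finally $\mathcal{CGD}_{p^4}=\mathrm{Cay}(GD_{p^4},\{h,ah,bh,ch,dh\})$. *)

(* Defs.v *)
From HB Require Import structures.
From mathcomp Require Import all_boot all_algebra all_fingroup all_solvable.

Set Implicit Arguments.
Unset Strict Implicit.
Unset Printing Implicit Defensive.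

Import GRing.Theory.
Local Open Scope group_scope.

(* A finite graph without loops, parallel edges being allowed.  An arc is a
   pair (v, e) with v \in ends e, namely e directed away from v. *)
Record mgraph := MGraph {
  vert : finType;
  edge : finType;
  ends : edge -> {set vert};
  card_ends : forall e, #|ends e| = 2 }.

Section Multigraphs.

Variable X : mgraph.

Definition madj : rel (vert X) :=
  [rel u v | [exists e : edge X, ends e == [set u; v]]].

Definition mconnected := forall u v : vert X, connect madj u v.

(* With parallel edges an automorphism is not determined by its action on the
   vertices, so it is a pair of permutations (of vertices, of edges). *)
Definition mAut : {set {perm vert X} * {perm edge X}} :=
  [set g : {perm vert X} * {perm edge X}
     | [forall e, ends (g.2 e) == g.1 @: ends e]].

Lemma mAut_group_set : group_set mAut.
Proof.
apply/group_setP; split.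
  rewrite inE; apply/forallP=> e; rewrite /= perm1.
  by rewrite (eq_imset _ (@perm1 _)) imset_id.
move=> g k; rewrite !inE => /forallP Hg /forallP Hk.
apply/forallP=> e; rewrite /= permM (eqP (Hk _)) (eqP (Hg _)) -imset_comp.
by apply/eqP/eq_imset=> v; rewrite permM.
Qed.
Canonical mAut_group := Group mAut_group_set.

End Multigraphs.

Definition miso (X Y : mgraph) : Prop :=
  exists (fV : vert X -> vert Y) (fE : edge X -> edge Y),
    [/\ bijective fV, bijective fE & forall e, ends (fE e) = fV @: ends e].

Section Covers.

Variables (X Y : mgraph) (fV : vert X -> vert Y) (fE : edge X -> edge Y).

Definition covering : Prop :=
  [/\ forall e, ends (fE e) = fV @: ends e,
      forall w, exists v, fV v = w
    & forall (v : vert X) (f : edge Y), fV v \in ends f ->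
        exists! e : edge X, v \in ends e /\ fE e = f].

Variable N : {group {perm vert X} * {perm edge X}}.

Definition semiregular_on_vertices : Prop :=
  forall g, g \in N -> forall v, g.1 v = v -> g = 1.

Definition orbits_are_fibres : Prop :=
  [/\ forall u v : vert X,
        (exists2 g, g \in N & g.1 u = v) <-> fV u = fV v,
      forall e e' : edge X,
        (exists2 g, g \in N & g.2 e = e') <-> fE e = fE e'
    & forall (u v : vert X) (e e' : edge X), u \in ends e -> v \in ends e' ->
        (exists2 g, g \in N & g.1 u = v /\ g.2 e = e') <->
        (fV u = fV v /\ fE e = fE e')].

Definition regular_cover_by : Prop :=
  [/\ covering, N \subset mAut X, semiregular_on_vertices & orbits_are_fibres].

End Covers.

Definition arc_transitive (X : mgraph) (A : {set {perm vert X} * {perm edge X}})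
    : Prop :=
  forall (u v : vert X) (e e' : edge X), u \in ends e -> v \in ends e' ->
    exists2 g, g \in A & g.1 u = v /\ g.2 e = e'.

(* X is a symmetric regular Q-cover of Y *)
Definition symmetric_cover (gT : finGroupType) (Q : {group gT}) (X Y : mgraph)
    : Prop :=
  exists fV fE (N : {group {perm vert X} * {perm edge X}}),
    [/\ @regular_cover_by X Y fV fE N, N \isog Q
      & arc_transitive 'N_(mAut X)(N)].

Lemma dipole_card_ends n (e : 'I_n) : #|[set: bool]| = 2.
Proof. by rewrite cardsT card_bool. Qed.

Definition dipole (n : nat) : mgraph :=
  @MGraph bool 'I_n (fun=> [set: bool]) (@dipole_card_ends n).

(* Simple graphs are given by their adjacency relation on vertices, and their
   automorphisms are permutations of the vertices. *)
Section SimpleGraphs.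

Variables (T : finType) (adj : rel T).

Definition sedge_pred (A : {set T}) : bool :=
  [exists x, exists y, [&& x != y, adj x y & A == [set x; y]]].

Definition sedge := {A : {set T} | sedge_pred A}.

Lemma sedge_card_ends (e : sedge) : #|val e| = 2.
Proof.
case: e => A /= /existsP[x /existsP[y /and3P[nxy _ /eqP->]]].
by rewrite cards2 nxy.
Qed.

Definition mgraph_of : mgraph :=
  @MGraph T sedge (fun e : sedge => val e) sedge_card_ends.

Definition sAut : {set {perm T}} :=
  [set s : {perm T} | [forall x, forall y, adj (s x) (s y) == adj x y]].

Lemma sAut_group_set : group_set sAut.
Proof.
apply/group_setP; split.
  by rewrite inE; apply/forallP=> x; apply/forallP=> y; rewrite !perm1.
move=> s t; rewrite !inE => /forallP Hs /forallP Ht.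
apply/forallP=> x; apply/forallP=> y; rewrite !permM.
by rewrite (eqP (forallP (Ht _) _)); apply: (forallP (Hs x)).
Qed.
Canonical sAut_group := Group sAut_group_set.

End SimpleGraphs.

(* Edges are {g, s g} for s in S; S is meant to be inverse-closed. *)
Definition cay (gT : finGroupType) (S : {set gT}) : rel gT :=
  [rel x y | y * x^-1 \in S].

(* The right regular representation g |-> (x |-> x g), as a permutation group *)
Definition RR (gT : finGroupType) : {group {perm gT}} :=
  (actperm ('R : {action gT &-> gT}) @* [set: gT])%G.

(* The generalized dihedral group: (v, e) stands for v h^e, where h inverts v,
   so that (v h^e) (w h^f) = (v + (-1)^e w) h^(e+f). *)
Section GeneralizedDihedral.

Variables p k : nat.

Definition GD : Type := ('rV['F_p]_k * bool)%type.

HB.instance Definition _ := Finite.on GD.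

Definition GDone : GD := (0%R, false).
Definition GDmul (x y : GD) : GD :=
  ((x.1 + (-1) ^+ x.2 *: y.1)%R, x.2 (+) y.2).
Definition GDinv (x : GD) : GD := (((-1) ^+ (~~ x.2) *: x.1)%R, x.2).

Lemma GDmulA : associative GDmul.
Proof.
move=> [u a] [v b] [w c]; rewrite /GDmul /= addbA; congr pair.
by rewrite scalerDr scalerA -signr_addb addrA.
Qed.

Lemma GDmul1 : left_id GDone GDmul.
Proof. by case=> u a; rewrite /GDmul /= expr0 scale1r add0r. Qed.

Lemma GDmulV : left_inverse GDone GDinv GDmul.
Proof.
case=> u [] /=; rewrite /GDmul /GDinv /GDone /=.
  by rewrite expr0 expr1 scale1r scaleN1r subrr.
by rewrite expr0 expr1 scale1r scaleN1r addNr.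
Qed.

HB.instance Definition _ := Finite_isGroup.Build GD GDmulA GDmul1 GDmulV.

(* The involution with given exponents, e.g. GDh [:: x; y] is a^x d^y h. *)
Definition GDh (s : seq 'F_p) : GD := (\row_(i < k) s`_i, true)%R.

End GeneralizedDihedral.

Arguments GDh {p k} s.

Section Graphs.

Local Open Scope ring_scope.

Definition ell_param (p : nat) (l : 'F_p) : bool :=
  ((p == 5) && (l == 1)) || ((5 %| p - 1)%N && 5.-primitive_root l).

Definition lambda_param (p : nat) (l : 'F_p) : bool :=
  [&& (5 %| p - 1)%N || (5 %| p + 1)%N, l != 0 & l ^+ 2 == 5%:R].

(* exponents along (a, d) *)
Definition CGD2_1 (p : nat) (l : 'F_p) : rel (GD p 2) :=
  cay [set GDh [:: 0; 0]; GDh [:: 1; 0];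
           GDh [:: l * (l + 1)^-1; l^-1];
           GDh [:: l; (l + 1)^-1];
           GDh [:: 0; 1]].

Definition CGD2_2 (p : nat) (l : 'F_p) : rel (GD p 2) :=
  cay [set GDh [:: 0; 0]; GDh [:: 1; 0];
           GDh [:: 2%:R^-1 * (1 + l); 1];
           GDh [:: 1; 2%:R^-1 * (1 + l)];
           GDh [:: 0; 1]].

(* exponents along (a, b, d) *)
Definition CGD3 (p : nat) (l : 'F_p) : rel (GD p 3) :=
  cay [set GDh [:: 0; 0; 0]; GDh [:: 1; 0; 0]; GDh [:: 0; 1; 0];
           GDh [:: - l ^+ 2; - l; - l ^+ 4];
           GDh [:: 0; 0; 1]].

(* exponents along (a, b, c, d) *)
Definition CGD4 (p : nat) : rel (GD p 4) :=
  cay [set GDh [:: 0; 0; 0; 0]; GDh [:: 1; 0; 0; 0]; GDh [:: 0; 1; 0; 0];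
           GDh [:: 0; 0; 1; 0]; GDh [:: 0; 0; 0; 1]].

End Graphs.

Arguments CGD4 : clear implicits.

Definition is_F20 (gT : finGroupType) (G : {set gT}) : bool :=
  [Frobenius G] && (#|G| == 20).

(* G = (F20 x F20) : Z_2.  As F20 is complete, the only alternative to the
   involution interchanging the factors would be F20 x F20 x Z_2. *)
Definition is_F20xF20_Z2 (gT : finGroupType) (G : {set gT}) : Prop :=
  exists K1 K2 K Q : {group gT},
    [/\ is_F20 K1, is_F20 K2, K1 \x K2 = K,
        K ><| Q = G & Q \isog [set: 'Z_2]
        /\ (exists2 x, x \in Q & K1 :^ x = K2)].

(* A = R : H for some complement H isomorphic to Q *)
Definition is_sdprod_by (gT hT : finGroupType) (A R : {group gT})
    (Q : {group hT}) : Prop :=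
  exists2 H : {group gT}, R ><| H = A & H \isog Q.

(* Main.v *)
(* A symmetric Z_p^n-cover of the dipole is described by voltages s_0, ..., s_4
   spanning Z_p^n affinely: it is the Cayley graph of the generalized dihedral
   group on the involutions (s_i, h), and the automorphisms normalizing the fibre
   group act on the s_i as affine permutations.  Arc-transitivity makes some affine
   map permute the s_i in a 5-cycle; the differences s_(i+1) - s_i are then a linear
   recurrent sequence of period 5, which leaves the listed graphs.

   Every hexagon of most of these graphs has labels a b c a b c, so that all
   automorphisms permute the labels of the edges in the same way at each vertex,
   hence normalize the regular group; the stabilizer is the group of affine
   permutations of the s_i.  That hexagons have this form is a finite check on the
   small integer relations between the s_i.  The exceptional graph, n = 2 and p = 5,
   is the incidence graph of the affine plane of order 5 with one parallel class
   removed, whose automorphisms can be computed in coordinates. *)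

Require Import Defs.
From HB Require Import structures.
From mathcomp Require Import all_boot all_algebra all_fingroup all_solvable.
From mathcomp Require Import finfield ring.

Set Implicit Arguments.
Unset Strict Implicit.
Unset Printing Implicit Defensive.

Import GRing.Theory.
Local Open Scope group_scope.

(** * Cayley graphs on five involutions *)

(** A single finite check serves infinitely many primes because the parameters are eliminated first.
    A hexagon yields an affine relation with small integer coefficients, and the relations of a
    planar or spatial family satisfy a quadratic identity free of the parameter: a vanishing sum of
    squares if [l] has order 5, a vanishing norm form x^2 + x y - y^2 in the golden case. The
    resulting integer would be a multiple of p, and it is too small or of the wrong parity for p >=
    11. Small primes escape. For n = 4, quadrangles replace hexagons at p = 2 and counts of walks
    are added at p = 3. For n = 2 and p = 5, the vector (0, 1, 2, -2, -1) is an affine relation and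
    gives hexagons with other labels. Both readings of [l] are roots of one polynomial, so they are
    classified together. Uniqueness for a given order comes from renumbering the points by i -> 2 i,
    which squares [l] and exchanges the two square roots of 5. A cover may a priori have parallel
    edges, that is, equal voltages; these are excluded only by the classification itself. *)

Section InvolutionCayley.

Variables (gT : finGroupType) (h : 'I_5 -> gT).
Hypotheses (h_inj : injective h) (h_invol : forall i, h i * h i = 1).
Hypothesis h_gen : <<[set h i | i : 'I_5]>> = [set: gT].

Let A := sAut_group (cay [set h i | i : 'I_5]).

Lemma cay_imP x y :
  reflect (exists i, y = h i * x) (cay [set h i | i : 'I_5] x y).
Proof.
apply: (iffP imsetP) => [[i _ e]|[i ->]].
  by exists i; rewrite -e mulgKV.
by exists i; rewrite ?inE ?mulgK.
Qed.

Lemma hKg i : cancel (mulg (h i)) (mulg (h i)).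
Proof. by move=> x; rewrite mulgA h_invol mul1g. Qed.

Lemma gen_ind (P : gT -> Prop) :
  P 1 -> (forall i x, P x -> P (h i * x)) -> forall x, P x.
Proof.
move=> P1 PM x.
have /gen_prodgP[n [c cS ->]] : x \in <<[set h i | i : 'I_5]>> by rewrite h_gen inE.
elim: n c cS => [|n IH] c cS; first by rewrite big_ord0.
rewrite big_ord_recl; have /imsetP[i _ ->] := cS ord0.
by apply: PM; apply: IH => j; apply: cS.
Qed.

(* The edges at [v] are labelled by [i] through their other ends [h i * v];
   an automorphism [f] permutes the labels, in a way depending on [v]. *)
Definition lab (f : {perm gT}) v i : 'I_5 :=
  odflt i [pick j | f (h i * v) == h j * f v].

Lemma autE f : f \in A ->
  forall x y, cay [set h i | i : 'I_5] (f x) (f y) = cay [set h i | i : 'I_5] x y.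
Proof. by rewrite inE => /forallP Af x y; apply/eqP/(forallP (Af x)). Qed.

Lemma labE f v i : f \in A -> f (h i * v) = h (lab f v i) * f v.
Proof.
move=> Af; rewrite /lab; case: pickP => [j /eqP //|noj].
have /cay_imP[j ej] :
    cay [set h i | i : 'I_5] (f v) (f (h i * v)).
  by rewrite autE //; apply/cay_imP; exists i.
by have := noj j; rewrite ej eqxx.
Qed.

Lemma lab_uniq f v i j : f \in A -> f (h i * v) = h j * f v -> lab f v i = j.
Proof. by move=> Af e; apply/h_inj/(mulIg (f v)); rewrite -labE. Qed.

Lemma lab_inj f v : f \in A -> injective (lab f v).
Proof.
move=> Af i j e; apply/h_inj/(mulIg v)/(@perm_inj _ f).
by rewrite !labE // e.
Qed.

Lemma lab_edge f v i : f \in A -> lab f (h i * v) i = lab f v i.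
Proof. by move=> Af; apply: lab_uniq; rewrite // hKg labE // hKg. Qed.

Definition rigid (f : {perm gT}) :=
  exists s : 'S_5, forall i g, f (h i * g) = h (s i) * f g.

Lemma rigid_step f : f \in A ->
  (forall v i j, lab f (h j * v) i = lab f v i) -> rigid f.
Proof.
move=> Af Hst; have Hc v i : lab f v i = lab f 1 i.
  by move: v i; apply: gen_ind => // j x IH i; rewrite Hst.
by exists (perm (@lab_inj f 1 Af)) => i g; rewrite permE labE // Hc.
Qed.

Lemma exists_other (a b d : 'I_5) : exists c, [&& c != a, c != b & c != d].
Proof.
have: 0 < #|~: [set a; b; d]|.
  rewrite cardsCs setCK card_ord subn_gt0 (leq_ltn_trans (leq_card_setU _ _)) //.
  by rewrite cards1 cards2; case: (a != b).
rewrite card_gt0 => /set0Pn[c]; rewrite !inE -!orbA !negb_or => Hc.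
by exists c.
Qed.

(** A product of three of these involutions is again an involution, as for reflections in a
    generalized dihedral group; hence every word a b c a b c closes up. *)
Hypothesis h_swap : forall a b c, h a * h b * h c = h c * h b * h a.

(** Two antipodal jumps, along hexagons labelled a, b, c and a, d, c, compose to the move v -> h b h
    d v. So the label of a survives this move for distinct a, b, d; five labels leave room for the
    auxiliary c. *)
Lemma rigid_hexagon f : f \in A ->
  (forall v a b c, a != b -> b != c -> a != c ->
    lab f (h c * (h b * (h a * v))) a = lab f v a) ->
  rigid f.
Proof.
move=> Af H1.
have H2 v b d a : b != d -> a != b -> a != d ->
    lab f (h b * (h d * v)) a = lab f v a.
  move=> nbd nab nad; have [c /and3P[ca cb cd]] := exists_other a b d.
  have nca : a != c by rewrite eq_sym.
  rewrite -(H1 v a b c) // 1?eq_sym //.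
  rewrite -(H1 (h c * (h b * (h a * v))) a d c) // 1?eq_sym //.
  congr (lab f _ a); rewrite !mulgA (h_swap c d a) -!mulgA hKg !mulgA.
  by rewrite (h_swap a d b) -!mulgA hKg.
apply: rigid_step => // v b d; case: (eqVneq b d) => [->|nbd].
  by rewrite lab_edge.
rewrite -(lab_edge _ _ Af).
(* The label permutations at v and at [h b * m] agree off {b, d}, so they map {b, d} to the same
   pair; the edges labelled d at v and b at [m] exclude an exchange. *)
set m := h d * v; have E : lab f m d = lab f v d by rewrite lab_edge.
have Eb : lab f (h b * m) b = lab f m b by rewrite lab_edge.
have inj_w := @lab_inj f (h b * m) Af; have inj_v := @lab_inj f v Af.
have sur_v j : exists i, lab f v i = j.
  by exists (invF inj_v j); rewrite (f_invF inj_v).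
have [i ei] := sur_v (lab f (h b * m) b).
have [eib|nib] := eqVneq i b; first by rewrite -ei eib.
have [eid|nid] := eqVneq i d.
  move: ei; rewrite eid Eb -E => /(@lab_inj f m Af) edb.
  by rewrite edb eqxx in nbd.
by move: ei; rewrite -(H2 v b d i) // => /inj_w eib; rewrite eib eqxx in nib.
Qed.

Lemma RR_mem (k : {perm gT}) : reflect (exists x, forall g, k g = g * x) (k \in RR gT).
Proof.
apply: (iffP morphimP) => [[x _ _ ->]|[x Hx]].
  by exists x => g; rewrite actpermE.
by exists x; rewrite ?inE //; apply/permP=> g; rewrite actpermE Hx.
Qed.

Lemma RR_sub : RR gT \subset A.
Proof.
apply/subsetP=> k /RR_mem[x Hk]; rewrite inE; apply/forallP=> y.
by apply/forallP=> z; rewrite !Hk /cay /= invMg mulgA mulgK.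
Qed.

Lemma RR_commute (k : {perm gT}) : (forall i g, k (h i * g) = h i * k g) -> k \in RR gT.
Proof.
move=> Hk; apply/RR_mem; exists (k 1).
by apply: gen_ind => [|i x IH]; rewrite ?mul1g // Hk IH mulgA.
Qed.

(** The conjugate of a right translation by [f] still commutes with left multiplication by each
    [h i], since [f] merely permutes these; as the [h i] generate, it is a right translation. *)
Lemma rigid_norm f : rigid f -> f \in 'N(RR gT).
Proof.
case=> s Hs; apply/normP/eqP; rewrite eqEcard cardJg leqnn andbT.
apply/subsetP=> _ /imsetP[k /RR_mem[x Hk] ->]; apply: RR_commute => i g.
rewrite conjgE !permM.
have e : f^-1 (h i * g) = h (s^-1 i) * f^-1 g.
  by apply: (@perm_inj _ f); rewrite permKV Hs !permKV.
by rewrite e !Hk -mulgA Hs permKV.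
Qed.

Definition baseN := 'C_('N_A(RR gT))[1 | 'P]%G.

Lemma baseNP (f : {perm gT}) :
  reflect [/\ f \in A, f \in 'N(RR gT) & f 1 = 1] (f \in baseN).
Proof.
rewrite !in_setI in_setT andTb [X in _ && X]inE sub1set [X in _ && X]inE.
by apply: (iffP andP) => [[/andP[-> ->] /eqP]|[-> -> /eqP]].
Qed.

(** Conjugation by [f] turns the right translation by y into another one, and evaluation at 1
    identifies it as the translation by [f y]. *)
Lemma baseN_morph f x y : f \in baseN -> f (x * y) = f x * f y.
Proof.
case/baseNP=> _ Nf f1.
have Ry : actperm 'R y \in RR gT by rewrite mem_morphim ?inE.
have := Ry; rewrite -(memJ_norm _ Nf) => /RR_mem[z Hz].
have Hf t : f (t * y) = f t * z by rewrite -Hz conjgE !permM permK actpermE.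
by rewrite Hf; have := Hf 1; rewrite f1 !mul1g => ->.
Qed.

Lemma baseN_sdprod : RR gT ><| baseN = 'N_A(RR gT).
Proof.
rewrite sdprodE; last 2 first.
- by apply/subsetP=> f /baseNP[].
- apply/trivgP/subsetP=> k; rewrite inE => /andP[/RR_mem[x Hk] /baseNP[_ _]].
  rewrite Hk mul1g => x1; apply/set1P/permP=> g.
  by rewrite Hk x1 mulg1 perm1.
apply/setP=> k; apply/mulsgP/idP => [[r f Rr Ff ->]|].
  have [Af Nf _] := baseNP _ Ff; rewrite groupM //.
    by rewrite inE (subsetP RR_sub) // (subsetP (normG _)).
  by rewrite inE Af.
(* [r] is the translation that, like [k], sends [k^-1 1] to 1, so that [r^-1 * k] fixes 1. *)
rewrite inE => /andP[Ak Nk]; set r := actperm 'R (k^-1 1)^-1.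
have Rr : r \in RR gT by rewrite mem_morphim ?inE.
exists r (r^-1 * k); rewrite ?mulKVg //.
apply/baseNP; split; first by rewrite groupM // groupV (subsetP RR_sub).
  by rewrite groupM // groupV (subsetP (normG _)).
rewrite permM -[RHS](permKV k); congr (k _).
by apply: (@perm_inj _ r); rewrite permKV actpermE /= mulgV.
Qed.

(** The value 1 outside [A] makes this a total function, as a morphism of groups requires. *)
Definition lab1 f : 'S_5 :=
  if insub f is Some u then perm (@lab_inj _ 1 (valP (u : {x | x \in A}))) else 1.

Lemma lab1E f i : f \in A -> lab1 f i = lab f 1 i.
Proof. by rewrite /lab1 => Af; case: insubP => [u _ <-|/negP//]; rewrite permE. Qed.

Lemma baseN_lab1 f i : f \in baseN -> f (h i) = h (lab1 f i).
Proof.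
case/baseNP=> Af _ f1; rewrite lab1E //.
by have := labE 1 i Af; rewrite f1 !mulg1.
Qed.

Lemma lab1M : {in baseN &, {morph lab1 : f k / f * k}}.
Proof.
move=> f k Ff Fk; apply/permP=> i; apply: h_inj.
by rewrite permM -!baseN_lab1 ?groupM // permM baseN_lab1.
Qed.
Canonical lab1_morphism := Morphism lab1M.

Lemma lab1_inj : 'injm lab1.
Proof.
apply/subsetP=> f /morphpreP[Ff /set1P f1]; apply/set1P/permP.
have [_ _ f_1] := baseNP _ Ff.
apply: gen_ind => [|i x IH]; first by rewrite f_1 perm1.
by rewrite baseN_morph // IH baseN_lab1 // f1 !perm1.
Qed.

Definition labperms := (lab1 @* baseN)%G.

Lemma baseN_isog : baseN \isog labperms.
Proof. exact: sub_isog lab1_inj. Qed.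

(** An endomorphism permuting the generators is onto, hence bijective by finiteness, and then it is
    a graph automorphism fixing 1. *)
Lemma labpermsP (s : 'S_5) :
  reflect (exists2 f : gT -> gT, {morph f : x y / x * y}
                               & forall i, f (h i) = h (s i))
          (s \in labperms).
Proof.
apply: (iffP morphimP) => [[f Ff _ ->]|[f fM fh]].
  by exists f => [x y|i]; rewrite ?baseN_morph // baseN_lab1.
have f1 : f 1 = 1 by apply: (mulgI (f 1)); rewrite -fM !mulg1.
have f_sur y : y \in codom f.
  move: y; apply: gen_ind => [|i x /codomP[y ->]].
    by apply/codomP; exists 1.
  apply/codomP; exists (h (s^-1 i) * y).
  by rewrite fM fh permKV.
have f_inj : injective f.
  apply/injectiveP/card_uniqP; rewrite size_map -cardT.
  by apply: eq_card => y; rewrite f_sur inE.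
have pE x : perm f_inj x = f x by rewrite permE.
have Fp : perm f_inj \in baseN.
  apply/baseNP; split; last by rewrite pE.
    rewrite inE; apply/forallP=> x; apply/forallP=> y; rewrite !pE; apply/eqP.
    apply/cay_imP/cay_imP => [[i e]|[i ->]]; last first.
      by exists (s i); rewrite fM fh.
    exists (s^-1 i); apply/f_inj.
    by rewrite e fM fh permKV.
  by apply: rigid_norm; exists s => i g; rewrite !pE fM fh.
exists (perm f_inj) => //; apply/permP=> i; apply: h_inj.
by rewrite -baseN_lab1 // pE fh.
Qed.

Lemma rigid_sdprod :
  (forall f, f \in A -> rigid f) -> RR gT ><| baseN = A.
Proof.
move=> Hr; rewrite baseN_sdprod; apply/setIidPl/subsetP=> f /Hr.
exact: rigid_norm.
Qed.

End InvolutionCayley.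

Section HexagonLabels.

Variables (gT : finGroupType) (h : 'I_5 -> gT).
Hypotheses (h_inj : injective h) (h_invol : forall i, h i * h i = 1).
Hypothesis h_gen : <<[set h i | i : 'I_5]>> = [set: gT].
Hypothesis h_swap : forall a b c, h a * h b * h c = h c * h b * h a.

Let A := sAut_group (cay [set h i | i : 'I_5]).

Lemma lab_adj f v i j : f \in A -> i != j -> lab h f v i != lab h f (h i * v) j.
Proof.
move=> Af nij; rewrite -(lab_edge h_inj h_invol v i Af).
by rewrite (inj_eq (lab_inj h_inj Af)).
Qed.

Lemma hexagon_closed v a b c :
  h c * (h b * (h a * (h c * (h b * (h a * v))))) = v.
Proof.
rewrite !mulgA (h_swap c b a) -!mulgA (mulgA (h c) (h c)) h_invol mul1g.
by rewrite (mulgA (h b) (h b)) h_invol mul1g mulgA h_invol mul1g.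
Qed.

Lemma hexagon_image f v a b c : f \in A -> a != b -> b != c -> a != c ->
  exists b' c' b'' c'',
    let a' := lab h f v a in
    let a'' := lab h f (h c * (h b * (h a * v))) a in
    [/\ [&& a' != b', b' != c', c' != a'', a'' != b'', b'' != c'' & c'' != a'],
        h c'' * (h b'' * (h a'' * (h c' * (h b' * h a')))) = 1
      & f (h c * (h b * (h a * v))) = h c' * (h b' * (h a' * f v))].
Proof.
move=> Af nab nbc nac.
exists (lab h f (h a * v) b), (lab h f (h b * (h a * v)) c).
set v3 := h c * _.
exists (lab h f (h a * v3) b), (lab h f (h b * (h a * v3)) c).
have nca : c != a by rewrite eq_sym.
split.
- rewrite !lab_adj //= -(lab_edge h_inj h_invol (h b * (h a * v3)) c Af).
  rewrite hexagon_closed eq_sym; apply: contra nac => /eqP.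
  by move/(lab_inj h_inj Af)->.
- apply: (mulIg (f v)); rewrite mul1g -!mulgA -!labE // -/v3.
  by rewrite hexagon_closed.
by rewrite /v3 -!labE.
Qed.

(* An automorphism maps the hexagon with labels a b c a b c to a hexagon; when
   every hexagon has this form, opposite edges keep a common label. *)
Lemma rigid_of_hexagons :
  (forall a b c d e f, [&& a != b, b != c, c != d, d != e, e != f & f != a] ->
     h f * (h e * (h d * (h c * (h b * h a)))) = 1 -> a = d) ->
  forall f, f \in A -> rigid h f.
Proof.
move=> Hhex f Af; apply: rigid_hexagon => // v a b c nab nbc nac.
have [b' [c' [b'' [c'' /= [H1 H2 _]]]]] := hexagon_image v Af nab nbc nac.
exact/esym/(Hhex _ _ _ _ _ _ H1 H2).
Qed.

(** Counting walks separates pairs of vertices that the shape of hexagons cannot; this is used for n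
    = 4 and p = 3. *)
Fixpoint walks k (v w : gT) : nat :=
  if k is k'.+1 then (\sum_(i < 5) walks k' (h i * v) w)%N else (v == w).

Lemma walks_aut f k v w : f \in A -> walks k (f v) (f w) = walks k v w.
Proof.
move=> Af; elim: k v => /= [|k IH] v; first by rewrite (inj_eq perm_inj).
rewrite [LHS](reindex_inj (lab_inj h_inj (v := v) Af)) /=.
by apply: eq_bigr => i _; rewrite -labE // IH.
Qed.

(** When the involutions commute, two labels a, b span a quadrangle a b a b, and the label of a is
    carried across it from one edge to the opposite one. *)
Lemma rigid_of_squares :
  (forall a b c d, [&& a != b, b != c, c != d & d != a] ->
     h d * (h c * (h b * h a)) = 1 -> a = c) ->
  (forall a b, h a * h b = h b * h a) ->
  forall f, f \in A -> rigid h f.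
Proof.
move=> Hsq hC f Af; apply: rigid_step => // v a b.
have [->|nab] := eqVneq a b; first by rewrite lab_edge.
have nba : b != a by rewrite eq_sym.
have v4 : h b * (h a * (h b * (h a * v))) = v.
  by rewrite (mulgA (h a)) hC -!mulgA !hKg.
have v3 : h a * (h b * (h a * v)) = h b * v.
  by rewrite (mulgA (h a)) hC -!mulgA hKg.
rewrite -v3 lab_edge //; apply/esym.
apply: (Hsq _ (lab h f (h a * v) b) _ (lab h f (h a * (h b * (h a * v))) b)).
  rewrite !lab_adj //= -(lab_edge h_inj h_invol (h a * _) b Af) v4.
  by rewrite (inj_eq (lab_inj h_inj Af)).
by apply: (mulIg (f v)); rewrite mul1g -!mulgA -!labE // v4.
Qed.

End HexagonLabels.

(** * Cayley graphs of generalized dihedral groups and affine maps of the voltages *)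

Section SumGraph.

Variables (p n : nat) (s : 'I_5 -> 'rV['F_p]_n).

Definition pt i : GD p n := (s i, true).

Lemma pt_mul i (u : 'rV['F_p]_n) b : pt i * (u, b) = (s i - u, ~~ b)%R :> GD p n.
Proof. by rewrite /mulg /= /GDmul /= expr1 scaleN1r. Qed.

Lemma pt_invol i : pt i * pt i = 1.
Proof. by rewrite pt_mul subrr. Qed.

Lemma pt_swap a b c : pt a * pt b * pt c = pt c * pt b * pt a.
Proof.
have E x y z : pt x * (pt y * pt z) = (s x - (s y - s z), true)%R :> GD p n.
  by rewrite [pt z]/pt 2!pt_mul.
by rewrite -!mulgA !E; congr pair; rewrite !opprB !addrA (addrC (s a)).
Qed.

Lemma pt_inj : injective s -> injective pt.
Proof. by move=> s_inj i j [/s_inj]. Qed.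

Definition spanning := row_full (\matrix_i (s i - s ord0))%R.

Definition affperm (t : 'S_5) :=
  exists M : 'M_n, exists c : 'rV_n, forall i, s (t i) = (s i *m M + c)%R.

End SumGraph.

Section Additive.

Variables (p n m : nat) (T : 'rV['F_p]_n -> 'rV['F_p]_m).
Hypothesis TD : forall u v, T (u + v)%R = (T u + T v)%R.

Lemma additive_mx : exists M : 'M['F_p]_(n, m), forall u, T u = (u *m M)%R.
Proof.
have T0 : T 0%R = 0%R by apply: (addrI (T 0%R)); rewrite -TD !addr0.
have TZ (a : 'F_p) u : T (a *: u)%R = (a *: T u)%R.
  rewrite -[a]natr_Zp !scaler_nat; elim: (a : nat) => [|k IH].
    by rewrite !mulr0n.
  by rewrite !mulrS TD IH.
exists (\matrix_i T (delta_mx 0 i))%R => u.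
rewrite mulmx_sum_row [in LHS](row_sum_delta u) (big_morph T TD T0).
by apply: eq_bigr => i _; rewrite TZ rowK.
Qed.

End Additive.

Definition tr p n (u : 'rV['F_p]_n) : GD p n := (u, false).

Lemma trM p n (u v : 'rV['F_p]_n) : tr (u + v)%R = tr u * tr v.
Proof. by rewrite /mulg /= /GDmul /= expr0 scale1r. Qed.

Section SumGraphTheory.

Variables (p n : nat) (s : 'I_5 -> 'rV['F_p]_n).
Hypothesis s_span : spanning s.

Lemma spanning_sum (u : 'rV['F_p]_n) :
  exists x : 'I_5 -> 'F_p, u = (\sum_i x i *: (s i - s ord0))%R.
Proof.
have /submxP[x ->] : (u <= (\matrix_i (s i - s ord0))%R)%MS by apply: submx_full.
exists (x ord0); rewrite mulmx_sum_row; apply: eq_bigr => i _.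
by rewrite rowK.
Qed.

Lemma pt_pt i j : pt s i * pt s j = tr (s i - s j)%R.
Proof. exact: pt_mul. Qed.

Lemma pt_gen : <<[set pt s i | i : 'I_5]>> = [set: GD p n].
Proof.
pose W := <<[set pt s i | i : 'I_5]>>%G; rewrite -[LHS]/(gval W).
have Wpt i : pt s i \in W by rewrite mem_gen ?imset_f.
have WD u v : tr u \in W -> tr v \in W -> tr (u + v)%R \in W.
  by move=> Wu Wv; rewrite trM groupM.
have W0 : @tr p n 0%R \in W by apply: group1.
have Wall u : tr u \in W.
  have [x ->] := spanning_sum u.
  apply: (big_ind (fun u => tr u \in W)) => // i _.
  have Wi : tr (s i - s ord0)%R \in W.
    by rewrite -pt_pt groupM.
  rewrite -[x i]natr_Zp scaler_nat; elim: (x i : nat) => [|k IH].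
    by rewrite mulr0n.
  by rewrite mulrS WD.
apply/eqP; rewrite eqEsubset subsetT; apply/subsetP=> [[u []]] _; last exact: Wall.
by rewrite (_ : (u, true) = pt s ord0 * tr (s ord0 - u)%R) ?groupM // pt_mul subKr.
Qed.

(** Extends the affine map u -> u M + c of the voltages to the group: translations follow the linear
    part, and c enters only on the coset of involutions. *)
Definition GDaff (M : 'M['F_p]_n) (c : 'rV['F_p]_n) (x : GD p n) : GD p n :=
  (x.1 *m M + c *+ x.2, x.2)%R.

Lemma GDaffM M c : {morph GDaff M c : x y / x * y}.
Proof.
move=> [u a] [v b]; rewrite /GDaff /mulg /= /GDmul /=; congr pair.
rewrite mulmxDl -scalemxAl scalerDr -!addrA; congr (_ + _)%R.
rewrite addrCA; congr (_ + _)%R.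
by case: a; case: b => /=;
   rewrite ?expr0 ?expr1 ?scale1r ?scaleN1r ?mulr1n ?mulr0n ?subrr ?oppr0 ?addr0 ?add0r.
Qed.

(** An endomorphism that permutes the involutions maps the products [pt s i * pt s j], which
    generate the translations, to translations; it is additive there, hence a matrix. *)
Lemma labperms_affperm (s_inj : injective s) (t : 'S_5) :
  t \in labperms (pt_inj s_inj) <-> affperm s t.
Proof.
split=> [/(labpermsP (pt_inj s_inj) pt_gen)[f fM fpt]|[M [c sE]]].
  pose g u := f (tr u).
  have gD u v : g (u + v)%R = g u * g v by rewrite /g trM fM.
  have gE i : g (s i - s ord0)%R = tr (s (t i) - s (t ord0))%R.
    by rewrite /g -pt_pt fM (fpt ord0) fpt pt_pt.
  have g2 u : (g u).2 = false.
    have [x ->] := spanning_sum u.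
    have gg0 : g 0%R = 1 by apply: (mulgI (g 0%R)); rewrite -gD addr0 mulg1.
    apply: (big_ind (fun u => (g u).2 = false)) => [|v w Hv Hw|i _].
    - by rewrite gg0.
    - by rewrite gD /= /mulg /= Hv Hw.
    rewrite -[x i]natr_Zp scaler_nat; elim: (x i : nat) => [|k IH].
      by rewrite mulr0n gg0.
    by rewrite mulrS gD /mulg /= IH gE.
  have TD u v : (g (u + v)%R).1 = ((g u).1 + (g v).1)%R.
    by rewrite gD /mulg /= g2 expr0 scale1r.
  have [M HM] := additive_mx TD.
  exists M, (s (t ord0) - s ord0 *m M)%R => i.
  have := HM (s i - s ord0)%R; rewrite gE /= mulmxBl => e.
  by rewrite addrC addrAC -addrA -e addrC subrK.
apply/(labpermsP (pt_inj s_inj) pt_gen).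
exists (GDaff M c); first exact: GDaffM.
by move=> i; rewrite /GDaff /pt /= mulr1n -sE.
Qed.

Lemma affperm_rel (t : 'S_5) (k : 'I_5 -> 'F_p) : affperm s t ->
  (\sum_i k i = 0 -> \sum_i k i *: s i = 0 -> \sum_i k i *: s (t i) = 0)%R.
Proof.
case=> M [c sE] k0 ks; under eq_bigr do rewrite sE scalerDr scalemxAl.
by rewrite big_split /= -mulmx_suml ks mul0mx add0r -scaler_suml k0 scale0r.
Qed.

End SumGraphTheory.

Section HexFree.

Variables (p n : nat).
Implicit Types s : 'I_5 -> 'rV['F_p]_n.

(** Each involution negates the vector part, so a closed walk of length six is an alternating sum of
    six voltages. *)
Definition hex_free s := forall a b c d e f,
  [&& a != b, b != c, c != d, d != e, e != f & f != a] ->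
  (s a + s c + s e = s b + s d + s f)%R -> a = d.

Lemma alternating6 (V : zmodType) (a b c d e f : V) :
  (f - (e - (d - (c - (b - a)))) = f + d + b - (e + c + a))%R.
Proof. by rewrite !opprD !opprK !addrA [LHS](ACl (1*3*5*2*4*6)%AC). Qed.

Definition affeq s s' := exists M : 'M['F_p]_n, exists c : 'rV['F_p]_n,
  M \in unitmx /\ forall i, s' i = (s i *m M + c)%R.

Lemma affeq_sym s s' : affeq s s' -> affeq s' s.
Proof.
case=> M [c [Mu sE]]; exists (invmx M), (- c *m invmx M)%R.
split=> [|i]; first by rewrite unitmx_inv.
by rewrite -mulmxDl sE addrK mulmxK.
Qed.

Lemma affeq_inj s s' : affeq s s' -> injective s' -> injective s.
Proof. by case=> M [c [_ sE]] Hs i j e; apply: Hs; rewrite !sE e. Qed.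

Lemma affeq_affperm s s' t : affeq s s' -> affperm s t -> affperm s' t.
Proof.
case=> M [c [Mu sE]] [N [d tE]]; exists (invmx M *m N *m M)%R.
exists (d *m M + c - c *m (invmx M *m N *m M))%R => i.
rewrite [in RHS]sE mulmxDl !mulmxA mulmxK // -[RHS]addrA [(_ + (_ - _))%R]addrC.
by rewrite subrK sE tE mulmxDl addrA.
Qed.

Lemma hex_free_rigid s : spanning s -> injective s -> hex_free s ->
  forall f, f \in sAut_group (cay [set pt s i | i : 'I_5]) -> rigid (pt s) f.
Proof.
move=> s_span s_inj Hs.
apply: (rigid_of_hexagons (pt_inj s_inj) (pt_invol s) (pt_gen s_span) (pt_swap s)).
move=> a b c d e f Hd H1; apply: (Hs a b c d e f Hd).
have := congr1 (fun x : GD p n => x.1) H1.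
rewrite pt_pt /tr !pt_mul /= !expr1 !scaleN1r alternating6 => /eqP.
rewrite subr_eq0 => /eqP e6.
rewrite -(addrC (s e)) (addrC (s a)) addrA -e6 addrC addrA (addrC (s b)).
by rewrite addrAC (addrC (s f)) addrAC (addrC (s d)).
Qed.

End HexFree.

(** * Covers of the dipole *)

Lemma miso_sym X Y : miso X Y -> miso Y X.
Proof.
case=> fV [fE [[gV fVK gVK] [gE fEK gEK] fP]].
exists gV, gE; split; [by exists fV|by exists fE|move=> e].
rewrite -[in RHS](gEK e) fP -imset_comp -[LHS]imset_id.
by apply: eq_imset => v; rewrite /= fVK.
Qed.

Lemma miso_trans X Y Z : miso X Y -> miso Y Z -> miso X Z.
Proof.
case=> fV [fE [fVb fEb fP]] [gV [gE [gVb gEb gP]]].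
exists (gV \o fV), (gE \o fE); split; [exact: bij_comp|exact: bij_comp|move=> e].
by rewrite /= gP fP -imset_comp.
Qed.

(** Injectivity of [ends] excludes parallel edges, so an edge can be recovered from the pair of its
    ends. *)
Lemma miso_mgraph_of (T : finType) (adj : rel T) (X : mgraph)
    (f : T -> vert X) :
    bijective f -> (forall x y, adj x y -> x != y) ->
    (forall x y, adj x y -> exists e : edge X, ends e = [set f x; f y]) ->
    (forall e : edge X, exists x y, adj x y /\ ends e = [set f x; f y]) ->
    injective (@ends X) ->
  miso (mgraph_of adj) X.
Proof.
move=> f_bij adjN fP edgeP ends_inj; have f_inj := bij_inj f_bij.
have ex (A : sedge adj) : exists e : edge X, ends e == f @: val A.
  case: A => A /= /existsP[x /existsP[y /and3P[_ xy /eqP->]]].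
  by have [e ee] := fP _ _ xy; exists e; rewrite imsetU1 imset_set1 ee.
exists f, (fun A => xchoose (ex A)); split=> // [|A]; last exact/eqP/(xchooseP (ex A)).
have ex' (e : edge X) : {A : sedge adj | ends e == f @: val A}.
  apply: sigW; have [x [y [xy ee]]] := edgeP e.
  have sA : sedge_pred adj [set x; y].
    by apply/existsP; exists x; apply/existsP; exists y; rewrite adjN ?xy /=.
  by exists (Sub _ sA); rewrite /= imsetU1 imset_set1 ee.
exists (fun e => sval (ex' e)) => [A|e].
  apply/val_inj/(imset_inj f_inj); rewrite -(eqP (svalP (ex' _))).
  exact/eqP/(xchooseP (ex A)).
by apply: ends_inj; rewrite (eqP (xchooseP (ex _))) -(eqP (svalP (ex' e))).
Qed.

Lemma cay_pt_adj p n (s : 'I_5 -> 'rV['F_p]_n) (x y : GD p n) :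
  reflect (exists2 i, y.1 = s i - x.1 & y.2 = ~~ x.2)%R
          (cay [set pt s i | i : 'I_5] x y).
Proof.
apply: (iffP (cay_imP _ _ _)) => [[i ->]|[i e1 e2]]; exists i.
- by case: x => u b; rewrite pt_mul.
- by case: x => u b; rewrite pt_mul.
by case: x y e1 e2 => [u b] [v c] /= -> ->; rewrite pt_mul.
Qed.

Lemma cay_pt_neq p n (s : 'I_5 -> 'rV['F_p]_n) (x y : GD p n) :
  cay [set pt s i | i : 'I_5] x y -> x != y.
Proof.
by case/cay_pt_adj=> i _ e2; apply/eqP=> exy; move: e2; rewrite exy; case: (y.2).
Qed.

Lemma affeq_miso p n (s s' : 'I_5 -> 'rV['F_p]_n) : affeq s s' ->
  miso (mgraph_of (cay [set pt s i | i : 'I_5]))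
       (mgraph_of (cay [set pt s' i | i : 'I_5])).
Proof.
case=> M [c [Mu sE]].
pose g (y : GD p n) : GD p n := ((y.1 - c *+ y.2) *m invmx M, y.2)%R.
have gK : cancel (GDaff M c) g.
  by case=> u b; rewrite /g /GDaff /= addrK mulmxK.
have Kg : cancel g (GDaff M c).
  by case=> u b; rewrite /g /GDaff /= mulmxKV // subrK.
have adjE x y : cay [set pt s' i | i : 'I_5] (GDaff M c x) (GDaff M c y) =
                cay [set pt s i | i : 'I_5] x y.
  have aE i z : GDaff M c (pt s i * z) = pt s' i * GDaff M c z.
    by rewrite GDaffM; congr (_ * _); rewrite /GDaff /pt /= mulr1n -sE.
  apply/cay_imP/cay_imP=> [[i]|[i ->]]; exists i; rewrite ?aE //.
  by apply: (can_inj gK); rewrite aE.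
apply: (@miso_mgraph_of _ _ (mgraph_of (cay [set pt s' i | i : 'I_5])) (GDaff M c)).
- by exists g.
- exact: cay_pt_neq.
- move=> x y xy.
  have sA : sedge_pred (cay [set pt s' i | i : 'I_5]) [set GDaff M c x; GDaff M c y].
    apply/existsP; exists (GDaff M c x); apply/existsP; exists (GDaff M c y).
    by rewrite (inj_eq (can_inj gK)) (cay_pt_neq xy) adjE xy /=.
  by exists (Sub _ sA).
- case=> A /= sA; have /existsP[x /existsP[y /and3P[_ xy /eqP->]]] := sA.
  by exists (g x), (g y); rewrite -adjE !Kg.
exact: val_inj.
Qed.

Lemma cay_perm p n (s : 'I_5 -> 'rV['F_p]_n) (t : 'I_5 -> 'I_5) : injective t ->
  [set pt (s \o t) i | i : 'I_5] = [set pt s i | i : 'I_5].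
Proof.
move=> t_inj; apply/setP=> x; apply/imsetP/imsetP=> [[i _ ->]|[i _ ->]].
  by exists (t i).
by exists (invF t_inj i) => //; rewrite /pt /= f_invF.
Qed.

Definition rows p n (r : seq (seq 'F_p)) (i : 'I_5) : 'rV['F_p]_n :=
  (\row_j (nth [::] r i)`_j)%R.

Lemma cay_rows p n (r0 r1 r2 r3 r4 : seq 'F_p) :
  [set pt (@rows p n [:: r0; r1; r2; r3; r4]) i | i : 'I_5] =
  [set GDh r0; GDh r1; GDh r2; GDh r3; GDh r4].
Proof.
apply/setP=> x; rewrite !inE; apply/imsetP/idP=> [[[[|[|[|[|[|//]]]]] Hi] _ ->]|].
- by rewrite eqxx.
- by rewrite eqxx ?orbT.
- by rewrite eqxx ?orbT.
- by rewrite eqxx ?orbT.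
- by rewrite eqxx ?orbT.
case/orP=> [/orP[/orP[/orP[]|]|]|] /eqP->.
- by exists (@Ordinal 5 0 isT).
- by exists (@Ordinal 5 1 isT).
- by exists (@Ordinal 5 2 isT).
- by exists (@Ordinal 5 3 isT).
- by exists (@Ordinal 5 4 isT).
Qed.

Lemma set2_eqP (T : finType) (u v a b : T) : u != v -> [set u; v] = [set a; b] ->
  (u = a /\ v = b) \/ (u = b /\ v = a).
Proof.
move=> nuv e; have := set21 u v; have := set22 u v; rewrite e !inE.
case/orP=> /eqP ev /orP[] /eqP eu; [|by right|by left|];
  by move: nuv; rewrite eu ev eqxx.
Qed.

Section DipoleCover.

Variables (p n : nat) (X : mgraph).
Variables (fV : vert X -> bool) (fE : edge X -> 'I_5).
Variable N : {group {perm vert X} * {perm edge X}}.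
Hypothesis cov : @covering X (dipole 5) fV fE.
Hypothesis N_aut : N \subset mAut X.
Hypothesis N_semireg : semiregular_on_vertices N.
Hypothesis N_orbits : @orbits_are_fibres X (dipole 5) fV fE N.
Variable nu : 'rV['F_p]_n -> {perm vert X} * {perm edge X}.
Hypothesis nuD : forall u v, nu (u + v)%R = nu u * nu v.
Hypothesis nu_inj : injective nu.
Hypothesis nuN : forall g, g \in N <-> exists u, g = nu u.
Hypothesis X_conn : mconnected X.
Hypothesis arcs : arc_transitive 'N_(mAut X)(N).

Let nu_in u : nu u \in N. Proof. by apply/nuN; exists u. Qed.

Lemma aut_ends g e : g \in mAut X -> ends (g.2 e) = g.1 @: ends e.
Proof. by rewrite inE => /forallP/(_ e)/eqP. Qed.

Lemma cover_edge_ends e v : v \in ends e ->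
  exists w, ends e = [set v; w] /\ fV w = ~~ fV v.
Proof.
case: cov => Hends _ _ ve.
have /imsetP[w we fw] : ~~ fV v \in fV @: ends e by rewrite -Hends inE.
exists w; split=> //; apply/eqP; rewrite eq_sym eqEcard card_ends cards2.
have -> /= : v != w by apply: contraTneq isT => evw; move: fw; rewrite evw; case: (fV w).
by rewrite andbT; apply/subsetP=> x; rewrite !inE => /orP[] /eqP->.
Qed.

Lemma edge_uniq v e e' : v \in ends e -> v \in ends e' -> fE e = fE e' -> e = e'.
Proof.
case: cov => _ _ Huniq ve ve' ee.
have [|e0 [_ U]] := Huniq v (fE e); first by rewrite inE.
by rewrite -(U e) // -(U e').
Qed.

Lemma fV_nu u v : fV ((nu u).1 v) = fV v.
Proof. by case: N_orbits => + _ _ => /(_ v ((nu u).1 v))[H _]; rewrite H //; exists (nu u). Qed.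

Lemma fE_nu u e : fE ((nu u).2 e) = fE e.
Proof. by case: N_orbits => _ + _ => /(_ e ((nu u).2 e))[H _]; rewrite H //; exists (nu u). Qed.

Lemma nu_move v w : fV v = fV w -> exists u, (nu u).1 v = w.
Proof.
case: N_orbits => + _ _ => /(_ v w)[_ H] /H[g /nuN[u ->] e].
by exists u.
Qed.

Lemma nu_free u u' v : (nu u).1 v = (nu u').1 v -> u = u'.
Proof.
move=> e; apply: nu_inj; apply: (mulIg (nu u')^-1); rewrite mulgV.
have gN : nu u * (nu u')^-1 \in N by rewrite groupM ?groupV.
by apply: (N_semireg gN (v := v)); rewrite permM e permK.
Qed.

Lemma nu_nu u v x : (nu u).1 ((nu v).1 x) = (nu (v + u)%R).1 x.
Proof.
have -> : (nu (v + u)%R).1 = (nu v).1 * (nu u).1 by rewrite nuD.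
by rewrite permM.
Qed.

(** Injectivity of the voltages stays a premise: it expresses that [X] has no parallel edges, and
    becomes available only after the voltages are classified. *)
Lemma dipole_cover_voltage :
  exists s : 'I_5 -> 'rV['F_p]_n,
    [/\ spanning s, forall i, exists2 t, affperm s t & t ord0 = i
      & injective s -> miso X (mgraph_of (cay [set pt s i | i : 'I_5]))].
Proof.
have [_ fV_sur lift] := cov.
have [v0 fv0] := fV_sur false; have [w0 fw0] := fV_sur true.
(* The sign on the fibre of [true] makes [nu u] act through [th] as right multiplication by
   [tr u]. *)
pose th (x : GD p n) :=
  if x.2 then (nu (- x.1)).1 w0 else (nu x.1).1 v0.
have fth x : fV (th x) = x.2.
  by rewrite /th; case: (x.2); rewrite fV_nu.
have th_inj : injective th.
  move=> [u a] [v b] e; have := congr1 fV e; rewrite !fth /= => eab.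
  move: e; rewrite eab /th /=; case: b {eab} => /nu_free; last by move->.
  by move/oppr_inj->.
have th_sur v : exists x, th x = v.
  case fv: (fV v).
    have [|u eu] := @nu_move w0 v; first by rewrite fw0.
    by exists (- u, true)%R; rewrite /th /= opprK.
  have [|u eu] := @nu_move v0 v; first by rewrite fv0.
  by exists (u, false).
have nu_th u x : (nu u).1 (th x) = th (if x.2 then x.1 - u else x.1 + u, x.2)%R.
  by rewrite /th; case: x => v [] /=; rewrite nu_nu // opprB addrC.
have ex_e (i : 'I_5) : exists e : edge X, v0 \in ends e /\ fE e = i.
  by have [|e [He _]] := lift v0 i; [rewrite inE | exists e].
have [ei Hei] := fin_all_exists ex_e.
have ex_s i : exists u, ends (ei i) = [set v0; th (u, true)].
  have [w [-> fw]] := cover_edge_ends (Hei i).1.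
  have [[u b] ew] := th_sur w; exists u; congr [set _; _]; rewrite -ew.
  by move: fw; rewrite -ew fth fv0 /= => ->.
have [s Hs] := fin_all_exists ex_s.
have v0E : v0 = th (0, false)%R.
  by rewrite /th /=; have := nuD 0%R 0%R; rewrite addr0 -[LHS]mulg1 => /mulgI <-; rewrite perm1.
have ends_nu u i : ends ((nu u).2 (ei i)) = [set th (u, false); th (s i - u, true)%R].
  rewrite aut_ends ?(subsetP N_aut) // Hs imsetU1 imset_set1 nu_th v0E nu_th /=.
  by rewrite add0r.
have edgeE e : exists u i, e = (nu u).2 (ei i).
  have [v ve fv] : exists2 v, v \in ends e & fV v = false.
    have /set0Pn[v ve] : ends e != set0 by rewrite -card_gt0 card_ends.
    have [w [ee fw]] := cover_edge_ends ve.
    case fv: (fV v); last by exists v.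
    by exists w; [rewrite ee set22|rewrite fw fv].
  have [[u b] ev] := th_sur v; exists u, (fE e).
  apply: (edge_uniq (v := v)) => //; last by rewrite fE_nu (Hei _).2.
  by rewrite ends_nu -ev; move: fv; rewrite -ev fth /= => ->; rewrite set21.
have sp : spanning s.
  set W := (\matrix_i (s i - s ord0))%R.
  have W_i i : ((s i - s ord0)%R <= W)%MS by rewrite -(rowK (fun i => s i - s ord0)%R) row_sub.
  (* Walking along edges never leaves the vertices whose coordinate, measured from [s ord0] on the
     second fibre, lies in [W]; by connectedness these are all vertices. *)
  pose P v := exists x : GD p n, v = th x /\
    ((if x.2 then x.1 - s ord0 else x.1)%R <= W)%MS.
  have Pstep v w : @madj X v w -> P v -> P w.
    case/existsP=> e /eqP ee [x [ex Wx]].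
    have [u [i eui]] := edgeE e; move: ee; rewrite eui ends_nu => ee.
    have nvw : th (u, false) != th (s i - u, true)%R by rewrite (inj_eq th_inj) xpair_eqE andbF.
    case: (set2_eqP nvw ee) => [[e1 e2]|[e1 e2]].
      exists (s i - u, true)%R; split=> //=.
      move: ex Wx; rewrite -e1 => /th_inj <- /= Wu.
      by rewrite addrAC; rewrite addmx_sub // eqmx_opp.
    exists (u, false)%R; split=> //=.
    move: ex Wx; rewrite -e2 => /th_inj <- /= Wu.
    have -> : u = ((s i - s ord0) - (s i - u - s ord0))%R.
      by rewrite [(s i - u - _)%R]addrAC subKr.
    by rewrite addmx_sub // eqmx_opp.
  have Pall v : P v.
    have P0 : P v0 by exists (0, false)%R; rewrite v0E sub0mx.
    have Plast (q : seq (vert X)) (x : vert X) : P x -> path (@madj X) x q -> P (last x q).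
      elim: q x => //= y q IH x Px /andP[xy yq].
      exact: IH (Pstep _ _ xy Px) yq.
    by have /connectP[q pq ->] := X_conn v0 v; apply: Plast.
  rewrite /spanning -sub1mx; apply/row_subP=> i.
  by have [x [/th_inj <- /=]] := Pall (th (row i 1%:M, false)%R).
exists s; split=> // [i|s_inj].
  (* [g] fixes [v0] and normalizes [N], on which it acts by an additive map [T]; it also permutes
     the five edges at [v0]. Together these say that it permutes the voltages by an affine map with
     linear part [T]. *)
  have [g] := arcs (Hei ord0).1 (Hei i).1.
  rewrite inE => /andP[Ag Ng] [gv0 ge0].
  have ex_T u : exists u', nu u ^ g = nu u' by apply/nuN; rewrite memJ_norm.
  have [T HT] := fin_all_exists ex_T.
  have TD u v : T (u + v)%R = (T u + T v)%R.
    by apply: nu_inj; rewrite nuD -!HT nuD conjMg.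
  have [M TM] := additive_mx TD.
  have g_nu u x : g.1 ((nu u).1 x) = (nu (T u)).1 (g.1 x).
    have /(congr1 (fun k : {perm vert X} * {perm edge X} => k.1 x)) :
      nu u * g = g * nu (T u) by rewrite -HT conjgC.
    by rewrite /= !permM.
  have g_ei j : v0 \in ends (g.2 (ei j)).
    by rewrite aut_ends // -gv0 imset_f // (Hei j).1.
  have g_eiE j : g.2 (ei j) = ei (fE (g.2 (ei j))).
    by apply: (edge_uniq (v := v0)); rewrite // ?(Hei _).1 ?(Hei _).2.
  have t_inj : injective (fun j => fE (g.2 (ei j))).
    move=> j k e; rewrite -(Hei j).2 -(Hei k).2; congr fE.
    by apply: (@perm_inj _ g.2); rewrite g_eiE [RHS]g_eiE e.
  have g_s j : g.1 (th (s j, true)) = th (s (fE (g.2 (ei j))), true).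
    have nE k : v0 != th (s k, true) by rewrite v0E (inj_eq th_inj) xpair_eqE andbF.
    have := aut_ends (ei j) Ag; rewrite [in LHS]g_eiE !Hs imsetU1 imset_set1 gv0.
    case/(set2_eqP (nE _)) => [[_ <-]|[_ e]] //.
    by move: (nE (fE (g.2 (ei j)))); rewrite e eqxx.
  exists (perm t_inj); last by rewrite permE ge0 (Hei i).2.
  exists M, (s i - T (s ord0))%R => j; rewrite permE -TM.
  have := g_s j; have -> : th (s j, true) = (nu (s ord0 - s j)%R).1 (th (s ord0, true)).
    by rewrite nu_th /= subKr.
  rewrite g_nu g_s ge0 (Hei i).2 nu_th /= => /th_inj [<-].
  have TN u : T (- u)%R = (- T u)%R by rewrite !TM mulNmx.
  by rewrite TD TN opprD opprK addrA addrC.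
apply: miso_sym; apply: (miso_mgraph_of (f := th)).
- have [th' Hth'] := fin_all_exists th_sur.
  by exists th' => x; [apply: th_inj; rewrite Hth'|].
- exact: cay_pt_neq.
- move=> [u []] [v b] /cay_pt_adj[i /= -> ->].
    by exists ((nu (s i - u)).2 (ei i))%R; rewrite ends_nu subKr setUC.
  by exists ((nu u).2 (ei i)); rewrite ends_nu.
- move=> e; have [u [i ->]] := edgeE e.
  exists (u, false), (s i - u, true)%R; split; last exact: ends_nu.
  by apply/cay_pt_adj; exists i.
move=> e e'; have [u [i ->]] := edgeE e; have [u' [i' ->]] := edgeE e'.
rewrite !ends_nu => ee.
have nvw : th (u, false) != th (s i - u, true)%R by rewrite (inj_eq th_inj) xpair_eqE andbF.
case: (set2_eqP nvw ee) => [[/th_inj[<-] /th_inj[]]|[/th_inj //]].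
by move/addIr/s_inj->.
Qed.

End DipoleCover.

Lemma symmetric_cover_voltage (p n : nat) (X : mgraph) :
  mconnected X -> symmetric_cover [set: 'rV['F_p]_n]%G X (dipole 5) ->
  exists s : 'I_5 -> 'rV['F_p]_n,
    [/\ spanning s, forall i, exists2 t, affperm s t & t ord0 = i
      & injective s -> miso X (mgraph_of (cay [set pt s i | i : 'I_5]))].
Proof.
move=> X_conn [fV [fE [N [[cov N_aut N_free N_orb] N_isog arcs]]]].
have /isogP[f f_inj fN] := isog_symr N_isog.
apply: (dipole_cover_voltage cov N_aut N_free N_orb (nu := f)) => //.
- by move=> u v; rewrite -morphM ?inE.
- by move=> u v e; apply: (injmP f_inj); rewrite ?inE.
move=> g; split=> [|[u ->]]; last by rewrite -fN mem_morphim ?inE.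
by rewrite -fN => /morphimP[u _ _ ->]; exists u.
Qed.

(** * Affine symmetries and the classification *)

Notation o0 := (@Ordinal 5 0 isT).
Notation o1 := (@Ordinal 5 1 isT).
Notation o2 := (@Ordinal 5 2 isT).
Notation o3 := (@Ordinal 5 3 isT).
Notation o4 := (@Ordinal 5 4 isT).

Lemma sum5 (V : nmodType) (F : 'I_5 -> V) :
  (\sum_i F i = F o0 + F o1 + F o2 + F o3 + F o4)%R.
Proof.
rewrite !big_ord_recr big_ord0 /= add0r.
by congr (F _ + F _ + F _ + F _ + F _)%R; apply/val_inj.
Qed.

Lemma ord5_ind (P : 'I_5 -> Prop) : P o0 -> P o1 -> P o2 -> P o3 -> P o4 -> forall i, P i.
Proof.
move=> P0 P1 P2 P3 P4 [[|[|[|[|[|//]]]]] Hi].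
- by rewrite (bool_irrelevance Hi isT).
- by rewrite (bool_irrelevance Hi isT).
- by rewrite (bool_irrelevance Hi isT).
- by rewrite (bool_irrelevance Hi isT).
by rewrite (bool_irrelevance Hi isT).
Qed.

Section AffinePerms.

Variables (p n : nat).
Implicit Types s : 'I_5 -> 'rV['F_p]_n.

Definition affine_rel s (x : 'I_5 -> 'F_p) :=
  (\sum_i x i = 0 /\ \sum_i x i *: s i = 0)%R.

(** Corrects the coefficient at [ord0] so that the total becomes 0: a combination of differences is
    thereby an affine relation among the points. *)
Definition shift0 (x : 'I_5 -> 'F_p) i := (x i - (\sum_j x j) *+ (i == ord0))%R.

Lemma sum_shift0 x : (\sum_i shift0 x i = 0)%R.
Proof.
rewrite sumrB; set S := (\sum_i x i)%R.
rewrite (bigD1 ord0) //= big1 ?addr0 ?mulr1n ?subrr //.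
by move=> i /negPf->.
Qed.

Lemma sum_shift (r : 'I_5 -> 'rV['F_p]_n) x :
  (\sum_i x i *: (r i - r ord0) = \sum_i shift0 x i *: r i)%R.
Proof.
have e0 : (\sum_(i < 5) ((\sum_j x j) *+ (i == ord0)) *: r i = \sum_i x i *: r ord0)%R.
  rewrite (bigD1 ord0) //= mulr1n -scaler_suml; set S := (\sum_i x i)%R.
  rewrite big1 ?addr0 //.
  by move=> i /negPf->; rewrite mulr0n scale0r.
under [RHS]eq_bigr do rewrite scalerBl.
under [LHS]eq_bigr do rewrite scalerBr.
by rewrite [LHS]sumrB [RHS]sumrB e0.
Qed.

Lemma spanningP s :
  spanning s <-> forall u, exists x, (\sum_i x i = 0 /\ u = \sum_i x i *: s i)%R.
Proof.
split=> [/spanning_sum sp u|sp].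
  have [x ->] := sp u.
  by exists (shift0 x); rewrite sum_shift0 sum_shift.
rewrite /spanning -sub1mx; apply/row_subP=> i; have [x [x0 ->]] := sp (row i 1%:M)%R.
have -> : (\sum_i x i *: s i = \sum_i x i *: (s i - s ord0))%R.
  under [RHS]eq_bigr do rewrite scalerBr.
  by rewrite sumrB -scaler_suml x0 scale0r subr0.
apply: summx_sub => j _; apply: scalemx_sub.
by rewrite -(rowK (fun i => s i - s ord0)%R) row_sub.
Qed.

Lemma spanning_perm s (t : 'I_5 -> 'I_5) : injective t -> spanning s -> spanning (s \o t).
Proof.
move=> t_inj /spanningP sp; apply/spanningP=> u; have [x [x0 ->]] := sp u.
exists (x \o t); split; last by rewrite [LHS](reindex_inj t_inj).
by rewrite -[RHS]x0 [RHS](reindex_inj t_inj).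
Qed.

(** Relations are the left kernel of the matrix of differences, so the inclusion of kernels makes
    [B'] factor through [B], and spanning of [s'] makes the factor invertible. Affine equivalence is
    thus reduced to comparing relations. *)
Lemma affeq_rel s s' : spanning s -> spanning s' ->
  (forall x, affine_rel s x -> affine_rel s' x) -> affeq s s'.
Proof.
move=> sp sp' Hrel.
set B := (\matrix_i (s i - s ord0))%R; set B' := (\matrix_i (s' i - s' ord0))%R.
have mulB (r : 'I_5 -> 'rV['F_p]_n) (x : 'rV['F_p]_5) :
    (x *m (\matrix_i (r i - r ord0)) = \sum_i shift0 (x 0) i *: r i)%R.
  by rewrite mulmx_sum_row -sum_shift; apply: eq_bigr => i _; rewrite rowK.
(* [pinvmx B] is a left inverse of [B], so the rows of 1 - B pinvmx B give relations of [s], hence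
   of [s']. *)
have BM : (B *m (pinvmx B *m B') = B')%R.
  apply/eqP; rewrite -subr_eq0 mulmxA -[X in (_ - X)%R]mul1mx -mulmxBl; apply/eqP/row_matrixP=> i.
  rewrite row_mul row0; set x := row i _.
  have xB : (x *m B = 0)%R.
    by rewrite -row_mul mulmxBl mul1mx -mulmxA mulVpmx // mulmx1 subrr row0.
  rewrite mulB; have [] // := Hrel (shift0 (x 0%R)).
  by rewrite /affine_rel sum_shift0 -mulB xB.
exists (pinvmx B *m B')%R, (s' ord0 - s ord0 *m (pinvmx B *m B'))%R; split.
  rewrite -row_full_unit -sub1mx (submx_trans _ (submxMl B _)) // BM sub1mx; exact: sp'.
move=> i; have := congr1 (row i) BM; rewrite row_mul !rowK mulmxBl => e.
by rewrite addrCA e addrC subrK.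
Qed.

Definition affperms s :=
  [set t : 'S_5 | [exists M : 'M['F_p]_n, [exists c : 'rV['F_p]_n,
     [forall i, s (t i) == (s i *m M + c)%R]]]].

Lemma affpermsP s (t : 'S_5) : reflect (affperm s t) (t \in affperms s).
Proof.
rewrite inE; apply: (iffP existsP) => [[M /existsP[c /forallP H]]|[M [c H]]].
  by exists M, c => i; apply/eqP.
by exists M; apply/existsP; exists c; apply/forallP=> i; apply/eqP.
Qed.

Lemma affperms_group_set s : group_set (affperms s).
Proof.
apply/group_setP; split=> [|t u /affpermsP[M [c Ht]] /affpermsP[N [d Hu]]].
  by apply/affpermsP; exists 1%:M%R, 0%R => i; rewrite perm1 mulmx1 addr0.
apply/affpermsP; exists (M *m N)%R, (c *m N + d)%R => i.
by rewrite permM Hu Ht mulmxDl mulmxA addrA.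
Qed.
Canonical affperms_group s := Group (affperms_group_set s).

(* A transitive group on five points contains a 5-cycle, so up to reordering the
   points an affine map takes s i to s (i + 1). *)
Definition cyc s := exists M : 'M['F_p]_n, exists c : 'rV['F_p]_n,
  forall i, s (ordS i) = (s i *m M + c)%R.

Lemma transitive_cyc s : (forall i, exists2 t, affperm s t & t ord0 = i) ->
  exists2 pi : 'I_5 -> 'I_5, injective pi & cyc (s \o pi).
Proof.
move=> Htr.
have dvd5 : 5 %| #|affperms s|.
  have o5 : #|orbit 'P (affperms s) (ord0 : 'I_5)| = 5.
    rewrite -[RHS]card_ord -cardsT; apply: eq_card => i; rewrite inE.
    by have [t /affpermsP At <-] := Htr i; apply: (mem_orbit 'P _ At).
  by have := dvdn_indexg (affperms_group s) 'C_(affperms_group s)[ord0 | 'P];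
    rewrite -card_orbit o5.
have [t /affpermsP[M [c Ht]] ot] := Cauchy (isT : prime 5) dvd5.
have t5 : t ^+ 5 = 1 by have := expg_order t; rewrite ot.
have [x tx] : exists x, t x != x.
  apply/existsP; rewrite -negb_forall; apply/negP=> /forallP H.
  have t1 : t = 1 by apply/permP=> x; rewrite perm1; apply/eqP.
  by rewrite t1 order1 in ot.
have fixn k : 0 < k < 5 -> (t ^+ k) x <> x.
  move=> Hk e; have em m : (t ^+ (k * m)) x = x.
    elim: m => [|m IH]; first by rewrite muln0 perm1.
    by rewrite mulnS expgD permM e.
  (* The witnesses are the inverses of k modulo 5. *)
  have [m Hm] : exists m, (k * m) %% 5 = 1%N.
    by case: k Hk {e em} => [|[|[|[|[|//]]]]] // _; [exists 1%N|exists 3|exists 2|exists 4].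
  by have := em m; rewrite -(expg_mod _ t5) Hm expg1 => /eqP; rewrite (negPf tx).
have ltn_case i j : i < j < 5 -> (t ^+ i) x <> (t ^+ j) x.
  move=> /andP[ij j5] e; apply: (fixn (j - i));
    first by rewrite subn_gt0 ij (leq_ltn_trans (leq_subr _ _)).
  by apply: (@perm_inj _ (t ^+ i)); rewrite -permM -expgD subnK // ltnW.
exists (fun i => (t ^+ i) x) => [i j e|]; last first.
  exists M, c => i /=; rewrite expg_mod // expgSr permM; exact: Ht.
apply/val_inj; case: (ltngtP i j) => // ij.
  by case: (ltn_case i j) => //; rewrite ij /=.
by case: (ltn_case j i) => //; rewrite ij /=.
Qed.

Lemma spanning_dim s : spanning s -> n <= 4.
Proof.
rewrite /spanning /row_full => /eqP <-.
have HW : ((\matrix_i (s i - s ord0))%R <= (\matrix_(i < 4) (s (lift ord0 i) - s ord0))%R)%MS.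
  apply/row_subP=> i; rewrite rowK; case: (unliftP ord0 i) => [j|] ->.
    by rewrite -(rowK (fun i => s (lift ord0 i) - s ord0)%R) row_sub.
  by rewrite subrr sub0mx.
exact: leq_trans (mxrankS HW) (rank_leq_row _).
Qed.

End AffinePerms.

(** * Fifth roots of unity in a prime field *)

Section PrimeField.

Variables (p : nat).
Hypothesis p_pr : prime p.

Lemma Fp_natr_eq0 k : ((k%:R : 'F_p) == 0)%R = (p %| k).
Proof. by rewrite -(dvdn_pcharf (pchar_Fp p_pr)). Qed.

(** The fifth cyclotomic polynomial. In characteristic 5 it is (l - 1)^4, otherwise its roots are
    the elements of order 5, so one equation covers both readings of the parameter. *)
Definition Phi5 (l : 'F_p) := (1 + l + l ^+ 2 + l ^+ 3 + l ^+ 4)%R.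

Lemma Phi5_exp5 l : Phi5 l = 0%R -> (l ^+ 5 = 1)%R.
Proof.
move=> H; apply/eqP; rewrite -subr_eq0; apply/eqP.
by rewrite -[RHS](mulr0 (l - 1)%R) -H /Phi5; ring.
Qed.

Lemma Phi5_neq0 l : Phi5 l = 0%R -> (l != 0)%R.
Proof.
move=> H; apply: contra_eqN H => /eqP->.
have -> : Phi5 0%R = 1%R by rewrite /Phi5; ring.
exact: oner_neq0.
Qed.

Lemma exp5_dvd (l : 'F_p) : (l ^+ 5 = 1)%R -> (l != 1)%R -> (5.-primitive_root l)%R /\ 5 %| p - 1.
Proof.
move=> l5 l1.
have [m] := prim_order_exists (isT : 0 < 5) l5;
case/(primeP) : (isT : prime 5) => _ H5 mP /H5 /orP[] /eqP em.
  by move: (prim_expr_order mP); rewrite em expr1 => /eqP; rewrite (negPf l1).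
rewrite em in mP; split=> //.
have l0 : l != 0%R by apply: contra_eqN l5 => /eqP->; rewrite expr0n eq_sym oner_neq0.
rewrite subn1 (prim_order_dvd mP) -(inj_eq (mulfI l0)) mulr1 -exprS.
by rewrite prednK ?prime_gt0 //; have := expf_card l; rewrite card_Fp // => ->.
Qed.

Lemma ell_paramP l : reflect (Phi5 l = 0%R) (ell_param l).
Proof.
apply: (iffP orP) => [[/andP[/eqP p5 /eqP->]|/andP[_ lP]]|H].
- apply/eqP; rewrite /Phi5 !expr1n -[1%R]/(1%:R)%R -!natrD Fp_natr_eq0 p5 //.
- have := prim_expr_order lP; move/eqP; rewrite -subr_eq0.
  have -> : (l ^+ 5 - 1 = (l - 1) * Phi5 l)%R by rewrite /Phi5; ring.
  rewrite mulf_eq0 subr_eq0 => /orP[/eqP l1|/eqP //].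
  by have := prim_order_dvd lP 1; rewrite expr1 l1 eqxx.
have [l1|l1] := eqVneq l 1%R.
  left; rewrite andbT; move/eqP: H; rewrite l1 /Phi5 !expr1n -[1%R]/(1%:R)%R -!natrD Fp_natr_eq0.
  by rewrite dvdn_prime2.
by right; have [-> ->] := exp5_dvd (Phi5_exp5 H) l1.
Qed.

End PrimeField.

Definition pts4 p := @rows p 4
  [:: [:: 0; 0; 0; 0]; [:: 1; 0; 0; 0]; [:: 0; 1; 0; 0]; [:: 0; 0; 1; 0]; [:: 0; 0; 0; 1]]%R.
Definition pts3 p (l : 'F_p) := @rows p 3
  [:: [:: 0; 0; 0]; [:: 1; 0; 0]; [:: 0; 1; 0]; [:: - l ^+ 2; - l; - l ^+ 4]; [:: 0; 0; 1]]%R.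
Definition pts2_1 p (l : 'F_p) := @rows p 2
  [:: [:: 0; 0]; [:: 1; 0]; [:: l * (l + 1)^-1; l^-1]; [:: l; (l + 1)^-1]; [:: 0; 1]]%R.
Definition pts2_2 p (l : 'F_p) := @rows p 2
  [:: [:: 0; 0]; [:: 1; 0]; [:: 2%:R^-1 * (1 + l); 1]; [:: 1; 2%:R^-1 * (1 + l)]; [:: 0; 1]]%R.

Section AffineRelations.

Variables (p n : nat).
Implicit Types s : 'I_5 -> 'rV['F_p]_n.

Lemma affine_rel_cyc s x : cyc s -> affine_rel s x -> affine_rel s (x \o @ord_pred 5).
Proof.
case=> M [c sE] [x0 xs]; split; first by rewrite -[RHS]x0 [RHS](reindex_inj (@ord_pred_inj 5)).
rewrite (reindex_inj (@ordS_inj 5)) /=.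
under eq_bigr do rewrite ordSK sE scalerDr scalemxAl.
by rewrite big_split /= -mulmx_suml xs mul0mx add0r -scaler_suml x0 scale0r.
Qed.

(** Dropping the coefficient at [ord0], which the sum condition determines, identifies the affine
    relations with the left kernel of this matrix. That kernel has dimension 4 - n when [s] spans:
    zero for n = 4, a line for n = 3. *)
Let B4 s := (\matrix_(i < 4) (s (lift ord0 i) - s ord0))%R.

Lemma spanning_B4 s : spanning s -> \rank (B4 s) = n.
Proof.
move=> sp; apply/eqP; rewrite -[_ == _]/(row_full (B4 s)) -sub1mx.
have: (1%:M%R <= (\matrix_i (s i - s ord0))%R)%MS by rewrite sub1mx.
move/submx_trans; apply; apply/row_subP=> i; rewrite rowK.
case: (unliftP ord0 i) => [j|] ->.
  by rewrite -(rowK (fun i => s (lift ord0 i) - s ord0)%R) row_sub.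
by rewrite subrr sub0mx.
Qed.

Lemma affine_rel_B4 s x : affine_rel s x -> ((\row_i x (lift ord0 i)) *m B4 s = 0)%R.
Proof.
case=> x0 xs; rewrite mulmx_sum_row.
under eq_bigr do rewrite rowK mxE.
have: (\sum_i x i *: (s i - s ord0) = 0)%R.
  under eq_bigr do rewrite scalerBr.
  by rewrite sumrB xs -scaler_suml x0 scale0r subrr.
by rewrite big_ord_recl subrr scaler0 add0r.
Qed.

Lemma B4_affine_rel s (y : 'rV['F_p]_4) : (y *m B4 s = 0)%R ->
  exists2 x, affine_rel s x & forall i, x (lift ord0 i) = y 0%R i.
Proof.
rewrite mulmx_sum_row; under eq_bigr do rewrite rowK scalerBr.
rewrite sumrB -scaler_suml => yB.
pose x i := (if unlift ord0 i is Some j then y 0 j else - \sum_j y 0 j)%R.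
have xl i : x (lift ord0 i) = y 0%R i by rewrite /x liftK.
have x00 : x ord0 = (- \sum_j y 0 j)%R by rewrite /x unlift_none.
exists x => //; split; rewrite big_ord_recl x00.
  by rewrite [X in (_ + X)%R](eq_bigr (y 0%R)) ?addNr // => i _; rewrite xl.
rewrite (eq_bigr (fun i => y 0 i *: s (lift ord0 i))%R) => [|i _]; last by rewrite xl.
by rewrite scaleNr addrC.
Qed.

End AffineRelations.

(** * Classification in dimensions four and three *)

Section Classification.

Variables (p : nat).
Hypothesis p_pr : prime p.

Lemma pts4_spanning : spanning (pts4 p).
Proof.
apply/spanningP=> u.
exists (fun i : 'I_5 => nth 0 [:: - (u 0 ord0 + u 0 (inord 1) + u 0 (inord 2) + u 0 (inord 3));
  u 0 ord0; u 0 (inord 1); u 0 (inord 2); u 0 (inord 3)] i)%R.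
split; first by rewrite sum5 /=; ring.
apply/rowP=> j; rewrite sum5 !mxE /=.
case: j => [[|[|[|[|//]]]] Hj] /=; rewrite ?mulr0 ?mulr1 ?add0r ?addr0; congr (u _ _);
  apply/val_inj; rewrite /= ?inordK //.
Qed.

(** Five points spanning a 4-space affinely are independent, so every relation to be compared is
    zero. *)
Lemma classification4 (s : 'I_5 -> 'rV['F_p]_4) : spanning s -> affeq s (pts4 p).
Proof.
move=> sp; apply: affeq_rel => //; first exact: pts4_spanning.
move=> x xs; have B_free : row_free (\matrix_(i < 4) (s (lift ord0 i) - s ord0))%R.
  by rewrite /row_free spanning_B4.
have := affine_rel_B4 xs; rewrite -(mul0mx _ (\matrix_(i < 4) (s (lift ord0 i) - s ord0))%R).
move/(row_free_inj B_free)/rowP=> x1.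
have x1' i : x (lift ord0 i) = 0%R by have := x1 i; rewrite !mxE.
have x0 : x ord0 = 0%R.
  case: xs => + _; rewrite big_ord_recl big1 ?addr0 // => i _; exact: x1'.
have xA i : x i = 0%R by case: (unliftP ord0 i) => [j|] ->.
by split; rewrite big1 // => i _; rewrite xA ?scale0r.
Qed.

Lemma affine_rel_line (s : 'I_5 -> 'rV['F_p]_3) : spanning s ->
  exists2 x, affine_rel s x /\ exists i, x i != 0%R
    & forall x', affine_rel s x' -> exists a, forall i, x' i = (a * x i)%R.
Proof.
move=> sp; set B := (\matrix_(i < 4) (s (lift ord0 i) - s ord0))%R.
have rk : \rank (kermx B) = 1%N by rewrite mxrank_ker spanning_B4.
have /rowV0Pn[y yB y0] : kermx B != 0%R by rewrite -mxrank_eq0 rk.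
have [x xs xy] := B4_affine_rel (sub_kermxP yB).
have lineP (z : 'rV_4) : (z <= kermx B)%MS -> exists a, z = (a *: y)%R.
  have Ky : (kermx B <= y)%MS.
    by rewrite -(geq_leqif (mxrank_leqif_sup yB)) rk lt0n mxrank_eq0.
  by move=> /submx_trans/(_ Ky)/sub_rVP.
exists x; first split=> //.
  have /rV0Pn[i] := y0; rewrite -xy => xi; by exists (lift ord0 i).
move=> x' xs'; have [a za] : exists a, (\row_i x' (lift ord0 i) = a *: y)%R.
  by apply: lineP; apply/sub_kermxP; apply: affine_rel_B4.
exists a => i; case: (unliftP ord0 i) => [j|] ->.
  by have /rowP/(_ j) := za; rewrite !mxE -xy.
have rel0 (z : 'I_5 -> 'F_p) : affine_rel s z -> z ord0 = (- \sum_i z (lift ord0 i))%R.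
  by case=> + _; rewrite big_ord_recl => /eqP; rewrite addr_eq0 => /eqP.
rewrite !rel0 // mulrN mulr_sumr; congr (- _)%R; apply: eq_bigr => j _.
by have /rowP/(_ j) := za; rewrite !mxE -xy.
Qed.

Lemma pts3_spanning l : spanning (@pts3 p l).
Proof.
apply/spanningP=> u.
exists (fun i : 'I_5 => nth 0 [:: - (u 0 ord0 + u 0 (inord 1) + u 0 (inord 2)); u 0 ord0;
  u 0 (inord 1); 0; u 0 (inord 2)] i)%R.
split; first by rewrite sum5 /=; ring.
apply/rowP=> j; rewrite sum5 !mxE /=.
case: j => [[|[|[|//]]] Hj] /=; rewrite ?mulr0 ?mulr1 ?mul0r ?add0r ?addr0; congr (u _ _);
  apply/val_inj; rewrite /= ?inordK //.
Qed.

(** The cyclic shift acts on the line of relations by a scalar l. A relation is therefore a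
    geometric sequence, and the vanishing of its coefficient sum is the equation for l. *)
Lemma cyc_rel_ratio (s : 'I_5 -> 'rV['F_p]_3) : spanning s -> cyc s ->
  exists2 l : 'F_p, Phi5 l = 0%R &
   exists2 x, forall x', affine_rel s x' -> exists a, forall i, x' i = (a * x i)%R
    & [/\ x o0 != 0, x o1 = l ^+ 4 * x o0, x o2 = l ^+ 3 * x o0, x o3 = l ^+ 2 * x o0 & x o4 =
      l * x o0]%R.
Proof.
move=> sp cs; have [x [xs [i xi]] xl] := affine_rel_line sp.
have [l Hl] := xl _ (affine_rel_cyc cs xs).
have pr k (Hk : k < 5) (Hk' : (k + 5).-1 %% 5 < 5) : x (Ordinal Hk') = (l * x (Ordinal Hk))%R.
  by rewrite -Hl /=; congr x; apply/val_inj.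
have x4 : x o4 = (l * x o0)%R by rewrite -Hl; congr x; apply/val_inj.
have x3 : x o3 = (l ^+ 2 * x o0)%R by rewrite expr2 -mulrA -x4 -Hl; congr x; apply/val_inj.
have x2 : x o2 = (l ^+ 3 * x o0)%R by rewrite exprS -mulrA -x3 -Hl; congr x; apply/val_inj.
have x1 : x o1 = (l ^+ 4 * x o0)%R by rewrite exprS -mulrA -x2 -Hl; congr x; apply/val_inj.
have x0 : x o0 != 0%R.
  apply: contraNneq xi => x00; apply/eqP.
  by move: i; apply: ord5_ind; rewrite ?x1 ?x2 ?x3 ?x4 x00 ?mulr0.
exists l; last by exists x.
apply: (mulIf x0); rewrite mul0r; case: xs => + _; rewrite sum5 x1 x2 x3 x4 => <-.
by rewrite /Phi5; ring.
Qed.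

(** Solving the geometric relation for the point [o3] produces the entries -l^2, -l and -l^-1 of
    [pts3], the last one written as -l^4. *)
Lemma classification3 (s : 'I_5 -> 'rV['F_p]_3) : spanning s -> cyc s ->
  exists2 l : 'F_p, ell_param l & affeq s (pts3 l).
Proof.
move=> sp cs; have [l Hl [x xl [x0 x1 x2 x3 x4]]] := cyc_rel_ratio sp cs.
exists l; first exact/(ell_paramP p_pr).
apply: affeq_rel => //; first exact: pts3_spanning.
move=> x' /[dup] [[xs0 _]] /xl[a xa]; split=> //.
apply/rowP=> j; rewrite sum5 !mxE !xa x1 x2 x3 x4 /=.
have l5 := Phi5_exp5 Hl.
case: j => [[|[|[|//]]] Hj] /=; rewrite ?mulr0 ?mulr1 ?add0r ?addr0.
- ring.
- ring.
have -> : (a * (l ^+ 2 * x o0) * - l ^+ 4 = - (a * (l * x o0)) * l ^+ 5)%R by ring.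
by rewrite l5; ring.
Qed.

End Classification.

(** * Planar voltages as second-order recurrences *)

Section Planar.

Variables (p : nat).
Hypothesis p_pr : prime p.
Implicit Types s : 'I_5 -> 'rV['F_p]_2.

(* [mxE] restricted to linear combinations: it also tries to unfold opaque rows. *)
Lemma rowDE (u v : 'rV['F_p]_2) j : ((u + v) 0 j = u 0 j + v 0 j)%R.
Proof. by rewrite mxE. Qed.
Lemma rowNE (v : 'rV['F_p]_2) j : ((- v) 0 j = - v 0 j)%R.
Proof. by rewrite mxE. Qed.
Lemma rowZE (a : 'F_p) (v : 'rV['F_p]_2) j : ((a *: v) 0 j = a * v 0 j)%R.
Proof. by rewrite mxE. Qed.
Lemma row0E j : ((0 : 'rV['F_p]_2) 0 j = 0)%R.
Proof. by rewrite mxE. Qed.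
Definition rowE := (rowDE, rowNE, rowZE, row0E).

(** The Cayley-Hamilton identity applied to successive differences: t and q stand for the trace and
    determinant of the linear part of the cyclic map. *)
Definition rec2 s (t q : 'F_p) := forall i,
  (s (ordS (ordS (ordS i))) - s (ordS (ordS i)) =
   t *: (s (ordS (ordS i)) - s (ordS i)) - q *: (s (ordS i) - s i))%R.

Lemma mx2_square (M : 'M['F_p]_2) : (M *m M = \tr M *: M - (\det M)%:M)%R.
Proof.
have i01 (i : 'I_2) : i = 0%R \/ i = 1%R.
  by case: i => [[|[|//]] Hi]; [left|right]; apply/val_inj.
have detE : (\det M = M 0 0 * M 1 1 - M 0 1 * M 1 0)%R.
  rewrite (expand_det_row _ 0%R) !big_ord_recr big_ord0 /cofactor !det_mx11 !mxE /= add0r.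
  rewrite expr0 expr1 mul1r mulN1r mulrN.
  by congr (M _ _ * M _ _ - M _ _ * M _ _)%R; apply/val_inj.
have trE : (\tr M = M 0 0 + M 1 1)%R.
  by rewrite /mxtrace !big_ord_recr big_ord0 /= add0r; congr (M _ _ + M _ _)%R; apply/val_inj.
apply/matrixP=> i j; rewrite !mxE trE detE !big_ord_recr big_ord0 /= add0r.
rewrite (_ : widen_ord _ _ = 0%R); last exact/val_inj.
rewrite (_ : ord_max = 1%R); last exact/val_inj.
by case: (i01 i) => ->; case: (i01 j) => -> /=; ring.
Qed.

Lemma cyc_rec2 s : cyc s -> exists M : 'M_2, rec2 s (\tr M)%R (\det M)%R.
Proof.
case=> M [c sE]; exists M => i.
have dS j : (s (ordS (ordS j)) - s (ordS j) = (s (ordS j) - s j) *m M)%R.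
  by rewrite [in LHS]sE [X in (_ - X)%R]sE opprD addrACA subrr addr0 mulmxBl.
by rewrite dS dS -mulmxA mx2_square mulmxBr -scalemxAr mul_mx_scalar.
Qed.

Lemma linear_rec_double (a0 a1 a2 a3 a4 a5 a6 t q : 'F_p) :
  (a3 - a2 = t * (a2 - a1) - q * (a1 - a0) ->
   a4 - a3 = t * (a3 - a2) - q * (a2 - a1) ->
   a5 - a4 = t * (a4 - a3) - q * (a3 - a2) ->
   a6 - a5 = t * (a5 - a4) - q * (a4 - a3) ->
   a6 - a4 = (t ^+ 2 - q *+ 2) * (a4 - a2) - q ^+ 2 * (a2 - a0))%R.
Proof.
move=> e3 e4 e5 e6.
have -> : (a6 - a4 = (a6 - a5) + (a5 - a4))%R by ring.
have -> : (a4 - a2 = (a4 - a3) + (a3 - a2))%R by ring.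
by rewrite e6 e5 e4 e3; ring.
Qed.

Definition dbl (i : 'I_5) : 'I_5 := inord ((i * 2) %% 5).

Lemma dbl_ordS i : dbl (ordS i) = ordS (ordS (dbl i)).
Proof. by move: i; apply: ord5_ind; apply/val_inj; rewrite /= !inordK. Qed.

Lemma dbl_inj : injective dbl.
Proof.
move=> i j /(congr1 val); rewrite /= !inordK ?ltn_pmod //.
by move: i j; do 2![apply: ord5_ind] => //= _; apply/val_inj.
Qed.

Lemma rec_coord (a b c d e f : 'rV['F_p]_2) (t q : 'F_p) j :
  (a - b = t *: (c - d) - q *: (e - f) ->
   a 0 j - b 0 j = t * (c 0 j - d 0 j) - q * (e 0 j - f 0 j))%R.
Proof. by move/rowP/(_ j); rewrite !mxE. Qed.

(* Visiting the points in the order 0 2 4 1 3 squares the roots of the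
   characteristic polynomial x ^ 2 - t x + q. *)
Lemma rec2_double s t q : rec2 s t q ->
  rec2 (s \o dbl) (t ^+ 2 - q *+ 2)%R (q ^+ 2)%R.
Proof.
move=> H i; rewrite /comp !dbl_ordS.
have E a0 a1 a2 a3 a4 a5 a6 :
  (a3 - a2 = t *: (a2 - a1) - q *: (a1 - a0) ->
   a4 - a3 = t *: (a3 - a2) - q *: (a2 - a1) ->
   a5 - a4 = t *: (a4 - a3) - q *: (a3 - a2) ->
   a6 - a5 = t *: (a5 - a4) - q *: (a4 - a3) ->
   a6 - a4 = (t ^+ 2 - q *+ 2) *: (a4 - a2) - q ^+ 2 *: (a2 - a0) :> 'rV['F_p]_2)%R.
  move=> e3 e4 e5 e6; apply/rowP=> j.
  have := linear_rec_double (rec_coord j e3) (rec_coord j e4) (rec_coord j e5) (rec_coord j e6).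
  by rewrite !rowE.
exact: E (H _) (H _) (H _) (H _).
Qed.

(** The final equation is the closing-up after five steps, 1 + M + M^2 + M^3 + M^4 = 0 at [d0] for a
    step M with M^2 = t M - q. Its two coefficients are those of the remainder of the fifth
    cyclotomic polynomial modulo x^2 - t x + q. *)
Lemma rec2_val s t q : rec2 s t q -> let d0 := (s o1 - s o0)%R in let d1 := (s o2 - s o1)%R in
  [/\ s o1 = s o0 + d0, s o2 = s o0 + d0 + d1,
      s o3 = s o0 + (1 - q) *: d0 + (1 + t) *: d1
    & s o4 = s o0 + (1 - q - t * q) *: d0 + (1 + t + t ^+ 2 - q) *: d1]%R
  /\ ((1 - q - t * q - q * (t ^+ 2 - q)) *: d0 + (1 + t + t ^+ 2 - q + t ^+ 3 - t * q *+ 2) *: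
    d1 = 0)%R.
Proof.
move=> H d0 d1.
have S0 : ordS o0 = o1 by apply/val_inj.
have S1 : ordS o1 = o2 by apply/val_inj.
have S2 : ordS o2 = o3 by apply/val_inj.
have S3 : ordS o3 = o4 by apply/val_inj.
have S4 : ordS o4 = o0 by apply/val_inj.
have := H o0; have := H o1; have := H o2; rewrite S0 S1 S2 S3 S4 => H2 H1 H0.
have E1 : (s o1 = s o0 + d0)%R by rewrite addrC subrK.
have E2 : (s o2 = s o0 + d0 + d1)%R by rewrite -E1 addrC subrK.
have E3 : (s o3 = s o0 + (1 - q) *: d0 + (1 + t) *: d1)%R.
  rewrite -[LHS](subrK (s o2)) H0 -/d0 -/d1 E2; apply/rowP=> j; rewrite !rowE; ring.
have E4 : (s o4 = s o0 + (1 - q - t * q) *: d0 + (1 + t + t ^+ 2 - q) *: d1)%R.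
  rewrite -[LHS](subrK (s o3)) H1 -/d1 E3 E2; apply/rowP=> j; rewrite !rowE; ring.
split=> //; move/eqP: H2; rewrite E4 E3 E2 -subr_eq0 => /eqP H2.
apply/rowP=> j; have := congr1 (fun v : 'rV['F_p]_2 => - v 0 j)%R H2;
  rewrite !rowE oppr0 => <-; ring.
Qed.

Lemma rec2_free s t q : spanning s -> rec2 s t q ->
  forall a b, (a *: (s o1 - s o0) + b *: (s o2 - s o1) = 0 -> a = 0 /\ b = 0)%R.
Proof.
move=> sp /rec2_val /=; set d0 := (s o1 - s o0)%R; set d1 := (s o2 - s o1)%R.
case=> [[E1 E2 E3 E4] _].
pose D := (\matrix_(i < 2) (if i == 0 then d0 else d1))%R.
have mulD (u : 'rV_2) : (u *m D = u 0 0 *: d0 + u 0 1 *: d1)%R.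
  rewrite mulmx_sum_row !big_ord_recr big_ord0 /= add0r !rowK /=.
  by congr (u _ _ *: _ + u _ _ *: _)%R; apply/val_inj.
have D_full : row_full D.
  rewrite -sub1mx; apply/row_subP=> i; have /spanningP/(_ (row i 1%:M)%R)[x [x0 ->]] := sp.
  apply/submxP; exists (\row_j (if j == 0 then x o1 + x o2 + (1 - q) * x o3 + (1 - q - t * q) *
    x o4
     else x o2 + (1 + t) * x o3 + (1 + t + t ^+ 2 - q) * x o4))%R.
  rewrite mulD sum5 E4 E3 E2 E1 !mxE /=.
  have -> : x o0 = (- (x o1 + x o2 + x o3 + x o4))%R.
    by move/eqP: x0; rewrite sum5 -!addrA addr_eq0 => /eqP.
  by apply/rowP=> j; rewrite !rowE; ring.
have D_unit : D \in unitmx by rewrite -row_full_unit.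
move=> a b e; pose u := (\row_j (if j == 0 then a else b) : 'rV['F_p]_2)%R.
have uD : (u *m D = 0)%R by rewrite mulD !mxE /=.
have u0 : u = 0%R by rewrite -(mulmxK D_unit u) uD mul0mx.
by have /rowP H := u0; move: (H 0%R) (H 1%R); rewrite !mxE.
Qed.

Lemma rec2_affeq s s' t q : spanning s -> spanning s' ->
  rec2 s t q -> rec2 s' t q -> affeq s s'.
Proof.
move=> sp sp' Hs Hs'; apply: affeq_rel => // x [x0 xs]; split=> //.
have E r : rec2 r t q -> (\sum_i x i *: r i =
    (x o1 + x o2 + (1 - q) * x o3 + (1 - q - t * q) * x o4) *: (r o1 - r o0) +
    (x o2 + (1 + t) * x o3 + (1 + t + t ^+ 2 - q) * x o4) *: (r o2 - r o1))%R.
  move=> /rec2_val /=; set d0 := (r o1 - r o0)%R; set d1 := (r o2 - r o1)%R.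
  case=> [[E1 E2 E3 E4] _]; rewrite sum5 E4 E3 E2 E1.
  have -> : x o0 = (- (x o1 + x o2 + x o3 + x o4))%R.
    by move/eqP: x0; rewrite sum5 -!addrA addr_eq0 => /eqP.
  by apply/rowP=> j; rewrite !rowE; ring.
move: xs; rewrite !(E _ Hs) (E _ Hs') => /(rec2_free sp Hs)[-> ->].
by rewrite !scale0r addr0.
Qed.

(** By independence of the first two differences, x^2 - t x + q divides the fifth cyclotomic
    polynomial. Outside characteristic 5 its two roots are either inverse to each other, giving q =
    1 and the golden equation, or one is the square of the other, giving t (1 + q) = - q with q
    again a root. In characteristic 5 both roots are 1, which belongs to the first alternative. *)
Lemma rec2_params s t q : spanning s -> rec2 s t q ->
  (Phi5 q = 0 /\ t * (1 + q) = - q)%R \/ [/\ q = 1, t ^+ 2 + t - 1 = 0 & 5%:R != 0 :> 'F_p]%R.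
Proof.
move=> sp Hs; have /= [_ H] := rec2_val Hs.
have [A B] := rec2_free sp Hs H.
(* q times the second coefficient plus t times the first one factors, and the factors separate the
   two cases. *)
have AB : ((1 - q) * (t * (1 + q) + q) = 0)%R.
  have -> : ((1 - q) * (t * (1 + q) + q) =
      q * (1 + t + t ^+ 2 - q + t ^+ 3 - t * q *+ 2) +
      t * (1 - q - t * q - q * (t ^+ 2 - q)))%R by ring.
  by rewrite A B !mulr0 addr0.
move/eqP: AB; rewrite mulf_eq0 subr_eq0; case/orP=> [/eqP q1|].
  rewrite -q1 in A *.
  have t0 : (t ^+ 2 + t - 1 = 0)%R by rewrite -[RHS]oppr0 -A; ring.
  have [c5|] := eqVneq (5%:R : 'F_p)%R 0%R; last by right.
  left; have : ((t - 2%:R) ^+ 2 = 0)%R.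
    have -> : ((t - 2%:R) ^+ 2 = t ^+ 2 + t - 1 - 5%:R * (t - 1))%R by ring.
    by rewrite t0 c5 mul0r subr0.
  move/eqP; rewrite expf_eq0 subr_eq0 => /eqP-> /=; rewrite /Phi5; split.
    by rewrite -c5; ring.
  by apply/eqP; rewrite -subr_eq0 -c5; apply/eqP; ring.
rewrite addr_eq0 => /eqP tq; left; split=> //.
have [q1|q1] := eqVneq q 1%R; last first.
  have -> : (Phi5 q = (1 + q) ^+ 2 * (1 - q - t * q - q * (t ^+ 2 - q)) + q * ((t * (1 + q)) *
    (1 + q) + (t * (1 + q)) ^+ 2) + q ^+ 2 + q ^+ 3 - q ^+ 3)%R.
    by rewrite /Phi5; ring.
  rewrite A tq mulr0; ring.
move: tq A; rewrite q1 => tq A.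
have c5 : (5%:R = 0 :> 'F_p)%R.
  rewrite -[RHS](mulr0 (4%:R)%R) -A.
  have -> : (4%:R * (1 - 1 - t * 1 - 1 * (t ^+ 2 - 1)) = 4%:R - 2%:R * (t * (1 + 1)) - (t * (1
    + 1)) ^+ 2)%R by ring.
  by rewrite tq; ring.
by rewrite /Phi5 -c5; ring.
Qed.

End Planar.

Lemma prime_pm1_mod5 p : prime p -> (5 %| p - 1) || (5 %| p + 1) -> 11 <= p.
Proof. by do 11?[case: p => //= p]. Qed.

Section PlanarClassification.

Variables (p : nat).
Hypothesis p_pr : prime p.
Implicit Types s : 'I_5 -> 'rV['F_p]_2.

(** This and the next lemmas rewrite inverses as polynomials in [l], so that identities are left to
    [ring] modulo the value of l^4. *)
Lemma Phi5_inv (l : 'F_p) : Phi5 l = 0%R -> (l^-1 = l ^+ 4)%R.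
Proof.
move=> H; apply: (mulfI (Phi5_neq0 H)); rewrite mulfV ?(Phi5_neq0 H) // -exprS.
by rewrite (Phi5_exp5 H).
Qed.

Lemma Phi5_add1_neq0 (l : 'F_p) : Phi5 l = 0%R -> (l + 1 != 0)%R.
Proof.
move=> H; apply: contra_eqN H; rewrite addr_eq0 => /eqP->.
have -> : Phi5 (- 1)%R = 1%R :> 'F_p by rewrite /Phi5; ring.
exact: oner_neq0.
Qed.

Lemma Phi5_inv_add1 (l : 'F_p) : Phi5 l = 0%R -> ((l + 1)^-1 = - (l + l ^+ 3))%R.
Proof.
move=> H; apply: (mulfI (Phi5_add1_neq0 H)); rewrite mulfV ?Phi5_add1_neq0 //.
by rewrite -[LHS]subr0 -H /Phi5; ring.
Qed.

Lemma Phi5_expr4 (l : 'F_p) : Phi5 l = 0%R -> (l ^+ 4 = - 1 - l - l ^+ 2 - l ^+ 3)%R.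
Proof. by move=> H; rewrite -[RHS]addr0 -H /Phi5; ring. Qed.

Lemma rec2_pts2_1 (l : 'F_p) : Phi5 l = 0%R -> rec2 (pts2_1 l) (- (l + 1)^-1)%R l^-1%R.
Proof.
move=> H; have l4 := Phi5_expr4 H; rewrite /pts2_1 Phi5_inv_add1 // Phi5_inv //.
apply: ord5_ind; apply/rowP=> [[[|[|//]] Hj]]; rewrite !mxE /=; ring: l4.
Qed.

Lemma rec2_pts2_2 (t : 'F_p) : (2%:R != 0 :> 'F_p)%R -> (t ^+ 2 + t - 1 = 0)%R ->
  rec2 (pts2_2 (2%:R * t + 1)%R) t 1%R.
Proof.
move=> n2 H; have t2 : (t ^+ 2 = 1 - t)%R by rewrite -[RHS]addr0 -H; ring.
have -> : pts2_2 (2%:R * t + 1)%R = @rows p 2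
  [:: [:: 0; 0]; [:: 1; 0]; [:: t + 1; 1]; [:: 1; t + 1]; [:: 0; 1]]%R.
  rewrite /pts2_2; have -> // : (2%:R^-1 * (1 + (2%:R * t + 1)) = t + 1)%R by field.
apply: ord5_ind; apply/rowP=> [[[|[|//]] Hj]]; rewrite !mxE /=; ring: t2.
Qed.

Lemma rows2_spanning (r2 r3 : seq 'F_p) :
  spanning (@rows p 2 [:: [:: 0; 0]; [:: 1; 0]; r2; r3; [:: 0; 1]]%R).
Proof.
apply/spanningP=> u.
exists (fun i : 'I_5 => nth 0 [:: - (u 0 ord0 + u 0 (inord 1)); u 0 ord0; 0; 0;
  u 0 (inord 1)] i)%R.
split; first by rewrite sum5 /=; ring.
apply/rowP=> j; rewrite sum5 !mxE /=.
case: j => [[|[|//]] Hj] /=; rewrite ?mulr0 ?mulr1 ?mul0r ?add0r ?addr0; congr (u _ _);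
  apply/val_inj; rewrite /= ?inordK //.
Qed.

(* The companion matrix of x ^ 2 - t x + 1 has order 5 in GL_2(p). *)
Lemma golden_dvd (t : 'F_p) : (t ^+ 2 + t - 1 = 0)%R -> (5%:R != 0 :> 'F_p)%R ->
  5 %| p - 1 \/ 5 %| p + 1.
Proof.
move=> t0 n5; have t2 : (t ^+ 2 = 1 - t)%R by rewrite -[RHS]addr0 -t0; ring.
pose M : 'M['F_p]_2 := (\matrix_(i, j) if i == 0 then (j == 1)%:R else if j == 0 then -1 else
  t)%R.
have M2 : (M ^+ 2 = t *: M - 1)%R.
  apply/matrixP=> i j; rewrite expr2 -mulmxE !mxE !big_ord_recr big_ord0 /= add0r !mxE.
  by case: i => [[|[|//]] Hi]; case: j => [[|[|//]] Hj]; rewrite /= ?mulr1n ?mulr0n; ring: t2.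
have M4 : (M ^+ 4 = t%:A - M)%R.
  rewrite (exprD M 2 2) M2; apply/matrixP=> i j.
  rewrite -mulmxE !mxE !big_ord_recr big_ord0 /= add0r !mxE.
  case: i => [[|[|//]] Hi]; case: j => [[|[|//]] Hj]; rewrite /= ?mulr1n ?mulr0n; ring: t2.
have M5 : (M ^+ 5 = 1)%R.
  rewrite exprSr M4 mulrBl -scalerAl mul1r -expr2 M2 opprB addrC subrK //.
have M1 : M != 1%R.
  by apply/eqP=> /matrixP/(_ 0 1)%R; rewrite !mxE /= => /eqP; rewrite oner_eq0.
have MU : M \is a GRing.unit.
  by apply/unitrP; exists (M ^+ 4)%R; rewrite -exprS -exprSr M5.
pose u : {'GL_2['F_p]} := FinRing.unit _ MU.
have u5 : u ^+ 5 = 1 by apply/val_inj; rewrite FinRing.val_unitX /= M5.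
have ou : #[u] = 5.
  have : #[u] %| 5 by rewrite order_dvdn u5.
  rewrite dvdn_divisors // /= inE => /orP[|]; last by rewrite inE => /eqP.
  rewrite order_eq1 => /eqP u1; have := congr1 val u1; rewrite /= => /eqP.
  by rewrite (negPf M1).
have : 5 %| #|'GL_2['F_p]| by rewrite -ou order_dvdG // inE.
rewrite card_GL_2 card_Fp // !Euclid_dvdM // -(addn1 p) -(subn1 p) orbb.
have -> : (5 %| p) = false.
  by apply/negbTE; rewrite dvdn_prime2 // eq_sym -dvdn_prime2 // -(Fp_natr_eq0 p_pr).
by case/orP=> H; [left|right].
Qed.

(** Completing the square: t^2 + t - 1 has discriminant 5. *)
Lemma lambda_param_golden (t : 'F_p) : (t ^+ 2 + t - 1 = 0)%R -> (5%:R != 0 :> 'F_p)%R ->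
  lambda_param (2%:R * t + 1)%R.
Proof.
move=> t0 n5; have E : ((2%:R * t + 1) ^+ 2 = 5%:R)%R.
  by rewrite -[RHS]addr0 -(mulr0 (4%:R)%R) -t0; ring.
rewrite /lambda_param E eqxx andbT.
have -> : (2%:R * t + 1 != 0)%R by apply: contraNneq n5 => e; rewrite -E e expr0n.
by rewrite andbT; case: (golden_dvd t0 n5) => ->; rewrite ?orbT.
Qed.

Lemma lambda_param_neq (l : 'F_p) : lambda_param l ->
  [/\ (2%:R != 0 :> 'F_p)%R, (5%:R != 0 :> 'F_p)%R & 11 <= p].
Proof.
case/and3P=> Hp l0 /eqP l2.
have n5 : (5%:R != 0 :> 'F_p)%R by rewrite -l2 expf_eq0.
split=> //.
  by apply/negP; rewrite (Fp_natr_eq0 p_pr) dvdn_prime2 // => /eqP p2; move: Hp; rewrite p2.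
exact: prime_pm1_mod5.
Qed.

Lemma classification2 s : spanning s -> cyc s ->
  (exists2 l : 'F_p, ell_param l & affeq s (pts2_1 l)) \/
  (exists2 l : 'F_p, lambda_param l & affeq s (pts2_2 l)).
Proof.
move=> sp /(cyc_rec2)[M Hs].
move: (\tr M)%R (\det M)%R Hs => t q Hs.
case: (rec2_params sp Hs) => [[Hq tq]|[q1 t0 n5]].
  have q0 := Phi5_neq0 Hq; have q1 := Phi5_add1_neq0 Hq.
  have Hq' : Phi5 (q^-1)%R = 0%R.
    have -> : (Phi5 q^-1 = Phi5 q / q ^+ 4)%R by rewrite /Phi5; field.
    by rewrite Hq mul0r.
  (* The recurrence of [pts2_1] has determinant l^-1, whence the inverse. *)
  left; exists (q^-1)%R; first exact/(ell_paramP p_pr).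
  apply: rec2_affeq (sp) (rows2_spanning _ _) Hs _.
  have -> : t = (- (q^-1 + 1)^-1)%R.
    have -> : (t = - q / (1 + q))%R by rewrite -tq mulfK // addrC.
    field; by rewrite q0 addrC q1.
  rewrite -[X in rec2 _ _ X](invrK q); exact: rec2_pts2_1.
have Hl := lambda_param_golden t0 n5.
right; exists (2%:R * t + 1)%R => //.
apply: rec2_affeq (sp) (rows2_spanning _ _) Hs _; rewrite q1.
by apply: rec2_pts2_2; have [] := lambda_param_neq Hl.
Qed.

End PlanarClassification.

(** * Hexagons *)

Definition ncnt (a c e j : nat) : nat := (a == j) + (c == j) + (e == j).

(** The coefficients of the affine relation of a hexagon, kept as pairs to be subtracted so that the
    check computes with natural numbers. *)
Definition diffs (a b c d e f : nat) : seq (nat * nat) :=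
  [seq (ncnt a c e j, ncnt b d f j) | j <- iota 0 5].

Definition hexcheck (Q : nat -> nat -> nat -> nat -> nat -> nat -> bool) :=
  all (fun a => all (fun b => all (fun c => all (fun d => all (fun e => all (fun f =>
    [&& a != b, b != c, c != d, d != e, e != f & f != a] ==> (a == d) || Q a b c d e f)
    (iota 0 5)) (iota 0 5)) (iota 0 5)) (iota 0 5)) (iota 0 5)) (iota 0 5).

Lemma hexcheckP Q : hexcheck Q -> forall a b c d e f : 'I_5,
  [&& a != b, b != c, c != d, d != e, e != f & f != a] ->
  a = d \/ Q a b c d e f.
Proof.
move=> H a b c d e f Hd; have io (i : 'I_5) : (i : nat) \in iota 0 5 by rewrite mem_iota /=.
move/allP/(_ _ (io a))/allP/(_ _ (io b))/allP/(_ _ (io c)): H.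
move/allP/(_ _ (io d))/allP/(_ _ (io e))/allP/(_ _ (io f)).
by rewrite Hd => /orP[/eqP/val_inj|]; [left|right].
Qed.

(** The absolute difference: one of the two truncated subtractions is 0. *)
Definition dst m k := (m - k) + (k - m).

Section Words.

Variables (p n : nat).

Lemma sum_delta (V : lmodType 'F_p) (g : 'I_5 -> V) (i : 'I_5) :
  (\sum_(j < 5) (i == j :> nat)%:R *: g j = g i)%R.
Proof.
rewrite (bigD1 i) //= eqxx scale1r big1 ?addr0 // => j ji.
by rewrite eq_sym (negPf (ji : val j != val i)) scale0r.
Qed.

Lemma sum_ncnt (V : lmodType 'F_p) (g : 'I_5 -> V) (i j k : 'I_5) :
  (\sum_(l < 5) (ncnt i j k l)%:R *: g l = g i + g j + g k)%R.
Proof.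
rewrite -(sum_delta g i) -(sum_delta g j) -(sum_delta g k) -!big_split /=.
by apply: eq_bigr => l _; rewrite /ncnt !natrD !scalerDl.
Qed.

Lemma word_rel (s : 'I_5 -> 'rV['F_p]_n) (a b c d e f : 'I_5) :
  (s a + s c + s e = s b + s d + s f)%R ->
  affine_rel s (fun j => (ncnt a c e j)%:R - (ncnt b d f j)%:R)%R.
Proof.
move=> eqs; split.
  have E (i j k : 'I_5) : (\sum_(l < 5) (ncnt i j k l)%:R = 1 + 1 + 1 :> 'F_p)%R.
    have := sum_ncnt (V := GRing.regular 'F_p) (fun=> 1%R) i j k; move=> <-.
    by apply: eq_bigr => l _; rewrite -[LHS]mulr1.
  by rewrite sumrB !E subrr.
under eq_bigr do rewrite scalerBl.
by rewrite sumrB !sum_ncnt eqs subrr.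
Qed.

Hypothesis p_pr : prime p.

Lemma Fp_natr_dst m k : (m%:R = k%:R :> 'F_p)%R -> p %| dst m k.
Proof.
wlog le_km : m k / k <= m => [H|] e.
  case/orP: (leq_total k m) => Hk; first exact: H.
  by rewrite /dst addnC; apply: H.
rewrite /dst (eqP (le_km : k - m == 0)) addn0 -(Fp_natr_eq0 p_pr) natrB // e subrr //.
Qed.

End Words.

Definition diffsq m : nat := sumn [seq (dst x.1 x.2 ^ 2)%N | x <- m].

(* An even number in ]0, 22[ has no prime factor >= 11. *)
Lemma hexcheck_sq : hexcheck (fun a b c d e f =>
  let q := diffsq (diffs a b c d e f) in [&& ~~ odd q, 0 < q & q < 22]).
Proof. by vm_compute. Qed.

(** For independent voltages: a coefficient between 1 and 4 in absolute value is nonzero modulo any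
    prime p >= 5. *)
Lemma hexcheck_small : hexcheck (fun a b c d e f =>
  has (fun x => 0 < dst x.1 x.2 < 5) (diffs a b c d e f)).
Proof. by vm_compute. Qed.

(** For n = 3 and p = 5, where the relations are the constant vectors: some coefficient must differ
    from the one at 3. *)
Lemma hexcheck_mod5 : hexcheck (fun a b c d e f =>
  has (fun j => ~~ (5 %| dst (ncnt a c e j + ncnt b d f 3) (ncnt a c e 3 + ncnt b d f j)))
    (iota 0 5)).
Proof. by vm_compute. Qed.

Lemma hexcheck_mod3 : hexcheck (fun a b c d e f =>
  [&& a == c, c == e, b == d & d == f] || has (fun x => ~~ (3 %| dst x.1 x.2)) (diffs a b c d e
    f)).
Proof. by vm_compute. Qed.

(* [dst] of the two sides of x ^ 2 + x y - y ^ 2 = 0 for x = x1 - x2, y = y1 - y2. *)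
Definition golden_dst (x1 x2 y1 y2 : nat) :=
  dst (x1 ^ 2 + x2 ^ 2 + x1 * y1 + x2 * y2 + 2 * (y1 * y2))%N
      (2 * (x1 * x2) + x1 * y2 + x2 * y1 + y1 ^ 2 + y2 ^ 2)%N.

Lemma hexcheck_golden : hexcheck (fun a b c d e f =>
  let P := ncnt a c e in let Q := ncnt b d f in
  (0 < golden_dst (P 1%N + P 3) (Q 1%N + Q 3) (P 2) (Q 2) < 11) ||
  (0 < golden_dst (P 2 + P 4) (Q 2 + Q 4) (P 3) (Q 3) < 11)).
Proof. by vm_compute. Qed.

Section HexFreePoints.

Variable p : nat.
Hypothesis p_pr : prime p.

Lemma hex_free_sq n (s : 'I_5 -> 'rV['F_p]_n) : 11 <= p ->
  (forall x, affine_rel s x -> \sum_i x i ^+ 2 = 0)%R -> hex_free s.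
Proof.
move=> p11 Hs a b c d e f Hd /word_rel/Hs e0.
case: (hexcheckP hexcheck_sq Hd) => // /and3P[Hodd q0 q22].
set q := diffsq _ in Hodd q0 q22.
have : p %| q.
  rewrite -(Fp_natr_eq0 p_pr) -e0 /q /diffsq /= addn0 sum5 4!natrD -!addrA.
  have E m k : ((dst m k ^ 2)%N%:R = (m%:R - k%:R) ^+ 2 :> 'F_p)%R.
    rewrite natrX /dst; case/orP: (leq_total k m) => H.
      by rewrite (eqP (H : k - m == 0)) addn0 natrB.
    by rewrite (eqP (H : m - k == 0)) add0n natrB // -sqrrN opprB.
  by rewrite 5!E.
case/dvdnP=> k qk; case: k qk => [|[|k]] qk; first by rewrite qk in q0.
  rewrite qk mul1n in Hodd.
  by case: (even_prime p_pr) => [p2|]; [rewrite p2 in p11|rewrite (negPf Hodd)].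
by move: q22; rewrite qk ltnNge; rewrite (leq_trans (n := (2 * 11)%N)) // leq_mul.
Qed.

Lemma hex_free_small n (s : 'I_5 -> 'rV['F_p]_n) : 5 <= p ->
  (forall x, affine_rel s x -> forall i, x i = 0)%R -> hex_free s.
Proof.
move=> p5 Hs a b c d e f Hd /word_rel/Hs e0.
case: (hexcheckP hexcheck_small Hd) => // /hasP[x /mapP[j]].
rewrite mem_iota /= => j5 -> /= /andP[x0 x5].
have := e0 (Ordinal j5) => /eqP; rewrite subr_eq0 => /eqP/(Fp_natr_dst p_pr)/(dvdn_leq x0).
by rewrite leqNgt (leq_trans x5).
Qed.

(** x^2 + x y - y^2 is the norm form of the ring generated by the golden ratio. At x = - (t + 1) y
    it equals (t^2 + t - 1) y^2 = 0, so p divides its integer value, whereas the check finds a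
    nonzero value below 11 for one of the two relations. *)
Lemma hex_free_golden (t : 'F_p) (s : 'I_5 -> 'rV['F_p]_2) : 11 <= p ->
  (t ^+ 2 + t - 1 = 0)%R ->
  (forall x, affine_rel s x ->
    x o1 + (t + 1) * x o2 + x o3 = 0 /\ x o2 + (t + 1) * x o3 + x o4 = 0)%R ->
  hex_free s.
Proof.
move=> p11 t0 Hs a b c d e f Hd /word_rel/Hs[/= e1 e2].
have G (x1 x2 y1 y2 : nat) : (x1%:R - x2%:R = - (t + 1) * (y1%:R - y2%:R))%R ->
    ~~ (0 < golden_dst x1 x2 y1 y2 < 11).
  move=> e0; have : p %| golden_dst x1 x2 y1 y2.
    apply: Fp_natr_dst => //; apply/eqP; rewrite -subr_eq0 !(natrD, natrM, natrX).
    have -> : (x1%:R ^+ 2 + x2%:R ^+ 2 + x1%:R * y1%:R + x2%:R * y2%:R + 2%:R * (y1%:R * y2%:R) -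
       (2%:R * (x1%:R * x2%:R) + x1%:R * y2%:R + x2%:R * y1%:R + y1%:R ^+ 2 + y2%:R ^+ 2) =
       (x1%:R - x2%:R) ^+ 2 + (x1%:R - x2%:R) * (y1%:R - y2%:R) - (y1%:R - y2%:R) ^+ 2 :> 'F_p)%R.
      by ring.
    rewrite e0; apply/eqP; move: (y1%:R - y2%:R)%R => y.
    have -> : ((- (t + 1) * y) ^+ 2 + - (t + 1) * y * y - y ^+ 2 = (t ^+ 2 + t - 1) * y ^+ 2)%R
      by ring.
    by rewrite t0 mul0r.
  move=> pd; apply/negP=> /andP[g0 g11]; have := dvdn_leq g0 pd.
  by rewrite leqNgt (leq_trans g11).
case: (hexcheckP hexcheck_golden Hd) => // H; exfalso; move: H.
case/orP; apply/negP; apply: G; rewrite 2!natrD.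
  by apply/eqP; rewrite -subr_eq0; apply/eqP; rewrite -[RHS]e1; ring.
by apply/eqP; rewrite -subr_eq0; apply/eqP; rewrite -[RHS]e2; ring.
Qed.

End HexFreePoints.

(** * Symmetry groups *)

Lemma cyclic_isog_Zp (gT : finGroupType) (G : {group gT}) n :
  cyclic G -> #|G| = n.+2 -> G \isog [set: 'Z_n.+2].
Proof.
move=> cG oG; rewrite isog_cyclic_card // cardsT card_ord oG eqxx andbT.
by apply/cyclicP; exists 1%R; exact: (@Zp_cycle n.+1).
Qed.

Section LabelGroups.

Variables (p n : nat) (s : 'I_5 -> 'rV['F_p]_n).

Lemma affperms_isog (s_span : spanning s) (s_inj : injective s) :
  labperms (pt_inj s_inj) = affperms_group s.
Proof.
apply/val_inj/setP=> t; apply/idP/affpermsP; first by move/(labperms_affperm s_span).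
by move=> At; apply/(labperms_affperm s_span).
Qed.

Lemma rigid_is_sdprod (hT : finGroupType) (Q : {group hT}) :
  spanning s -> injective s ->
  (forall f, f \in sAut_group (cay [set pt s i | i : 'I_5]) -> rigid (pt s) f) ->
  affperms_group s \isog Q ->
  is_sdprod_by (sAut_group (cay [set pt s i | i : 'I_5])) (RR (GD p n)) Q.
Proof.
move=> s_span s_inj Hr HQ; exists (baseN (pt s)).
  exact: (rigid_sdprod (pt_gen s_span)).
have := baseN_isog (pt_inj s_inj) (pt_gen s_span).
rewrite affperms_isog //; move/isog_trans; exact.
Qed.

Definition rot : 'S_5 := perm (@ordS_inj 5).

Lemma rotX k i : (rot ^+ k) i = ((i + k) %% 5)%N :> nat.
Proof.
elim: k => [|k IH]; first by rewrite perm1 addn0 modn_small.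
by rewrite expgSr permM permE /= IH -addn1 modnDml addn1 addnS.
Qed.

Lemma rot_order : #[rot] = 5.
Proof.
apply/eqP; have : #[rot] %| 5.
  by rewrite order_dvdn; apply/eqP/permP=> i; apply/val_inj;
    rewrite /= rotX perm1 modnDr modn_small.
case/primeP: (isT : prime 5) => _ H5 /H5 /orP[|//].
rewrite order_eq1 => /eqP/permP/(_ o0)/(congr1 val).
by rewrite perm1 permE.
Qed.

Lemma affperms_card : rot \in affperms s ->
  #|affperms s| = (5 * #|[set t in affperms s | t o0 == o0]|)%N.
Proof.
move=> rs; rewrite -(card_orbit_stab 'P (affperms_group s) o0); congr (_ * _)%N.
  rewrite -[RHS](card_ord 5) -cardsT; apply: eq_card => i; rewrite inE.
  apply/orbitP; exists (rot ^+ i); first by rewrite groupX.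
  by apply/val_inj; rewrite /= rotX add0n modn_small.
apply: eq_card => t; rewrite !inE; congr (_ && _).
by rewrite sub1set inE.
Qed.

Lemma affperms_Z5 : rot \in affperms s ->
  (forall t, t \in affperms s -> t o0 = o0 -> t = 1) ->
  affperms_group s \isog [set: 'Z_5].
Proof.
move=> rs Hst.
have card5 : #|affperms s| = 5.
  rewrite affperms_card // (_ : [set _ in _ | _] = [set 1]) ?cards1 ?muln1 //.
  apply/setP=> t; rewrite !inE; apply/andP/eqP => [[At /eqP t0]|->].
    by apply: Hst; rewrite ?inE.
  by rewrite perm1 eqxx; have := group1 (affperms_group s); rewrite inE => ->.
by apply: cyclic_isog_Zp => //; apply: prime_cyclic; rewrite card5.
Qed.

(** The reflection i -> - i modulo 5: [rev_ord] gives 4 - i and [rot] adds 1. *)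
Definition refl5 : 'S_5 := perm (@rev_ord_inj 5) * rot.

Lemma refl5E : [/\ refl5 o0 = o0, refl5 o1 = o4, refl5 o2 = o3, refl5 o3 = o2 & refl5 o4 = o1].
Proof. by split; apply/val_inj; rewrite /= permM !permE. Qed.

(** [refl5] and [refl5 * rot] are involutions. The group they generate contains elements of orders 2
    and 5, and the stabilizer bounds [affperms s] by 10, so both groups coincide; ['D_10] has order
    10. *)
Lemma affperms_D10 : rot \in affperms s -> refl5 \in affperms s ->
  (forall t, t \in affperms s -> t o0 = o0 -> t = 1 \/ t = refl5) ->
  affperms_group s \isog 'D_10%G.
Proof.
move=> rs fs Hst; have [f0 f1 f2 f3 f4] := refl5E.
have ff : refl5 * refl5 = 1.
  by apply/permP; apply: ord5_ind; rewrite permM perm1 ?f0 ?f1 ?f2 ?f3 ?f4 ?f1 ?f2.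
have fr : (refl5 * rot) * (refl5 * rot) = 1.
  by apply/permP; apply: ord5_ind; apply/val_inj; rewrite perm1 !permM ?f0 ?f1 ?f2 ?f3 ?f4 !permE.
have nf : refl5 != 1 by apply/eqP=> /permP/(_ o1); rewrite f1 perm1.
have nr : rot != 1 by rewrite -order_eq1 rot_order.
have o2P (x : 'S_5) : x != 1 -> x * x = 1 -> #[x] = 2.
  by move=> x1 xx; apply: nt_prime_order; rewrite // expgS expg1.
pose y := refl5 * rot.
have oy : #[y] = 2.
  by apply: o2P fr; apply/eqP=> /permP/(_ o0)/(congr1 val); rewrite permM f0 permE perm1.
have nxy : refl5 != y by rewrite -(inj_eq (mulgI refl5)) ff mulgA ff mul1g eq_sym.
have sub : <<[set refl5; y]>> \subset affperms s.
  rewrite -[affperms s]/(gval (affperms_group s)) gen_subG; apply/subsetP=> z.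
  by case/set2P=> ->; [exact: fs|exact: (@groupM _ (affperms_group s))].
have c10 : #|affperms s| <= 10.
  rewrite affperms_card // -[10]/(5 * 2)%N leq_mul2l /=.
  apply: (@leq_trans #|[set 1; refl5]|); last by rewrite cards2; case: (_ != _).
  apply/subset_leq_card/subsetP=> t; rewrite !inE => /andP[At /eqP t0].
  by case: (Hst t) => // [|->|->]; rewrite ?inE ?eqxx ?orbT.
have Gr : rot \in <<[set refl5; y]>>.
  by rewrite -[rot]mul1g -ff -mulgA groupM ?mem_gen ?inE ?eqxx ?orbT.
have d5 : 5 %| #|<<[set refl5; y]>>| by have := order_dvdG Gr; rewrite rot_order.
have d2 : 2 %| #|<<[set refl5; y]>>|.
  have: refl5 \in <<[set refl5; y]>> by rewrite mem_gen // set21.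
  by move/order_dvdG; rewrite (o2P _ nf ff).
have d10 : 10 %| #|<<[set refl5; y]>>| by rewrite (@Gauss_dvd 2 5) // d2.
have G_eq : <<[set refl5; y]>> = affperms s.
  apply/eqP; rewrite eqEcard sub (leq_trans c10) //; apply: dvdn_leq d10.
  exact: cardG_gt0.
have c10' : #|affperms s| = 10.
  by apply/eqP; rewrite eqn_leq c10 -G_eq dvdn_leq // cardG_gt0.
have := involutions_gen_dihedral (o2P _ nf ff) oy nxy.
by rewrite /= G_eq c10'.
Qed.

End LabelGroups.

Section PointFamilies.

Variable p : nat.
Hypothesis p_pr : prime p.

Lemma affine_rel_row n (s : 'I_5 -> 'rV['F_p]_n) x j : affine_rel s x ->
  (x o0 * s o0 0 j + x o1 * s o1 0 j + x o2 * s o2 0 j + x o3 * s o3 0 j + x o4 * s o4 0 j = 0)%R.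
Proof. by case=> _ /rowP/(_ j); rewrite sum5 !mxE. Qed.

Lemma affine_rel_sum n (s : 'I_5 -> 'rV['F_p]_n) x : affine_rel s x ->
  (x o0 + x o1 + x o2 + x o3 + x o4 = 0)%R.
Proof. by case; rewrite sum5. Qed.

Lemma pts4_rel x : affine_rel (pts4 p) x -> forall i, x i = 0%R.
Proof.
move=> H; have S := affine_rel_sum H.
have R j := affine_rel_row j H.
move: (R (@Ordinal 4 0 isT)) (R (@Ordinal 4 1 isT)) (R (@Ordinal 4 2 isT)) (R (@Ordinal 4 3 isT)).
rewrite !mxE /= !mulr0 !mulr1 ?addr0 ?add0r => e1 e2 e3 e4.
by apply: ord5_ind => //; move: S; rewrite e1 e2 e3 e4 !addr0.
Qed.

Lemma pts3_rel (l : 'F_p) x : Phi5 l = 0%R -> affine_rel (pts3 l) x ->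
  [/\ x o0 = l ^+ 3 * x o3, x o1 = l ^+ 2 * x o3, x o2 = l * x o3 & x o4 = l ^+ 4 * x o3]%R.
Proof.
move=> Hl H; have S := affine_rel_sum H.
have R j := affine_rel_row j H.
move: (R (@Ordinal 3 0 isT)) (R (@Ordinal 3 1 isT)) (R (@Ordinal 3 2 isT)).
rewrite !mxE /= !mulr0 !mulr1 ?addr0 ?add0r => e1 e2 e3.
have x1 : (x o1 = l ^+ 2 * x o3)%R by apply/eqP; rewrite -subr_eq0; apply/eqP;
  rewrite -[RHS]e1; ring.
have x2 : (x o2 = l * x o3)%R by apply/eqP; rewrite -subr_eq0; apply/eqP; rewrite -[RHS]e2; ring.
have x4 : (x o4 = l ^+ 4 * x o3)%R by apply/eqP; rewrite -subr_eq0; apply/eqP;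
  rewrite -[RHS]e3; ring.
split=> //; apply/eqP; rewrite -subr_eq0; apply/eqP.
rewrite -[RHS]S x1 x2 x4.
have -> : (x o0 - l ^+ 3 * x o3 = x o0 + l ^+ 2 * x o3 + l * x o3 + x o3 + l ^+ 4 * x o3 - Phi5
  l * x o3)%R.
  by rewrite /Phi5; ring.
by rewrite Hl mul0r subr0.
Qed.

Lemma pts3_relP (l : 'F_p) x : Phi5 l = 0%R ->
  [/\ x o0 = l ^+ 3 * x o3, x o1 = l ^+ 2 * x o3, x o2 = l * x o3 & x o4 = l ^+ 4 * x o3]%R ->
  affine_rel (pts3 l) x.
Proof.
move=> Hl [e0 e1 e2 e4]; have l4 := Phi5_expr4 Hl; split; rewrite sum5 e0 e1 e2 e4.
  by ring: l4.
by apply/rowP=> [[[|[|[|//]]] Hj]]; rewrite !mxE /=; ring.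
Qed.

(** In terms of the Fourier transform k -> \sum_i l^(k i) x_i, which is 0 at k = 0 by the sum
    condition: it also vanishes at k = 3 and k = 1. *)
Lemma pts2_1_rel (l : 'F_p) x : Phi5 l = 0%R -> affine_rel (pts2_1 l) x ->
  (x o0 + l ^+ 3 * x o1 + l * x o2 + l ^+ 4 * x o3 + l ^+ 2 * x o4 = 0 /\
   x o0 + l * x o1 + l ^+ 2 * x o2 + l ^+ 3 * x o3 + l ^+ 4 * x o4 = 0)%R.
Proof.
move=> Hl H; have S := affine_rel_sum H; have l4 := Phi5_expr4 Hl.
have R j := affine_rel_row j H.
move: (R (@Ordinal 2 0 isT)) (R (@Ordinal 2 1 isT)).
rewrite !mxE /= Phi5_inv_add1 // Phi5_inv // => C0 C1.
set F0 := (X in X = _) in C0; set F1 := (X in X = _) in C1; set F := (X in X = _) in S.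
split.
  transitivity (F + (l ^+ 3 - 1) * F0 + (l ^+ 2 - 1) * F1)%R;
    last by rewrite S C0 C1 !mulr0 !addr0.
  by rewrite /F /F0 /F1; ring: l4.
transitivity (F + (l - 1) * F0 + (l ^+ 4 - 1) * F1)%R; last by rewrite S C0 C1 !mulr0 !addr0.
by rewrite /F /F0 /F1; ring: l4.
Qed.

(** Parseval: 5 times the sum of squares is the sum over k of the products of the Fourier
    coefficients at k and - k. One factor vanishes in each product, since 0, 1 and 3 meet every pair
    {k, - k}. *)
Lemma pts2_1_rel_sq (l : 'F_p) x : Phi5 l = 0%R -> (5%:R != 0 :> 'F_p)%R ->
  affine_rel (pts2_1 l) x -> (\sum_i x i ^+ 2 = 0)%R.
Proof.
move=> Hl n5 H; have [H3 H1] := pts2_1_rel Hl H; have S := affine_rel_sum H.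
have l4 := Phi5_expr4 Hl.
apply: (mulfI n5); rewrite mulr0 sum5.
set F1 := (X in X = _) in H1; set F3 := (X in X = _) in H3; set F := (X in X = _) in S.
transitivity (F ^+ 2 +
   2%:R * F1 * (x o0 + l ^+ 4 * x o1 + l ^+ 3 * x o2 + l ^+ 2 * x o3 + l * x o4) +
   2%:R * F3 * (x o0 + l ^+ 2 * x o1 + l ^+ 4 * x o2 + l * x o3 + l ^+ 3 * x o4))%R.
  by rewrite /F /F1 /F3; ring: l4.
by rewrite S H1 H3 expr0n !mulr0 !mul0r !addr0.
Qed.

(** The squares of a geometric relation are geometric too, with a ratio that is again a root of
    [Phi5]. *)
Lemma pts3_rel_sq (l : 'F_p) x : Phi5 l = 0%R ->
  affine_rel (pts3 l) x -> (\sum_i x i ^+ 2 = 0)%R.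
Proof.
move=> Hl /(pts3_rel Hl)[e0 e1 e2 e4]; have l4 := Phi5_expr4 Hl.
by rewrite sum5 e0 e1 e2 e4; ring: l4.
Qed.

Lemma pts2_2E (l : 'F_p) : lambda_param l -> exists t : 'F_p,
  [/\ (t ^+ 2 + t - 1 = 0)%R, l = (2%:R * t + 1)%R &
   pts2_2 l = @rows p 2 [:: [:: 0; 0]; [:: 1; 0]; [:: t + 1; 1]; [:: 1; t + 1]; [:: 0; 1]]%R].
Proof.
move=> Hl; have [n2 n5 _] := lambda_param_neq p_pr Hl; case/and3P: Hl => _ _ /eqP l2.
exists ((l - 1) / 2%:R)%R; split; last 1 first.
- rewrite /pts2_2; have -> // : (2%:R^-1 * (1 + l) = (l - 1) / 2%:R + 1)%R by field.
- have -> : (((l - 1) / 2%:R) ^+ 2 + (l - 1) / 2%:R - 1 = (l ^+ 2 - 5%:R) / 4%:R)%R.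
    field; rewrite n2 (_ : 4%:R = 2%:R * 2%:R :> 'F_p)%R ?mulf_neq0 //; by ring.
  by rewrite l2 subrr mul0r.
by field.
Qed.

Lemma pts2_2_rel (t : 'F_p) x :
  affine_rel (@rows p 2 [:: [:: 0; 0]; [:: 1; 0]; [:: t + 1; 1]; [:: 1; t + 1]; [:: 0; 1]]%R) x ->
  (x o1 + (t + 1) * x o2 + x o3 = 0 /\ x o2 + (t + 1) * x o3 + x o4 = 0)%R.
Proof.
move=> H; have R j := affine_rel_row j H.
move: (R (@Ordinal 2 0 isT)) (R (@Ordinal 2 1 isT)); rewrite !mxE /= => C0 C1.
by split; [rewrite -[RHS]C0|rewrite -[RHS]C1]; ring.
Qed.

Lemma Fp_odd_neq0 : 5 %| p - 1 -> (5%:R != 0 :> 'F_p)%R.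
Proof.
move=> H; have := prime_pm1_mod5 p_pr; rewrite H => /(_ isT) p11.
by rewrite (Fp_natr_eq0 p_pr) gtnNdvd // (leq_trans _ p11).
Qed.

Lemma rows_inj n (r : seq (seq 'F_p)) : size r = 5 ->
  uniq [seq mkseq (fun j => v`_j)%R n | v <- r] -> injective (@rows p n r).
Proof.
move=> r5 Hu i j e; apply/val_inj/eqP.
rewrite -(nth_uniq [::] _ _ Hu) ?size_map ?r5 ?ltn_ord //.
rewrite !(nth_map [::]) ?r5 ?ltn_ord //; apply/eqP/eq_in_map => k; rewrite mem_iota => /= kn.
by have /rowP/(_ (Ordinal kn)) := e; rewrite !mxE.
Qed.

Lemma pts4_inj : injective (pts4 p).
Proof.
by apply: rows_inj; rewrite //= /mkseq /= !inE !eqseq_cons ?eqxx ?oner_eq0 ?(eq_sym 0%R 1%R)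
  ?oner_eq0 /=.
Qed.

Lemma pts3_inj (l : 'F_p) : Phi5 l = 0%R -> injective (pts3 l).
Proof.
move=> Hl; have l0 := Phi5_neq0 Hl.
apply: rows_inj; rewrite //= /mkseq /= !inE !eqseq_cons ?eqxx ?(eq_sym 0%R 1%R) ?oner_eq0 /=.
by rewrite ?(eq_sym 0%R (- _)%R) ?oppr_eq0 ?expf_eq0 ?(negPf l0) ?andbF ?oner_eq0 ?andbT.
Qed.

Lemma pts2_1_inj (l : 'F_p) : Phi5 l = 0%R -> injective (pts2_1 l).
Proof.
move=> Hl; have l0 := Phi5_neq0 Hl; have l1 := Phi5_add1_neq0 Hl.
apply: rows_inj; rewrite //= /mkseq /= !inE !eqseq_cons ?eqxx ?(eq_sym 0%R) ?oner_eq0 /=.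
have nl : (l / (l + 1) == l)%R = false.
  apply/negbTE; rewrite -subr_eq0; have -> : (l / (l + 1) - l = - (l ^+ 2 / (l + 1)))%R by field.
  by rewrite oppr_eq0 mulf_eq0 expf_eq0 invr_eq0 negb_or l0 l1.
by rewrite ?(eq_sym 0%R) ?mulf_eq0 ?invr_eq0 ?(negPf l0) ?(negPf l1) ?nl ?andbF ?orbF.
Qed.

Lemma pts2_2_inj (l : 'F_p) : lambda_param l -> injective (pts2_2 l).
Proof.
move=> Hl; have [t [t0 _ ->]] := pts2_2E Hl.
have t1 : (t + 1 != 0)%R.
  rewrite addr_eq0; apply: contra_eqN t0 => /eqP->.
  have -> : ((- 1) ^+ 2 + (- 1) - 1 = - 1 :> 'F_p)%R by ring.
  by rewrite oppr_eq0 oner_eq0.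
have t2 : (t + 1 != 1)%R.
  rewrite -subr_eq0 addrK; apply: contra_eqN t0 => /eqP->.
  have -> : (0 ^+ 2 + 0 - 1 = - 1 :> 'F_p)%R by ring.
  by rewrite oppr_eq0 oner_eq0.
apply: rows_inj; rewrite //= /mkseq /= !inE !eqseq_cons ?eqxx ?(eq_sym 0%R) ?oner_eq0 /=.
by rewrite ?(eq_sym 0%R) ?oner_eq0 ?(negPf t1) ?(negPf t2) ?andbF ?orbF.
Qed.

End PointFamilies.

Section Symmetries.

Variable p : nat.
Hypothesis p_pr : prime p.

Lemma CGD2_1E (l : 'F_p) : CGD2_1 l = cay [set pt (pts2_1 l) i | i : 'I_5].
Proof. by rewrite /CGD2_1 -cay_rows. Qed.
Lemma CGD2_2E (l : 'F_p) : CGD2_2 l = cay [set pt (pts2_2 l) i | i : 'I_5].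
Proof. by rewrite /CGD2_2 -cay_rows. Qed.
Lemma CGD3E (l : 'F_p) : CGD3 l = cay [set pt (pts3 l) i | i : 'I_5].
Proof. by rewrite /CGD3 -cay_rows. Qed.
Lemma CGD4E : CGD4 p = cay [set pt (pts4 p) i | i : 'I_5].
Proof. by rewrite /CGD4 -cay_rows. Qed.

Lemma affeq_affperms n (s : 'I_5 -> 'rV['F_p]_n) (t : 'S_5) :
  affeq s (s \o t) -> t \in affperms s.
Proof. by case=> M [c [_ H]]; apply/affpermsP; exists M, c. Qed.

Lemma affperms_rel n (s : 'I_5 -> 'rV['F_p]_n) (t : 'S_5) x :
  t \in affperms s -> affine_rel s x -> affine_rel s (x \o t).
Proof.
move=> At [x0 xs]; split; first by rewrite -[RHS]x0 [RHS](reindex_inj (@perm_inj _ t)).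
have At' : t^-1 \in affperms_group s by rewrite groupV.
have := affperm_rel (affpermsP _ _ At') x0 xs.
rewrite (reindex_inj (@perm_inj _ t)) => H; rewrite -[RHS]H; apply: eq_bigr => i _ /=.
by rewrite permK.
Qed.

Lemma sum_perm_rel n (s : 'I_5 -> 'rV['F_p]_n) (t : 'S_5) : spanning s ->
  (forall x, affine_rel s x -> affine_rel s (x \o t)) -> t^-1 \in affperms s.
Proof.
move=> sp Hx; apply: affeq_affperms; apply: affeq_rel => //.
  by apply: spanning_perm => //; apply: perm_inj.
move=> x xs; have [xt0 xts] := Hx _ xs; split; first by case: xs.
rewrite (reindex_inj (@perm_inj _ t)) -[RHS]xts; apply: eq_bigr => i _ /=.
by rewrite permK.
Qed.

Lemma pts4_affperms : affperms_group (pts4 p) \isog [set: 'S_5].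
Proof.
have -> : affperms_group (pts4 p) = [set: 'S_5]%G; last exact: isog_refl.
apply/val_inj/setP=> t; rewrite [RHS]inE.
rewrite -[t]invgK; apply: sum_perm_rel; first exact: pts4_spanning.
move=> x /pts4_rel x0; split; rewrite big1 // => i _; rewrite /= x0 ?scale0r //.
Qed.

Lemma pts3_rot (l : 'F_p) : Phi5 l = 0%R -> rot \in affperms (pts3 l).
Proof.
move=> Hl; have rV : rot^-1 \in affperms_group (pts3 l); last by rewrite groupV in rV.
apply: sum_perm_rel; first exact: pts3_spanning.
move=> x /(pts3_rel Hl)[e0 e1 e2 e4].
have l5 := Phi5_exp5 Hl.
have r0 : rot o0 = o1 by apply/val_inj; rewrite permE.
have r1 : rot o1 = o2 by apply/val_inj; rewrite permE.
have r2 : rot o2 = o3 by apply/val_inj; rewrite permE.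
have r3 : rot o3 = o4 by apply/val_inj; rewrite permE.
have r4 : rot o4 = o0 by apply/val_inj; rewrite permE.
apply: pts3_relP => //; rewrite /= r0 r1 r2 r3 r4 e0 e1 e2 e4; split=> //.
- by rewrite mulrA -exprD (exprD l 5 2) l5 mul1r.
- by rewrite mulrA -exprD (exprD l 5 1) l5 mul1r expr1.
- by rewrite mulrA -exprS l5 mul1r.
- by rewrite mulrA -exprD (exprD l 5 3) l5 mul1r.
Qed.

Lemma primitive5_neq1 (l : 'F_p) : (5.-primitive_root l)%R -> Phi5 l = 0%R.
Proof.
move=> lP; have := prim_expr_order lP; move/eqP; rewrite -subr_eq0.
have -> : (l ^+ 5 - 1 = (l - 1) * Phi5 l)%R by rewrite /Phi5; ring.
rewrite mulf_eq0 subr_eq0 => /orP[/eqP l1|/eqP //].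
by have := prim_order_dvd lP 1; rewrite expr1 l1 eqxx.
Qed.

Lemma primitive5_expr_inj (l : 'F_p) k m : (5.-primitive_root l)%R -> coprime k 5 ->
  injective (fun i : 'I_5 => l ^+ (m + k * i))%R.
Proof.
move=> lP k5 i j /eqP; rewrite (eq_prim_root_expr lP) eqn_modDl.
have main (a b : 'I_5) : a <= b -> k * a == k * b %[mod 5] -> a = b.
  move=> le_ab; rewrite eq_sym eqn_mod_dvd ?leq_mul2l ?le_ab ?orbT // -mulnBr.
  rewrite Gauss_dvdr 1?coprime_sym // => d5; apply/val_inj/eqP; rewrite eqn_leq le_ab /=.
  rewrite -subn_eq0; case: posnP => // lt0; have := dvdn_leq lt0 d5.
  by rewrite leqNgt (leq_ltn_trans (leq_subr _ _)).
case/orP: (leq_total i j) => H; first exact: main.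
by rewrite eq_sym => e; apply/esym/main.
Qed.

(** The relations are the multiples of a vector with five distinct values. Composing it with [t]
    rescales it; the fixed index makes the factor 1, so [t] fixes every index. *)
Lemma pts3_stab (l : 'F_p) (t : 'S_5) : (5.-primitive_root l)%R ->
  t \in affperms (pts3 l) -> t o0 = o0 -> t = 1.
Proof.
move=> lP At t0; have Hl := primitive5_neq1 lP; have l0 := Phi5_neq0 Hl.
have lE k : (l ^+ (k %% 5) = l ^+ k)%R by apply: (expr_mod _ (Phi5_exp5 Hl)).
pose x (i : 'I_5) := (l ^+ (3 + 4 * i))%R.
have xs : affine_rel (pts3 l) x.
  apply: pts3_relP => //; rewrite /x /= -(lE (3 + 4 * 1)%N) -(lE (3 + 4 * 2)%N) -(lE (3 + 4 *
    3)%N) -(lE (3 + 4 * 4)%N) /=.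
  by rewrite !expr0 !mulr1 expr1.
have := pts3_rel Hl (affperms_rel At xs); rewrite /= t0; set c := x (t o3).
have l3 : (x o0 = l ^+ 3)%R by [].
case=> e0 e1 e2 e4.
have c1 : c = 1%R.
  by apply: (mulfI (_ : l ^+ 3 != 0)%R); rewrite ?expf_neq0 // mulr1 -e0.
have xt : forall i, x (t i) = x i.
  have [f0 f1 f2 f4] := pts3_rel Hl xs.
  have f3 : x o3 = 1%R by rewrite /x /= -(lE (3 + 4 * 3)%N).
  by apply: ord5_ind; rewrite ?t0 // ?e1 ?e2 ?e4 ?f1 ?f2 ?f4 ?f3 -?/c c1.
by apply/permP=> i; rewrite perm1; apply: (primitive5_expr_inj (k := 4) (m := 3) lP) => //;
  apply: xt.
Qed.

Definition conic (y : 'I_5 -> 'F_p) (i : 'I_5) : 'rV['F_p]_2 :=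
  (\row_j (if j == 0 then y i else y i ^+ 2))%R.

Lemma conic_spanning y : injective y -> spanning (conic y).
Proof.
move=> y_inj; have nz i j : i != j -> (y i - y j != 0)%R.
  by rewrite subr_eq0 (inj_eq y_inj).
have [n10 n20 n21] := And3 (nz o1 o0 isT) (nz o2 o0 isT) (nz o2 o1 isT).
apply/spanningP=> u.
(* A combination of the first three points is found by divided differences, as in Newton
   interpolation. *)
have [b eb] : exists b, (b * (y o2 - y o1) = u 0 1 - u 0 0 * (y o1 + y o0))%R.
  by exists ((u 0 1 - u 0 0 * (y o1 + y o0)) / (y o2 - y o1))%R; rewrite divfK.
have [x1 e1] : exists x1, (x1 * (y o1 - y o0) = u 0 0 - b)%R by exists ((u 0 0 - b) / (y o1 - y
  o0))%R; rewrite divfK.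
have [x2 e2] : exists x2, (x2 * (y o2 - y o0) = b)%R by exists (b / (y o2 - y o0))%R;
  rewrite divfK.
exists (fun i : 'I_5 => nth 0 [:: - x1 - x2; x1; x2; 0; 0] i)%R.
split; first by rewrite sum5 /=; ring.
apply/rowP=> [[[|[|//]] Hj]]; rewrite sum5 !mxE /=.
  rewrite (_ : Ordinal Hj = 0%R); last exact/val_inj.
  transitivity (x1 * (y o1 - y o0) + x2 * (y o2 - y o0))%R; last by ring.
  by rewrite e1 e2 subrK.
rewrite (_ : Ordinal Hj = 1%R); last exact/val_inj.
transitivity (x1 * (y o1 - y o0) * (y o1 + y o0) + x2 * (y o2 - y o0) * (y o2 + y o0))%R;
  last by ring.
rewrite e1 e2.
transitivity (u 0 0 * (y o1 + y o0) + b * (y o2 - y o1))%R; last by ring.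
by rewrite eb; ring.
Qed.

(* y o t = a0 + a1 y + a2 y ^ 2, and the square of the right-hand side again has
   degree at most 2 on the five values of y, whence a2 ^ 2 = 0. *)
Lemma conic_affperm y (t : 'S_5) : injective y -> affperm (conic y) t ->
  exists a b, forall i, y (t i) = (a + b * y i)%R.
Proof.
move=> y_inj [M [c H]].
have E i : (y (t i) = y i * M 0 0 + y i ^+ 2 * M 1 0 + c 0 0)%R.
  have /rowP/(_ 0%R) := H i; rewrite !mxE !big_ord_recr big_ord0 /= !mxE add0r /= => ->.
  by congr (_ * M _ _ + _ * M _ _ + _)%R; apply/val_inj.
have E2 i : (y (t i) ^+ 2 = y i * M 0 1 + y i ^+ 2 * M 1 1 + c 0 1)%R.
  have /rowP/(_ 1%R) := H i; rewrite !mxE !big_ord_recr big_ord0 /= !mxE add0r /= => ->.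
  by congr (_ * M _ _ + _ * M _ _ + _)%R; apply/val_inj.
pose q := [:: c 0 0 ^+ 2 - c 0 1; c 0 0 * M 0 0 *+ 2 - M 0 1;
  M 0 0 ^+ 2 + c 0 0 * M 1 0 *+ 2 - M 1 1; M 0 0 * M 1 0 *+ 2; M 1 0 ^+ 2]%R.
have q0 : Poly q = 0%R.
  apply: (@roots_geq_poly_eq0 _ _ [seq y i | i : 'I_5]).
  - apply/allP=> _ /mapP[i _ ->]; rewrite /root horner_Poly /=; apply/eqP.
    transitivity ((y i * M 0 0 + y i ^+ 2 * M 1 0 + c 0 0) ^+ 2 - (y i * M 0 1 + y i ^+ 2 * M 1
      1 + c 0 1))%R; first by ring.
    by rewrite -E -E2 subrr.
  - by rewrite map_inj_uniq ?enum_uniq.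
  by rewrite size_map -cardE card_ord (leq_trans (size_Poly _)).
have := coef_Poly q 4; rewrite q0 coef0 /= => /esym/eqP.
rewrite expf_eq0 /= => /eqP M10.
by exists (c 0 0)%R, (M 0 0)%R => i; rewrite E M10; ring.
Qed.

Lemma affeq_affpermsE n (s s' : 'I_5 -> 'rV['F_p]_n) : affeq s s' -> affperms s = affperms s'.
Proof.
move=> e; have e' := affeq_sym e.
by apply/setP=> t; apply/affpermsP/affpermsP; apply: affeq_affperm.
Qed.

Lemma rec2_rot s t q : spanning s -> rec2 s t q -> rot \in affperms (s : 'I_5 -> 'rV['F_p]_2).
Proof.
move=> sp Hs; have [M [c [_ H]]] : affeq s (s \o @ordS 5).
  apply: rec2_affeq (sp) _ (Hs) _; first exact: spanning_perm (@ordS_inj 5) sp.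
  by move=> i; apply: Hs.
by apply/affpermsP; exists M, c => i; rewrite permE -H.
Qed.

(** The sequence l^(3 i), whose squares are l^i. The points (l^(3 i), l^i) of a parabola obey the
    recurrence with roots l^3 and l, and these have the trace and determinant of [pts2_1]. *)
Definition root5 (l : 'F_p) (i : 'I_5) : 'F_p := nth 0%R [:: 1; l ^+ 3; l; l ^+ 4; l ^+ 2]%R i.

Lemma root5_inj l : (5.-primitive_root l)%R -> injective (root5 l).
Proof.
move=> lP; have lE k : (l ^+ (k %% 5) = l ^+ k)%R by apply: (expr_mod _ (prim_expr_order lP)).
have E i : root5 l i = (l ^+ (0 + 3 * i))%R.
  by rewrite -lE; move: i; apply: ord5_ind; rewrite /root5 //= ?expr0 ?expr1.
by move=> i j; rewrite !E; apply: primitive5_expr_inj.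
Qed.

Lemma root5_rec2 (l : 'F_p) : Phi5 l = 0%R -> rec2 (conic (root5 l)) (- (l + 1)^-1)%R l^-1%R.
Proof.
move=> Hl; have l4 := Phi5_expr4 Hl; rewrite Phi5_inv_add1 // Phi5_inv //.
by apply: ord5_ind; apply/rowP=> [[[|[|//]] Hj]]; rewrite !mxE /root5 /=; ring: l4.
Qed.

Lemma pts2_1_conic (l : 'F_p) : (5.-primitive_root l)%R -> affeq (pts2_1 l) (conic (root5 l)).
Proof.
move=> lP; have Hl := primitive5_neq1 lP.
by apply: rec2_affeq (rows2_spanning _ _) (conic_spanning (root5_inj lP)) (rec2_pts2_1 Hl)
  (root5_rec2 Hl).
Qed.

(** On the parabola [t] acts on the fifth roots of unity by y -> a + b y. Their sum is 0, so 5 a =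
    0, and the fixed root 1 then gives b = 1. *)
Lemma pts2_1_stab (l : 'F_p) (t : 'S_5) : (5%:R != 0 :> 'F_p)%R -> (5.-primitive_root l)%R ->
  t \in affperms (pts2_1 l) -> t o0 = o0 -> t = 1.
Proof.
move=> n5 lP; have y_inj := root5_inj lP.
rewrite (affeq_affpermsE (pts2_1_conic lP)) => /affpermsP/(conic_affperm y_inj)[a [b H]] t0.
have S0 : (\sum_i root5 l i = 0)%R.
  by rewrite sum5 /root5 /= -(primitive5_neq1 lP) /Phi5; ring.
have a0 : a = 0%R.
  apply: (mulfI n5); rewrite mulr0 -[RHS]S0 [RHS](reindex_inj (@perm_inj _ t)).
  under [RHS]eq_bigr do rewrite H.
  by rewrite big_split /= -mulr_sumr S0 mulr0 addr0 sumr_const card_ord mulr_natl.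
have b1 : b = 1%R by have := H o0; rewrite t0 a0 /root5 /= add0r mulr1.
by apply/permP=> i; rewrite perm1; apply: y_inj; rewrite H a0 b1 mul1r add0r.
Qed.

End Symmetries.

(** * Affine symmetries of the golden family *)

Section GoldenSymmetries.

Variable p : nat.
Hypothesis p_pr : prime p.

Lemma pts2_2_relP (t : 'F_p) x : (\sum_i x i = 0 ->
  x o1 + (t + 1) * x o2 + x o3 = 0 /\ x o2 + (t + 1) * x o3 + x o4 = 0 ->
  affine_rel (@rows p 2 [:: [:: 0; 0]; [:: 1; 0]; [:: t + 1; 1]; [:: 1; t + 1]; [:: 0; 1]]) x)%R.
Proof.
move=> x0 [C0 C1]; split=> //; rewrite sum5.
by apply/rowP=> [[[|[|//]] Hj]]; rewrite !mxE /=; [rewrite -[RHS]C0|rewrite -[RHS]C1]; ring.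
Qed.

Lemma pts2_2_rot (l : 'F_p) : lambda_param l -> rot \in affperms (pts2_2 l).
Proof.
move=> Hl; have [n2 _ _] := lambda_param_neq p_pr Hl; have [t [t0 lE _]] := pts2_2E p_pr Hl.
by apply: rec2_rot (rows2_spanning _ _) _; rewrite lE; apply: rec2_pts2_2.
Qed.

Lemma pts2_2_refl (l : 'F_p) : lambda_param l -> refl5 \in affperms (pts2_2 l).
Proof.
move=> Hl; have [t [t0 lE E]] := pts2_2E p_pr Hl; have [f0 f1 f2 f3 f4] := refl5E.
have rV : refl5^-1 \in affperms_group (pts2_2 l); last by rewrite groupV in rV.
apply: sum_perm_rel; first exact: rows2_spanning.
rewrite E => x xs; have [C0 C1] := pts2_2_rel xs; have S := affine_rel_sum xs.
apply: pts2_2_relP; rewrite ?sum5 /= ?f0 f1 f2 f3 f4; first by rewrite -[RHS]S; ring.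
by split; [rewrite -[RHS]C1|rewrite -[RHS]C0]; ring.
Qed.

(** [T] satisfies T^2 = T + 1, and [v] spans the relations vanishing at [o0]. Composed with [s] it
    becomes w1 times itself, where [w1] is one of 1, -T, T, -1. The values T and -T would make T + 1
    or its negative a value of [v]; the values 1 and -1 give the identity and the reflection. *)
Lemma pts2_2_stab (l : 'F_p) (s : 'S_5) : lambda_param l ->
  s \in affperms (pts2_2 l) -> s o0 = o0 -> s = 1 \/ s = refl5.
Proof.
move=> Hl As s0; have [n2 n5 _] := lambda_param_neq p_pr Hl.
have [t [t0 lE E]] := pts2_2E p_pr Hl; have [f0 f1 f2 f3 f4] := refl5E.
pose T := (t + 1)%R; have T2 : (T ^+ 2 = T + 1)%R by rewrite -[RHS]addr0 -t0 /T; ring.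
have T0 : (T != 0)%R.
  by apply: contra_eqN T2 => /eqP->; rewrite expr0n add0r eq_sym oner_neq0.
pose v (i : 'I_5) := nth 0%R [:: 0; 1; - T; T; - 1]%R i.
rewrite E in As; have vs : affine_rel (@rows p 2 [:: [:: 0; 0]; [:: 1; 0]; [:: t + 1; 1];
  [:: 1; t + 1]; [:: 0; 1]]%R) v.
  by apply: pts2_2_relP; rewrite ?sum5 /v /= -/T; [ring|split; ring: T2].
have ws := affperms_rel As vs; have [C0 C1] := pts2_2_rel ws.
have S := affine_rel_sum ws.
move: C0 C1 S; rewrite -/T /= s0 (_ : v o0 = 0%R) // add0r.
set w1 := v (s o1); set w2 := v (s o2); set w3 := v (s o3); set w4 := v (s o4) => C0 C1 S.
have w3E : w3 = (T * w1)%R.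
  apply/eqP; rewrite -subr_eq0; apply/eqP.
  transitivity (- T * ((w1 + w2 + w3 + w4) - (w2 + T * w3 + w4)))%R; first by ring: T2.
  by rewrite C1 S subrr mulr0.
have w2E : w2 = (- T * w1)%R.
  apply: (mulfI T0); apply/eqP; rewrite -subr_eq0; apply/eqP.
  by rewrite -[RHS]C0 w3E; ring: T2.
have w4E : w4 = (- w1)%R.
  apply/eqP; rewrite -subr_eq0; apply/eqP; rewrite -[RHS]C1 w2E w3E; ring: T2.
have T1 : (T != 1)%R.
  apply: contra_eqN T2 => /eqP->; rewrite -subr_eq0 opprD addrA expr1n subrr add0r.
  by rewrite oppr_eq0 oner_neq0.
have TN1 : (T != - 1)%R.
  apply: contra_eqN T2 => /eqP->; rewrite addNr sqrrN expr1n oner_neq0 //.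
have n11 : (1 != - 1 :> 'F_p)%R by rewrite -subr_eq0 opprK.
have TNT : (T != - T)%R.
  by rewrite -subr_eq0 opprK (_ : T + T = 2%:R * T)%R ?mulf_neq0 //; ring.
have Hv k : v k <> (T + 1)%R /\ v k <> (- (T + 1))%R.
  have a1 : (T + 1 != 0)%R by rewrite addr_eq0.
  have a2 : (T + 1 != 1)%R by rewrite -subr_eq0 addrK.
  have a3 : (T + 1 != T)%R by rewrite -subr_eq0 addrAC subrr add0r oner_neq0.
  have a4 : (T + 1 != - T)%R.
    rewrite -addr_eq0; apply: contra_neqN (oner_neq0 'F_p) => /eqP e.
    (* Modulo T^2 = T + 1 the product (2 T + 1) (2 T - 3) equals 1, so 2 T + 1 is nonzero. *)
    transitivity ((T + 1 + T) * (2%:R * T - 3%:R))%R; first by ring: T2.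
    by rewrite e mul0r.
  have a5 : (T + 1 != - 1)%R.
    apply: contraNneq n5 => e.
    have e' : T = (- 2%:R)%R by rewrite -[LHS](addrK 1%R) e; ring.
    by move: T2; rewrite e' => /eqP; rewrite -subr_eq0 => /eqP <-; apply/eqP; ring.
  split; move: k; apply: ord5_ind; rewrite /v /=; apply/eqP.
  - by rewrite eq_sym.
  - by rewrite eq_sym.
  - by rewrite eq_sym.
  - by rewrite eq_sym.
  - by rewrite eq_sym.
  - by rewrite eq_sym oppr_eq0.
  - by rewrite eq_sym eqr_oppLR.
  - by rewrite eqr_opp eq_sym.
  - by rewrite eq_sym eqr_oppLR.
  - by rewrite eqr_opp eq_sym.
have v_inj : injective v.
  move=> i j /eqP; rewrite nth_uniq ?ltn_ord //= => [/eqP/val_inj//|].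
  rewrite !inE !negb_or ?(eq_sym 0%R) ?oppr_eq0 ?oner_neq0 T0 n11 TN1 /=.
  by rewrite ?(eq_sym 1%R) ?eqr_oppLR ?opprK ?T1 ?TN1 ?TNT //= (eq_sym _ T) TNT T1.
have n01 : s o1 <> o0 by move=> s1; have := perm_inj (etrans s1 (esym s0)).
have : w1 = v (s o1) by [].
move: (s o1) n01; apply: ord5_ind => // _ w1E.
- left; apply/permP; apply: ord5_ind; rewrite perm1 ?s0 //; apply: v_inj;
    rewrite -?/w1 -?/w2 -?/w3 -?/w4 ?w2E ?w3E ?w4E w1E /v /= ?mulr1 //.
- by case: (Hv (s o2)) => + _; rewrite -/w2 w2E w1E /v /= mulrNN -expr2 T2.
- by case: (Hv (s o2)) => _; rewrite -/w2 w2E w1E /v /= mulNr -expr2 T2.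
right; apply/permP; apply: ord5_ind; rewrite ?f0 ?f1 ?f2 ?f3 ?f4 ?s0 //; apply: v_inj;
    rewrite -?/w1 -?/w2 -?/w3 -?/w4 ?w2E ?w3E ?w4E w1E /v /= ?mulrN1 ?opprK //.
Qed.
End GoldenSymmetries.

(** * Independence of the graphs from the parameter *)

Section Uniqueness.

Variable p : nat.
Hypothesis p_pr : prime p.

Lemma miso_refl X : miso X X.
Proof. by exists id, id; split=> [||e]; [exists id|exists id|rewrite imset_id]. Qed.

Lemma affeq_perm_miso n (s s' : 'I_5 -> 'rV['F_p]_n) (f : 'I_5 -> 'I_5) :
  injective f -> affeq (s \o f) s' ->
  miso (mgraph_of (cay [set pt s i | i : 'I_5])) (mgraph_of (cay [set pt s' i | i : 'I_5])).
Proof. by move=> f_inj /affeq_miso; rewrite cay_perm. Qed.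

Lemma Phi5_sqr (l : 'F_p) : Phi5 l = 0%R -> Phi5 (l ^+ 2)%R = 0%R.
Proof. by move=> Hl; have l4 := Phi5_expr4 Hl; rewrite /Phi5; ring: l4. Qed.

(** 2 generates the units modulo 5, so repeated squaring reaches all elements of order 5 from any of
    them; in characteristic 5 the only root is 1. *)
Lemma ell_param_ind (P : 'F_p -> 'F_p -> Prop) :
  (forall l, P l l) -> (forall k l m, P k l -> P l m -> P k m) ->
  (forall l, Phi5 l = 0%R -> P l (l ^+ 2)%R) ->
  forall l l', ell_param l -> ell_param l' -> P l l'.
Proof.
move=> Pr Pt Ps l l' /(ell_paramP p_pr) Hl /(ell_paramP p_pr) Hl'.
have H2 : P l (l ^+ 2)%R by apply: Ps.
have H4 : P l (l ^+ 4)%R by rewrite (exprM l 2 2); apply: Pt H2 _; apply/Ps/Phi5_sqr.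
have H8 : P l (l ^+ 8)%R.
  by rewrite (exprM l 4 2); apply: Pt H4 _; apply: Ps; rewrite (exprM l 2 2);
    do 2!apply: Phi5_sqr.
have one (k : 'F_p) : Phi5 k = 0%R -> (k == 1%R) = (5%:R == 0 :> 'F_p)%R.
  move=> Hk; apply/idP/idP => /eqP e; apply/eqP.
    by transitivity (Phi5 k) => //; rewrite e /Phi5; ring.
  apply/eqP; apply: contraTT isT => /(exp5_dvd p_pr (Phi5_exp5 Hk))[_ /(Fp_odd_neq0 p_pr)].
  by rewrite e eqxx.
have [l1|l1] := eqVneq l 1%R.
  suff -> : l' = 1%R by rewrite l1.
  by apply/eqP; rewrite (one _ Hl') -(one _ Hl) l1.
have [lP _] := exp5_dvd p_pr (Phi5_exp5 Hl) l1.
have [[[|[|[|[|[|//]]]]] Hk] e] := prim_rootP lP (Phi5_exp5 Hl'); rewrite e //=.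
- by rewrite (one _ Hl) -(one _ Hl') e expr0 eqxx in l1.
- by rewrite -(expr_mod 8 (Phi5_exp5 Hl)) in H8.
Qed.

Lemma dblE : [/\ dbl o0 = o0, dbl o1 = o2, dbl o2 = o4, dbl o3 = o1 & dbl o4 = o3].
Proof. by split; apply/val_inj; rewrite /= inordK. Qed.

Lemma CGD2_1_unique (l l' : 'F_p) : ell_param l -> ell_param l' ->
  miso (mgraph_of (CGD2_1 l)) (mgraph_of (CGD2_1 l')).
Proof.
apply: (ell_param_ind (P := fun l l' => miso (mgraph_of (CGD2_1 l)) (mgraph_of (CGD2_1 l')))).
- by move=> k; apply: miso_refl.
- by move=> k m n; apply: miso_trans.
move=> {l'} {}l Hl; rewrite !CGD2_1E; apply: (affeq_perm_miso dbl_inj).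
have H2 := Phi5_sqr Hl; have l4 := Phi5_expr4 Hl.
have := rec2_double (rec2_pts2_1 Hl).
have -> : ((- (l + 1)^-1) ^+ 2 - l^-1 *+ 2 = - (l ^+ 2 + 1)^-1)%R.
  by rewrite !Phi5_inv_add1 // Phi5_inv //; ring: l4.
have -> : (l^-1 ^+ 2 = (l ^+ 2)^-1)%R by rewrite exprVn.
move=> Hd; apply: rec2_affeq _ (rows2_spanning _ _) Hd (rec2_pts2_1 H2).
exact: spanning_perm dbl_inj (rows2_spanning _ _).
Qed.

(** The square roots of 5 are opposite. Changing the sign replaces t by the other golden root - t -
    1 = t^2 - 2, which is the trace after doubling the indices. *)
Lemma CGD2_2_unique (l l' : 'F_p) : lambda_param l -> lambda_param l' ->
  miso (mgraph_of (CGD2_2 l)) (mgraph_of (CGD2_2 l')).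
Proof.
move=> Hl Hl'; have [n2 _ _] := lambda_param_neq p_pr Hl.
have /and3P[_ _ /eqP l2] := Hl; have /and3P[_ _ /eqP l2'] := Hl'.
have : (l' ^+ 2 == l ^+ 2)%R by rewrite l2 l2'.
rewrite eqf_sqr => /orP[/eqP->|/eqP->]; first exact: miso_refl.
have [t [t0 -> _]] := pts2_2E p_pr Hl.
rewrite !CGD2_2E; apply: (affeq_perm_miso dbl_inj).
have := rec2_double (rec2_pts2_2 n2 t0).
have t2 : (t ^+ 2 = 1 - t)%R by rewrite -[RHS]addr0 -t0; ring.
have -> : (t ^+ 2 - 1 *+ 2 = - t - 1)%R by ring: t2.
rewrite expr1n => Hd.
have -> : (- (2%:R * t + 1) = 2%:R * (- t - 1) + 1 :> 'F_p)%R by ring.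
apply: rec2_affeq _ (rows2_spanning _ _) Hd (rec2_pts2_2 n2 _).
  exact: spanning_perm dbl_inj (rows2_spanning _ _).
by ring: t2.
Qed.

Lemma CGD3_unique (l l' : 'F_p) : ell_param l -> ell_param l' ->
  miso (mgraph_of (CGD3 l)) (mgraph_of (CGD3 l')).
Proof.
apply: (ell_param_ind (P := fun l l' => miso (mgraph_of (CGD3 l)) (mgraph_of (CGD3 l')))).
- by move=> k; apply: miso_refl.
- by move=> k m n; apply: miso_trans.
move=> {l'} {}l Hl; rewrite !CGD3E; apply: (affeq_perm_miso dbl_inj).
have H2 := Phi5_sqr Hl; have l4 := Phi5_expr4 Hl; have [d0 d1 d2 d3 d4] := dblE.
apply: affeq_rel; last 1 first; [|exact: spanning_perm dbl_inj (pts3_spanning _)|exact: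
  pts3_spanning].
move=> x [x0 xs]; have xs' : affine_rel (pts3 l) (x \o invF dbl_inj).
  split; first by rewrite (reindex_inj dbl_inj) -[RHS]x0; apply: eq_bigr => i _;
    rewrite /= invF_f.
  by rewrite (reindex_inj dbl_inj) -[RHS]xs; apply: eq_bigr => i _; rewrite /= invF_f.
have E i : (x \o invF dbl_inj) (dbl i) = x i by rewrite /= invF_f.
have [e0 e1 e2 e4] := pts3_rel Hl xs'.
move: (E o0) (E o1) (E o2) (E o3) (E o4) e0 e1 e2 e4; rewrite d0 d1 d2 d3 d4.
move=> -> -> -> -> -> e0 e3 e1 e2; apply: pts3_relP => //.
by split; rewrite ?e0 ?e1 ?e2 ?e3; ring: l4.
Qed.

End Uniqueness.

(* The two sides of the equation v h_x h_y h_z h_u h_w = v h_a h_b h_c between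
   walks, modulo 3. *)
Definition walk_eq (a b c x y z u w : nat) :=
  all (fun j => 3 %| dst (ncnt x z w j + (b == j)) (ncnt a c y j + (u == j))) (iota 0 5).

Definition walk_count (a b c : nat) : nat :=
  sumn [seq sumn [seq sumn [seq sumn [seq sumn [seq (walk_eq a b c x y z u w : nat)
    | w <- iota 0 5] | u <- iota 0 5] | z <- iota 0 5] | y <- iota 0 5] | x <- iota 0 5].

Lemma walk_count_check :
  all (fun a => all (fun b => all (fun c => (a == b) || (b == c) || (walk_count a b c == if a
    == c then 52 else 48))
   (iota 0 5)) (iota 0 5)) (iota 0 5).
Proof. by vm_compute. Qed.

Lemma prime_geq5 p : prime p -> p != 2 -> p != 3 -> 5 <= p.
Proof. by do 5?[case: p => //= p]. Qed.

(** * Rigidity in dimension four for every prime *)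

Section Rigidity.

Variable p : nat.
Hypothesis p_pr : prime p.

(** In characteristic 2 the group is elementary abelian and the five involutions are independent in
    it: the graph is the 5-cube, whose quadrangles all have labels a b a b. *)
Lemma pts4_rigid2 : p = 2 ->
  forall f, f \in sAut_group (cay [set pt (pts4 p) i | i : 'I_5]) -> rigid (pt (pts4 p)) f.
Proof.
move=> p2; have v2 (v : 'rV['F_p]_4) : (- v = v)%R.
  have c2 : (1 = - 1 :> 'F_p)%R.
    by apply/eqP; rewrite -subr_eq0 opprK; rewrite (Fp_natr_eq0 p_pr 2) p2.
  by rewrite -scaleN1r -c2 scale1r.
apply: (rigid_of_squares (pt_inj (@pts4_inj p)) (pt_invol _) (pt_gen (pts4_spanning p))).
  move=> a b c d Hd; rewrite pt_pt /tr !pt_mul => /(congr1 fst) /= e.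
  (* The same point is added on both sides because [word_rel] expects three terms a side; its
     contribution cancels in the coefficient at [a]. *)
  have E : (pts4 p a + pts4 p c + pts4 p o0 = pts4 p b + pts4 p d + pts4 p o0)%R.
    congr (_ + _)%R; apply/eqP; rewrite -subr_eq0; apply/eqP; rewrite -[RHS]e.
    by rewrite ?expr1 ?scaleN1r !v2 !addrA [LHS](ACl (4*2*3*1)%AC).
  have /pts4_rel/(_ a) := word_rel E.
  case/and4P: Hd => nab nbc ncd nda; have [//|nac] := eqVneq a c.
  rewrite /ncnt eqxx (eq_sym (c : nat)) (eq_sym (b : nat)).
  rewrite (negPf (nac : val a != val c)) (negPf (nab : val a != val b)) (negPf (nda : val d !=
    val a)).
  by rewrite addn0 !add0n natrD addrK => /eqP; rewrite oner_eq0.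
by move=> a b; rewrite !pt_pt -[X in tr X]v2 opprB.
Qed.

Lemma pts4_walk (a b c x y z u w : 'I_5) (v : GD p 4) : p = 3 ->
  (pt (pts4 p) w * (pt (pts4 p) u * (pt (pts4 p) z * (pt (pts4 p) y * (pt (pts4 p) x * v))))
    == pt (pts4 p) c * (pt (pts4 p) b * (pt (pts4 p) a * v))) = walk_eq a b c x y z u w.
Proof.
move=> p3; have mulE i (g : GD p 4) :
    pt (pts4 p) i * g = (pts4 p i - g.1, ~~ g.2)%R :> GD p 4.
  by case: g => r e; rewrite pt_mul.
rewrite 8!mulE /= !negbK xpair_eqE eqxx andbT; move: (v.1) => r.
pose P (j : 'I_5) := ncnt x z w j + (b == j :> nat).
pose Q (j : 'I_5) := ncnt a c y j + (u == j :> nat).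
set s := pts4 p.
have PE : (\sum_j (P j)%:R *: s j = s x + s z + s w + s b)%R.
  rewrite -(sum_ncnt s) -(sum_delta s b) -big_split; apply: eq_bigr => j _ /=.
  by rewrite natrD scalerDl.
have QE : (\sum_j (Q j)%:R *: s j = s a + s c + s y + s u)%R.
  rewrite -(sum_ncnt s) -(sum_delta s u) -big_split; apply: eq_bigr => j _ /=.
  by rewrite natrD scalerDl.
rewrite -subr_eq0.
have -> : (s w - (s u - (s z - (s y - (s x - r)))) - (s c - (s b - (s a - r))) =
           \sum_j (P j)%:R *: s j - \sum_j (Q j)%:R *: s j)%R.
  rewrite PE QE; apply/rowP=> j; rewrite !mxE; ring.
have wE : walk_eq a b c x y z u w = [forall j, 3 %| dst (P j) (Q j)].
  apply/allP/forallP=> [H j|H j]; first by apply: H; rewrite mem_iota /=.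
  by rewrite mem_iota => /= j5; apply: (H (Ordinal j5)).
rewrite wE; apply/eqP/forallP=> [e0 j|H].
  have : affine_rel s (fun j => (P j)%:R - (Q j)%:R)%R.
    split; last by under eq_bigr do rewrite scalerBl; rewrite sumrB.
    have S (i k l m : 'I_5) : (\sum_(j < 5) (ncnt i k l j + (m == j :> nat))%:R = 4%:R :> 'F_p)%R.
      have E1 := sum_ncnt (V := GRing.regular 'F_p) (fun=> 1%R) i k l.
      have E2 := sum_delta (V := GRing.regular 'F_p) (fun=> 1%R) m.
      transitivity (1 + 1 + 1 + 1 : 'F_p)%R; last by ring.
      rewrite -[in RHS]E1 -[X in (_ + X)%R]E2 -big_split; apply: eq_bigr => h _ /=.
      by rewrite natrD; congr (_ + _)%R; rewrite -[LHS]mulr1.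
    by rewrite sumrB !S subrr.
  by move/pts4_rel/(_ j)/eqP; rewrite subr_eq0 => /eqP/(Fp_natr_dst p_pr); rewrite p3.
apply/eqP; rewrite subr_eq0; apply/eqP/eq_bigr => j _; congr (_ *: _)%R.
have := H j; rewrite -p3 -(Fp_natr_eq0 p_pr) /dst natrD.
case/orP: (leq_total (P j) (Q j)) => PQ.
  by rewrite (eqP (PQ : _ - _ == 0)) add0r natrB // subr_eq0 => /eqP.
by rewrite (eqP (PQ : _ - _ == 0)) addr0 natrB // subr_eq0 => /eqP.
Qed.

Lemma sum_iota5 (F : nat -> nat) : (\sum_(i < 5) F i)%N = sumn [seq F i | i <- iota 0 5].
Proof. by rewrite sumnE big_map -[iota 0 5]/(index_iota 0 5) big_mkord. Qed.

Lemma walks5_pts4 (a b c : 'I_5) (v : GD p 4) : p = 3 ->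
  walks (pt (pts4 p)) 5 v (pt (pts4 p) c * (pt (pts4 p) b * (pt (pts4 p) a * v)))
   = walk_count a b c.
Proof.
move=> p3; rewrite /walks /walk_count.
do 4!(rewrite -sum_iota5; apply: eq_bigr => ? _).
by rewrite -sum_iota5; apply: eq_bigr => w _; rewrite pts4_walk.
Qed.

(* At p = 3 there are further hexagons, with labels a b a b a b; counting the
   walks of length 5 from v to h_c h_b h_a v tells a = c from a <> c. *)
Lemma pts4_rigid3 : p = 3 ->
  forall f, f \in sAut_group (cay [set pt (pts4 p) i | i : 'I_5]) -> rigid (pt (pts4 p)) f.
Proof.
move=> p3 f Af; have s_inj := pt_inj (@pts4_inj p); have s_gen := pt_gen (pts4_spanning p).
have s_swap := pt_swap (pts4 p); have s_invol := pt_invol (pts4 p).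
have io (i : 'I_5) : (i : nat) \in iota 0 5 by rewrite mem_iota /=.
have wc (a b c : 'I_5) : a != b -> b != c -> walk_count a b c = if a == c then 52 else 48.
  move=> nab nbc; have := walk_count_check.
  move/allP/(_ _ (io a))/allP/(_ _ (io b))/allP/(_ _ (io c)).
  by rewrite (negPf (nab : val a != val b)) (negPf (nbc : val b != val c)) => /eqP.
apply: (rigid_hexagon s_inj s_invol s_gen s_swap Af) => v a b c nab nbc nac.
have [b' [c' [b'' [c'' /= [H1 H2 H3]]]]] := hexagon_image s_inj s_invol s_swap v Af nab nbc nac.
set a' := lab _ f v a in H1 H2 H3 *; set a'' := lab _ f _ a in H1 H2 *.
have e6 : (pts4 p a' + pts4 p c' + pts4 p b'' = pts4 p b' + pts4 p a'' + pts4 p c'')%R.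
  have := congr1 (fun x : GD p 4 => x.1) H2.
  rewrite pt_pt /tr !pt_mul /= !expr1 !scaleN1r alternating6 => /eqP.
  rewrite subr_eq0 => /eqP e.
  rewrite -(addrC (pts4 p b'')) (addrC (pts4 p a')) addrA -e addrC addrA (addrC (pts4 p b')).
  by rewrite addrAC (addrC (pts4 p c'')) addrAC (addrC (pts4 p a'')).
have [//|/orP[alt|/hasP[x /mapP[j]]]] := hexcheckP hexcheck_mod3 H1.
  case/and4P: alt => /eqP/val_inj ac' _ _ _.
  have := walks_aut s_inj 5 v (pt (pts4 p) c * (pt (pts4 p) b * (pt (pts4 p) a * v))) Af.
  case/and4P: H1 => nab' nbc' _ _.
  by rewrite H3 !walks5_pts4 // !wc // ac' eqxx (negPf nac).
rewrite mem_iota => j5 -> /=; have /pts4_rel/(_ (Ordinal j5))/eqP := word_rel e6.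
by rewrite subr_eq0 => /eqP/(Fp_natr_dst p_pr); rewrite p3 /= => ->.
Qed.

Lemma pts4_rigid f : f \in sAut_group (cay [set pt (pts4 p) i | i : 'I_5]) -> rigid (pt (pts4
  p)) f.
Proof.
have [p2|n2] := eqVneq p 2; first exact: pts4_rigid2.
have [p3|n3] := eqVneq p 3; first exact: pts4_rigid3.
apply: hex_free_rigid (pts4_spanning p) (@pts4_inj p) _ f.
apply: hex_free_small => //; last by move=> x /pts4_rel.
exact: prime_geq5.
Qed.

End Rigidity.

(** * Automorphism groups and the classification of covers *)

Section MainCases.

Variable p : nat.
Hypothesis p_pr : prime p.

Lemma CGD4_aut : is_sdprod_by (sAut_group (CGD4 p)) (RR (GD p 4)) [set: 'S_5]%G.
Proof.
rewrite CGD4E; apply: rigid_is_sdprod (pts4_spanning p) (@pts4_inj p) _ (pts4_affperms p).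
exact: pts4_rigid.
Qed.

Lemma ell_param_prim (l : 'F_p) : 5 %| p - 1 -> ell_param l ->
  [/\ Phi5 l = 0%R, (5.-primitive_root l)%R, (5%:R != 0 :> 'F_p)%R & 11 <= p].
Proof.
move=> H5 lP; have p11 : 11 <= p by apply: prime_pm1_mod5; rewrite ?H5.
split=> //; [exact/(ell_paramP p_pr)| |exact: Fp_odd_neq0].
by case/orP: lP => [/andP[/eqP p5]|/andP[]] //; rewrite p5 in H5.
Qed.

Lemma CGD3_aut (l : 'F_p) : 5 %| p - 1 -> ell_param l ->
  is_sdprod_by (sAut_group (CGD3 l)) (RR (GD p 3)) [set: 'Z_5]%G.
Proof.
move=> H5 /(ell_param_prim H5)[Hl lP n5 p11]; rewrite CGD3E.
have sp := pts3_spanning l; have s_inj := pts3_inj Hl.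
apply: rigid_is_sdprod => //.
  apply: hex_free_rigid => //; apply: (hex_free_sq p_pr p11) => x.
  exact: pts3_rel_sq.
by apply: affperms_Z5 (pts3_rot Hl) _ => t; apply: pts3_stab.
Qed.

Lemma CGD2_1_aut (l : 'F_p) : 5 %| p - 1 -> ell_param l ->
  is_sdprod_by (sAut_group (CGD2_1 l)) (RR (GD p 2)) [set: 'Z_5]%G.
Proof.
move=> H5 /(ell_param_prim H5)[Hl lP n5 p11]; rewrite CGD2_1E.
have s_inj := pts2_1_inj Hl.
apply: rigid_is_sdprod => //; first exact: rows2_spanning.
  apply: hex_free_rigid => //; first exact: rows2_spanning.
  apply: (hex_free_sq p_pr p11) => x; exact: pts2_1_rel_sq.
apply: affperms_Z5; first exact: rec2_rot (rows2_spanning _ _) (rec2_pts2_1 Hl).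
by move=> t; apply: pts2_1_stab.
Qed.

Lemma CGD2_2_aut (l : 'F_p) : lambda_param l ->
  is_sdprod_by (sAut_group (CGD2_2 l)) (RR (GD p 2)) 'D_10%G.
Proof.
move=> Hl; have [n2 n5 p11] := lambda_param_neq p_pr Hl; rewrite CGD2_2E.
have s_inj := pts2_2_inj p_pr Hl.
apply: rigid_is_sdprod => //; first exact: rows2_spanning.
  apply: hex_free_rigid => //; first exact: rows2_spanning.
  have [t [t0 _ ->]] := pts2_2E p_pr Hl.
  by apply: (hex_free_golden p_pr p11 t0) => x; apply: pts2_2_rel.
apply: affperms_D10; [exact: pts2_2_rot|exact: pts2_2_refl|].
by move=> t; apply: pts2_2_stab.
Qed.

Lemma cover_classification (n : nat) (X : mgraph) : 1 < n -> mconnected X ->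
  symmetric_cover [set: 'rV['F_p]_n]%G X (dipole 5) ->
  [/\ 2 <= n <= 4,
      n = 2 ->
        (exists2 l : 'F_p, ell_param l & miso X (mgraph_of (CGD2_1 l)))
        \/ (exists2 l : 'F_p, lambda_param l & miso X (mgraph_of (CGD2_2 l))),
      n = 3 ->
        exists2 l : 'F_p, ell_param l & miso X (mgraph_of (CGD3 l))
    & n = 4 -> miso X (mgraph_of (CGD4 p))].
Proof.
move=> n_gt1 X_conn X_cov.
have [s [sp s_tr s_iso]] := symmetric_cover_voltage X_conn X_cov.
have [f f_inj s_cyc] := transitive_cyc s_tr.
have sp_f := spanning_perm f_inj sp.
(* Injectivity of [s], which the isomorphism with [X] awaits, is carried back from the explicit
   family [s']. *)
have finish (s' : 'I_5 -> 'rV['F_p]_n) : injective s' -> affeq (s \o f) s' ->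
    miso X (mgraph_of (cay [set pt s' i | i : 'I_5])).
  move=> s'_inj sf; apply: miso_trans (s_iso _) (affeq_perm_miso f_inj sf).
  have sf_inj := affeq_inj sf s'_inj.
  move=> i j; rewrite -(f_invF f_inj i) -(f_invF f_inj j) => e.
  by congr f; apply: sf_inj.
split; first by rewrite n_gt1 (spanning_dim sp).
- move=> n2; subst n; case: (classification2 p_pr sp_f s_cyc) => [[l lP sl]|[l lP sl]].
    left; exists l => //; rewrite CGD2_1E; apply: finish sl.
    by apply: pts2_1_inj; apply/(ell_paramP p_pr).
  by right; exists l => //; rewrite CGD2_2E; apply: finish sl; apply: pts2_2_inj.
- move=> n3; subst n; have [l lP sl] := classification3 p_pr sp_f s_cyc.
  exists l => //; rewrite CGD3E; apply: finish sl.
  by apply: pts3_inj; apply/(ell_paramP p_pr).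
move=> n4; subst n; rewrite CGD4E; apply: finish (classification4 sp_f).
exact: pts4_inj.
Qed.

End MainCases.

(** At l = 1 the relations are the constant vectors, which every permutation of the points
    preserves; hence all of ['S_5]. *)
Lemma CGD3_aut5 :
  is_sdprod_by (sAut_group (CGD3 (1%R : 'F_5))) (RR (GD 5 3)) [set: 'S_5]%G.
Proof.
have Hl : Phi5 (1%R : 'F_5) = 0%R by apply/eqP.
rewrite CGD3E; apply: rigid_is_sdprod.
- exact: pts3_spanning.
- exact: pts3_inj.
- apply: hex_free_rigid; [exact: pts3_spanning|exact: pts3_inj|].
  move=> a b c d e f Hd /word_rel/(pts3_rel Hl)[e0 e1 e2 e4].
  case: (hexcheckP hexcheck_mod5 Hd) => // /hasP[j]; rewrite mem_iota => /= j5.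
  rewrite !expr1n !mul1r in e0 e1 e2 e4.
  have E : forall i : 'I_5, ((ncnt a c e i)%:R - (ncnt b d f i)%:R = (ncnt a c e 3)%:R - (ncnt
    b d f 3)%:R :> 'F_5)%R.
    by apply: ord5_ind.
  have := E (Ordinal j5); rewrite /= => Ej.
  have : ((ncnt a c e j + ncnt b d f 3)%:R = (ncnt a c e 3 + ncnt b d f j)%:R :> 'F_5)%R.
    rewrite 2!natrD; apply/eqP; rewrite -subr_eq0; apply/eqP.
    move/eqP: Ej; rewrite -subr_eq0 => /eqP <-; ring.
  by move/(Fp_natr_dst (isT : prime 5)) => ->.
have -> : affperms_group (pts3 (1%R : 'F_5)) = [set: 'S_5]%G; last exact: isog_refl.
apply/val_inj/setP=> t; rewrite [RHS]inE -[t]invgK; apply: sum_perm_rel;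
  first exact: pts3_spanning.
move=> x /(pts3_rel Hl); rewrite !expr1n !mul1r => [[e0 e1 e2 e4]].
have E i : x i = x o3 by move: i; apply: ord5_ind.
by apply: pts3_relP => //; rewrite /= !E !expr1n !mul1r.
Qed.

(** * The planar graph at p = 5 *)

Lemma is_F20_isog (gT hT : finGroupType) (G : {group gT}) (H : {group hT}) :
  is_F20 G -> G \isog H -> is_F20 H.
Proof.
case/andP=> frG /eqP cG GH; have [f f_inj fG] := isogP GH.
apply/andP; split; last by rewrite -(card_isog GH) cG.
by rewrite -fG; apply: injm_Frobenius_group.
Qed.

Lemma is_F20xF20_Z2_isog (gT hT : finGroupType) (G : {group gT}) (H : {group hT}) :
  is_F20xF20_Z2 G -> G \isog H -> is_F20xF20_Z2 H.
Proof.
case=> K1 [K2 [K [Q [F1 F2 KE GE [QZ [x Qx Kx]]]]]] GH.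
have [f f_inj fG] := isogP GH.
have [_ mulKQ _ _] := sdprodP GE.
have [sKG sQG] : K \subset G /\ Q \subset G.
  by rewrite -mulKQ; split; [apply: mulG_subl|apply: mulG_subr].
have [_ mulK12 _ _] := dprodP KE.
have [sK1 sK2] : K1 \subset G /\ K2 \subset G.
  split; apply: subset_trans sKG; rewrite -mulK12; [exact: mulG_subl|exact: mulG_subr].
have F20f (L : {group gT}) : L \subset G -> is_F20 L -> is_F20 (f @* L).
  by move=> sL FL; apply: is_F20_isog FL _; apply: sub_isog.
exists (f @* K1)%G, (f @* K2)%G, (f @* K)%G, (f @* Q)%G; split; rewrite ?F20f //.
- exact: injm_dprod KE.
- by rewrite -fG; apply: injm_sdprod GE.
split; first by apply: isog_trans QZ; rewrite isog_sym; apply: sub_isog.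
exists (f x); first by rewrite mem_morphim // (subsetP sQG).
by rewrite -morphimJ ?(subsetP sQG) // Kx.
Qed.

(** A transitive action on five points in which only 1 fixes two of them is a Frobenius action once
    the point stabilizers are nontrivial; here they have order 4. *)
Lemma is_F20_perm (T : finType) (G : {group {perm T}}) (S : {set T}) (u : T) :
  #|G| = 20 -> #|S| = 5 -> u \in S -> orbit 'P G u = S ->
  (forall g x y, g \in G -> x \in S -> y \in S -> x != y -> g x = x -> g y = y -> g = 1) ->
  is_F20 G.
Proof.
move=> cG cS uS oS fix2; rewrite /is_F20 cG eqxx andbT.
have [v vS nuv] : exists2 v, v \in S & u != v.
  have : 0 < #|S :\ u| by move: cS; rewrite (cardsD1 u) uS add1n => -[->].
  by rewrite card_gt0 => /set0Pn[v]; rewrite !inE => /andP[vu vS]; exists v; rewrite // eq_sym.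
apply/existsP; exists 'C_G[u | 'P]%G; apply/Frobenius_actionP.
exists T S 'P%act; split.
- apply/subsetP=> g; rewrite inE => /andP[Gg /astabP fixg]; apply/set1P.
  by apply: (fix2 g u v) => //; [apply: fixg|apply: fixg].
- by apply/imsetP; exists u => //; rewrite oS.
- move=> g /setD1P[g1 Gg]; rewrite leqNgt; apply/negP=> /card_gt1P[x [y []]].
  move=> /setIP[xS /afix1P gx] /setIP[yS /afix1P gy] nxy.
  by case/eqP: g1; apply: (fix2 g x y).
- have := card_orbit_stab 'P G u; rewrite oS cS cG => c5.
  by apply/eqP=> C1; move: c5; rewrite C1 cards1.
by exists u.
Qed.

Lemma affine_fix2 (F : fieldType) (t b x y : F) :
  x != y -> (t * x + b = x -> t * y + b = y -> t = 1 /\ b = 0)%R.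
Proof.
move=> nxy ex ey; have nxy' : (x - y != 0)%R by rewrite subr_eq0.
have t1 : t = 1%R.
  apply: (mulIf nxy'); rewrite mul1r -{2}ex -{2}ey mulrBr.
  by rewrite opprD addrACA subrr addr0.
by split=> //; apply: (addrI x); rewrite addr0 -{2}ex t1 mul1r.
Qed.

(** * The wreath product of an affine group of a line with an involution *)

Section AffineWreath.

Variable K : finFieldType.
Local Notation D := (K * bool)%type.
Implicit Types (q : {perm D}).

Definition aff2 q (r t a b : K) :=
  (forall x, q (x, false) = (r * x + a, false)%R) /\
  (forall x, q (x, true) = (t * x + b, true)%R).

Lemma aff2_uniq q q' r t a b : aff2 q r t a b -> aff2 q' r t a b -> q = q'.
Proof. by move=> [H0 H1] [H0' H1']; apply/permP=> -[x []]; rewrite ?H0 ?H0' ?H1 ?H1'. Qed.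

Lemma aff2_inj q r t a b r' t' a' b' : aff2 q r t a b -> aff2 q r' t' a' b' ->
  [/\ r = r', t = t', a = a' & b = b'].
Proof.
move=> [H0 H1] [H0' H1'].
have E0 x : (r * x + a = r' * x + a')%R by have := H0 x; rewrite H0' => -[].
have E1 x : (t * x + b = t' * x + b')%R by have := H1 x; rewrite H1' => -[].
have := E0 0%R; rewrite !mulr0 !add0r => ea; have := E1 0%R; rewrite !mulr0 !add0r => eb.
have := E0 1%R; rewrite !mulr1 ea => /addIr er; have := E1 1%R; rewrite !mulr1 eb => /addIr et.
by split.
Qed.

Lemma aff2M q r t a b q' r' t' a' b' : aff2 q r t a b -> aff2 q' r' t' a' b' ->
  aff2 (q * q') (r' * r)%R (t' * t)%R (r' * a + a')%R (t' * b + b')%R.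
Proof.
by move=> [H0 H1] [H0' H1']; split=> x; rewrite permM ?H0 ?H1 ?H0' ?H1' mulrDr addrA mulrA.
Qed.

Lemma aff2_1 : aff2 1 1%R 1%R 0%R 0%R.
Proof. by split=> x; rewrite perm1 mul1r addr0. Qed.

Definition affine2 (r t a b : K) (u : D) : D :=
  if u.2 then (t * u.1 + b, true)%R else (r * u.1 + a, false)%R.

Lemma aff2_ex (r t a b : K) : r != 0%R -> t != 0%R -> exists q, aff2 q r t a b.
Proof.
move=> r0 t0; have inj : injective (affine2 r t a b).
  move=> [x e] [y e']; rewrite /affine2 /=; case: e; case: e' => // -[].
    by move=> /addIr/(mulfI t0)->.
  by move=> /addIr/(mulfI r0)->.
by exists (perm inj); split=> x; rewrite permE.
Qed.

Fact flip_inj : injective (fun u : D => (u.1, ~~ u.2)).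
Proof. by move=> [x e] [y e'] [-> /negb_inj->]. Qed.

Definition flip : {perm D} := perm flip_inj.

Lemma flipE x e : flip (x, e) = (x, ~~ e). Proof. by rewrite permE. Qed.

Lemma flipK : flip * flip = 1.
Proof. by apply/permP=> -[x e]; rewrite permM !flipE negbK perm1. Qed.

Lemma aff2_flip q r t a b : aff2 q r t a b -> aff2 (q ^ flip) t r b a.
Proof.
have fV : flip^-1 = flip by apply: (mulgI flip); rewrite mulgV flipK.
by move=> [H0 H1]; split=> x; rewrite conjgE fV !permM flipE ?H0 ?H1 flipE.
Qed.

Lemma flip_neq q r t a b : aff2 q r t a b -> q != flip.
Proof. by move=> [H0 _]; apply/eqP=> E; have := H0 0%R; rewrite E flipE. Qed.

Variable J : {group {perm D}}.
Hypothesis JP : forall q, q \in J <->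
  exists r t a b, [/\ r != 0%R, t != 0%R & aff2 q r t a b \/ aff2 (q * flip) r t a b].
Hypothesis cK : #|K| = 5.

Let K1 := 'C_J([set u : D | u.2] | 'P)%G.
Let K2 := (K1 :^ flip)%G.

Lemma J_aff2 q r t a b : r != 0%R -> t != 0%R -> aff2 q r t a b -> q \in J.
Proof. by move=> r0 t0 H; apply/JP; exists r, t, a, b; split=> //; left. Qed.

Lemma flip_J : flip \in J.
Proof.
apply/JP; exists 1%R, 1%R, 0%R, 0%R; split; rewrite ?oner_neq0 //; right.
by rewrite flipK; apply: aff2_1.
Qed.

Lemma K1P q : q \in K1 <-> exists r a, r != 0%R /\ aff2 q r 1%R a 0%R.
Proof.
split=> [/setIP[/JP[r [t [a [b [r0 t0 Hq]]]]] /astabP fq]|[r [a [r0 Hq]]]].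
  have fqx x : q (x, true) = (x, true) by apply: fq; rewrite inE.
  case: Hq => [[H0 H1]|[H0 H1]]; last first.
    by have := H1 0%R; rewrite permM fqx flipE.
  exists r, a; split=> //; split=> // x; first by rewrite fqx mul1r addr0.
apply/setIP; split; first exact: J_aff2 r0 (oner_neq0 K) Hq.
by apply/astabP=> -[x e]; rewrite inE /= => ->; rewrite /aperm (proj2 Hq) mul1r addr0.
Qed.

Lemma K2P q : q \in K2 <-> exists t b, t != 0%R /\ aff2 q 1%R t 0%R b.
Proof.
have fV : flip^-1 = flip by apply: (mulgI flip); rewrite mulgV flipK.
rewrite mem_conjg fV K1P; split=> -[r [a [r0 /aff2_flip Hq]]]; exists r, a; split=> //.
by rewrite -conjgM flipK conjg1 in Hq.
Qed.

Lemma card_K1 : #|K1| = 20.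
Proof.
have c0 : #|[set~ 0%R : K]| = 4 by rewrite cardsC1 cK.
have ex (u : K * K) : exists q : {perm D}, u.1 != 0%R -> aff2 q u.1 1%R u.2 0%R.
  case: (eqVneq u.1 0%R) => [_|u0]; first by exists 1.
  by have [q Hq] := aff2_ex u.2 0%R u0 (oner_neq0 K); exists q.
have [F FE] := fin_all_exists ex.
have -> : K1 = F @: setX [set~ 0%R] setT :> {set _}.
  apply/setP=> q; apply/idP/imsetP => [/K1P[r [a [r0 Hq]]]|[u Hu ->]].
    exists (r, a); first by rewrite !inE r0.
    by apply: aff2_uniq Hq (FE (r, a) r0).
  have u0 : u.1 != 0%R by move: Hu; rewrite !inE andbT.
  by apply/K1P; exists u.1, u.2; split=> //; apply: FE.
rewrite card_in_imset ?cardsX ?c0 ?cardsT ?cK //.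
move=> [r a] [r' a']; rewrite !inE !andbT => r0 r0' /= E.
have := FE (r', a') r0'; rewrite -E => /aff2_inj /(_ (FE (r, a) r0)) /= [-> _ -> _] //.
Qed.

Lemma F20_K1 : is_F20 K1.
Proof.
apply: (@is_F20_perm _ _ [set u : D | ~~ u.2] (0%R, false)).
- exact: card_K1.
- rewrite -cK -cardsT -(card_imset _ (f := fun x : K => (x, false))) => [|x y []//].
  apply: eq_card => -[x e]; rewrite inE /=; apply/idP/imsetP => [|[y _ [_ ->]] //].
  by case: e => // _; exists x.
- by rewrite inE.
- apply/setP=> -[x e]; rewrite inE; apply/orbitP/idP => [[q /K1P[r [a [_ [H0 _]]]]]|].
    by rewrite /= /aperm H0 => -[_ <-].
  case: e => // _; have [q Hq] := aff2_ex x 0%R (oner_neq0 K) (oner_neq0 K).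
  exists q; last by rewrite /= /aperm (proj1 Hq) mulr0 add0r.
  by apply/K1P; exists 1%R, x; split; first exact: oner_neq0.
move=> q [x e] [y e'] /K1P[r [a [r0 Hq]]]; rewrite !inE /= => e0 e0'.
move/negbTE: e0 e0' => -> /negbTE -> nxy; have [H0 _] := Hq.
rewrite !H0 => -[ex] [ey].
have [r1 a0] : r = 1%R /\ a = 0%R.
  by apply: (affine_fix2 _ ex ey); apply: contra nxy => /eqP->.
by apply: aff2_uniq aff2_1; move: Hq; rewrite r1 a0.
Qed.

Lemma affine_wreath : is_F20xF20_Z2 J.
Proof.
have o1 := oner_neq0 K.
have K12 : K1 \x K2 = (K1 <*> K2)%G.
  apply: dprodEY.
    apply/centsP=> q /K2P[t [b [t0 Hq]]] q' /K1P[r [a [r0 Hq']]].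
    apply: aff2_uniq (aff2M Hq Hq') _; have := aff2M Hq' Hq.
    by rewrite !mul1r !mulr1 !mulr0 !add0r !addr0.
  apply/trivgP/subsetP=> q /setIP[/K1P[r [a [r0 Hq]]] /K2P[t [b [t0 Hq']]]].
  have [er et ea eb] := aff2_inj Hq Hq'; apply/set1P.
  by apply: (aff2_uniq (r := 1%R) (t := 1%R) (a := 0%R) (b := 0%R)) aff2_1; move: Hq;
    rewrite er ea.
have [_ mulK12 _ _] := dprodP K12.
have KP q : q \in (K1 <*> K2)%G <-> exists r t a b, [/\ r != 0, t != 0 & aff2 q r t a b]%R.
  rewrite -mulK12; split=> [/mulsgP[q1 q2 /K1P[r [a [r0 H1]]] /K2P[t [b [t0 H2]]] ->]|].
    exists r, t, a, b; split=> //; have := aff2M H1 H2.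
    by rewrite !mul1r !mulr1 !mulr0 !add0r !addr0.
  case=> r [t [a [b [r0 t0 Hq]]]].
  have [q1 H1] := aff2_ex a 0%R r0 o1; have [q2 H2] := aff2_ex 0%R b o1 t0.
  apply/mulsgP; exists q1 q2; first by apply/K1P; exists r, a.
    by apply/K2P; exists t, b.
  apply: aff2_uniq Hq _; have := aff2M H1 H2.
  by rewrite !mul1r !mulr1 !mulr0 !add0r !addr0.
have f1 : flip != 1 by rewrite eq_sym; apply: flip_neq aff2_1.
have of2 : #[flip] = 2 by apply: nt_prime_order; rewrite // expgS expg1 flipK.
have QP q : q \in <[flip]>%G -> q = 1 \/ q = flip.
  by rewrite /= cycle2g // => /set2P.
exists K1, K2, (K1 <*> K2)%G, <[flip]>%G; split=> //.
- exact: F20_K1.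
- by apply: is_F20_isog F20_K1 _; apply: conj_isog.
- rewrite sdprodE.
  + apply/setP=> q; apply/mulsgP/idP => [[k f /KP[r [t [a [b [r0 t0 Hk]]]]] /QP Ff ->]|].
      apply: groupM; first exact: J_aff2 Hk.
      by case: Ff => ->; rewrite ?group1 ?flip_J.
    case/JP=> r [t [a [b [r0 t0 [Hq|Hq]]]]].
      by exists q 1; rewrite ?mulg1 //; apply/KP; exists r, t, a, b.
    exists (q * flip) flip; rewrite ?cycle_id //; first by apply/KP; exists r, t, a, b.
    by rewrite -mulgA flipK mulg1.
  + rewrite cycle_subG; apply/normP/eqP; rewrite eqEcard cardJg leqnn andbT.
    apply/subsetP=> _ /imsetP[q /KP[r [t [a [b [r0 t0 /aff2_flip Hq]]]]] ->].
    by apply/KP; exists t, r, b, a.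
  apply/trivgP/subsetP=> q /setIP[/KP[r [t [a [b [_ _ Hq]]]]] /QP[] qE].
    by rewrite qE group1.
  by have := flip_neq Hq; rewrite qE eqxx.
split; last by exists flip; rewrite ?cycle_id.
by apply: cyclic_isog_Zp (cycle_cyclic _) _.
Qed.

End AffineWreath.

(** * Coordinates of an affine plane without one parallel class *)

Section Biaffine.

Variables (p : nat) (s : 'I_5 -> 'rV['F_p]_2) (wt : 'I_5 -> 'F_p).

Local Notation K := 'F_p.
Local Notation G2 := (GD p 2).

Hypothesis F2 : (2%:R != 0 :> K)%R.
Hypothesis s_span : spanning s.
Hypothesis s_inj : injective s.
Hypothesis wt_inj : injective wt.
Hypothesis wt_surj : forall k, exists i, wt i = k.
(** The coordinates of a point have difference w and sum w^2, so the points fill a parabola; with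
    [wt i = i] in ['F_5] this is [pts2_1] at l = 1. *)
Hypothesis sE : forall i,
  (s i 0 0 = (wt i ^+ 2 + wt i) / 2%:R /\ s i 0 1 = (wt i ^+ 2 - wt i) / 2%:R)%R.

(* In the coordinates x, Y of both vertex classes, edges join (x, Y) to (x', Y')
   when Y + Y' = x x': points and lines of the affine plane over 'F_p,
   with one parallel class removed. *)
Definition cX (g : G2) : K := (g.1 0 0 - g.1 0 1)%R.
Definition cY (g : G2) : K := ((g.1 0 0 + g.1 0 1 - cX g ^+ 2) / 2%:R)%R.
Definition mk (x y : K) (e : bool) : G2 :=
  (\row_j (if j == 0 then (2%:R * y + x ^+ 2 + x) / 2%:R else (2%:R * y + x ^+ 2 - x) / 2%:R),
    e)%R.

Lemma cX_mk x y e : cX (mk x y e) = x.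
Proof. by rewrite /cX !mxE /=; field. Qed.

Lemma cY_mk x y e : cY (mk x y e) = y.
Proof. by rewrite /cY cX_mk !mxE /=; field. Qed.

Lemma mkK g : mk (cX g) (cY g) g.2 = g.
Proof.
case: g => u e; congr pair; apply/rowP=> j; rewrite mxE /cY /cX /=.
case: j => [[|[|//]] Hj] /=.
  by rewrite (_ : Ordinal Hj = 0%R); [field|apply/val_inj].
by rewrite (_ : Ordinal Hj = 1%R); [field|apply/val_inj].
Qed.

Lemma mk_ind (P : G2 -> Prop) : (forall x y e, P (mk x y e)) -> forall g, P g.
Proof. by move=> H g; rewrite -(mkK g). Qed.

Lemma mk_inj x y e x' y' e' : mk x y e = mk x' y' e' -> [/\ x = x', y = y' & e = e'].
Proof.
move=> E; split; last exact: (congr1 snd E).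
  by rewrite -(cX_mk x y e) E cX_mk.
by rewrite -(cY_mk x y e) E cY_mk.
Qed.

Lemma pt_mk i x y e : pt s i * mk x y e = mk (wt i - x)%R (x * (wt i - x) - y)%R (~~ e).
Proof.
rewrite /mk pt_mul; congr pair; apply/rowP=> j; have [E0 E1] := sE i.
rewrite rowDE rowNE [X in (_ - X)%R]mxE [RHS]mxE.
case: j => [[|[|//]] Hj] /=.
  by rewrite (_ : Ordinal Hj = 0%R); [rewrite E0; field|apply/val_inj].
by rewrite (_ : Ordinal Hj = 1%R); [rewrite E1; field|apply/val_inj].
Qed.

Lemma mk2 x y e : (mk x y e).2 = e. Proof. by []. Qed.

Lemma mk_mul x y e a b : mk x y e * mk a b false =
  (if e then mk (x - a) (y + a * x - a ^+ 2 - b) true else mk (x + a) (y - a * x + b) false)%R.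
Proof.
rewrite /mk /mulg /= /GDmul /= addbF; case: e; congr pair; apply/rowP=> j; rewrite !mxE /=.
  by case: j => [[|[|//]] Hj] /=; rewrite expr1; field.
by case: j => [[|[|//]] Hj] /=; rewrite expr0; field.
Qed.

Definition swp : {perm G2} := actperm 'R (mk 0%R 0%R true).

Lemma swpE x y e : swp (mk x y e) = mk x y (~~ e).
Proof.
rewrite actpermE /= /mk /mulg /= /GDmul /= addbT; congr pair; apply/rowP=> j; rewrite !mxE /=.
by case: j => [[|[|//]] Hj] /=; field.
Qed.

Lemma mk0 : mk 0%R 0%R false = 1.
Proof. by congr pair; apply/rowP=> j; rewrite !mxE /=; case: (_ == _); field. Qed.

#[local] Opaque mk swp.

Local Notation adj := (cay [set pt s i | i : 'I_5]).

Lemma adj_mk x y e x' y' e' :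
  adj (mk x y e) (mk x' y' e') = (e' == ~~ e) && (y + y' == x * x')%R.
Proof.
apply/cay_imP/andP => [[i]|[/eqP-> /eqP e0]].
  rewrite pt_mk => /mk_inj[-> -> ->]; rewrite eqxx; split=> //.
  by apply/eqP; ring.
have [i iE] := wt_surj (x + x')%R; exists i; rewrite pt_mk iE; congr mk; first by ring.
by apply/eqP; rewrite -subr_eq0; apply/eqP; rewrite -[RHS](subrr (x * x')%R) -{1}e0; ring.
Qed.

Local Notation A := (sAut_group adj).

Lemma lab_wt f v i : f \in A -> (wt (lab (pt s) f v i) = cX (f (pt s i * v)%g) + cX (f v))%R.
Proof.
move=> Af; rewrite (labE _ _ Af); move: (f v); apply: mk_ind => x y e.
by rewrite pt_mk !cX_mk subrK.
Qed.

(** The scalings r and t of x on the two vertex classes are independent; preserving Y + Y' = x x'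
    then dictates the action on Y up to the shift c, which enters with opposite signs. *)
Definition genf (r t a b c : K) (g : G2) : G2 :=
  let x := cX g in let y := cY g in
  if g.2 then mk (t * x + b)%R (r * t * y + t * a * x + a * b - c)%R true
  else mk (r * x + a)%R (r * t * y + r * b * x + c)%R false.

(** The default value 1 covers zero scalings, where [genf] is no permutation. *)
Definition gp r t a b c : {perm G2} :=
  odflt 1 [pick f : {perm G2} | [forall g, f g == genf r t a b c g]].

Lemma genf_inj r t a b c : r != 0%R -> t != 0%R -> injective (genf r t a b c).
Proof.
move=> r0 t0 g h e; rewrite -(mkK g) -(mkK h); move: e; rewrite /genf.
case: (g.2); case: (h.2) => /mk_inj[] //.
  move=> /addIr/(mulfI t0)-> /addIr; rewrite !(addrAC _ _ (a * b)%R) => /addIr/addIr e _.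
  by rewrite (mulfI (mulf_neq0 r0 t0) e).
by move=> /addIr/(mulfI r0)-> /addIr/addIr/(mulfI (mulf_neq0 r0 t0))->.
Qed.

Lemma gpE r t a b c g : r != 0%R -> t != 0%R -> gp r t a b c g = genf r t a b c g.
Proof.
move=> r0 t0; rewrite /gp; case: pickP => [f /forallP/(_ g)/eqP //|].
by move/(_ (perm (@genf_inj r t a b c r0 t0)))/negP; case; apply/forallP=> h; rewrite permE.
Qed.

#[local] Opaque gp.

Definition acts (f : {perm G2}) r t a b c :=
  (forall x y, f (mk x y false) = mk (r * x + a)%R (r * t * y + r * b * x + c)%R false) /\
  (forall x y, f (mk x y true) = mk (t * x + b)%R (r * t * y + t * a * x + a * b - c)%R true).

Lemma gpP r t a b c : r != 0%R -> t != 0%R -> acts (gp r t a b c) r t a b c.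
Proof. by move=> r0 t0; split=> x y; rewrite gpE // /genf cX_mk cY_mk. Qed.

#[local] Opaque gp.

Lemma acts_uniq f f' r t a b c : acts f r t a b c -> acts f' r t a b c -> f = f'.
Proof. by move=> [H0 H1] [H0' H1']; apply/permP; apply: mk_ind => x y [];
  rewrite ?H0 ?H0' ?H1 ?H1'. Qed.

Lemma actsM f r t a b c f' r' t' a' b' c' : acts f r t a b c -> acts f' r' t' a' b' c' ->
  acts (f * f') (r * r')%R (t * t')%R (r' * a + a')%R (t' * b + b')%R
    (r' * t' * c + r' * b' * a + c')%R.
Proof.
move=> [H0 H1] [H0' H1']; split=> x y; rewrite permM ?H0 ?H0' ?H1 ?H1'; congr mk; ring.
Qed.

Lemma gpM r t a b c r' t' a' b' c' :
  r != 0%R -> t != 0%R -> r' != 0%R -> t' != 0%R ->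
  gp r t a b c * gp r' t' a' b' c' =
  gp (r * r')%R (t * t')%R (r' * a + a')%R (t' * b + b')%R (r' * t' * c + r' * b' * a + c')%R.
Proof.
move=> r0 t0 r0' t0'.
exact: acts_uniq (actsM (gpP a b c r0 t0) (gpP a' b' c' r0' t0'))
  (gpP _ _ _ (mulf_neq0 r0 r0') (mulf_neq0 t0 t0')).
Qed.

Lemma acts_inj f r t a b c r' t' a' b' c' : acts f r t a b c -> acts f r' t' a' b' c' ->
  [/\ r = r', t = t', a = a', b = b' & c = c'].
Proof.
move=> [H0 H1] [H0' H1'].
have E0 x : (r * x + a = r' * x + a')%R /\ (r * t * 0 + r * b * x + c = r' * t' * 0 + r' * b' *
  x + c')%R.
  by have := H0 x 0%R; rewrite H0' => /mk_inj[].
have E1 x : (t * x + b = t' * x + b')%R by have := H1 x 0%R; rewrite H1' => /mk_inj[].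
have [] := E0 0%R; rewrite !mulr0 !add0r => ea ec.
have := E1 0%R; rewrite !mulr0 !add0r => eb.
have [] := E0 1%R; rewrite !mulr1 ea => /addIr er _.
have := E1 1%R; rewrite !mulr1 eb => /addIr et.
by split.
Qed.

Lemma gp_inj r t a b c r' t' a' b' c' :
  r != 0%R -> t != 0%R -> r' != 0%R -> t' != 0%R ->
  gp r t a b c = gp r' t' a' b' c' -> [/\ r = r', t = t', a = a', b = b' & c = c'].
Proof.
move=> r0 t0 r0' t0' E; apply: (acts_inj (gpP a b c r0 t0)).
by rewrite E; apply: gpP.
Qed.

Lemma acts1 : acts 1 1%R 1%R 0%R 0%R 0%R.
Proof. by split=> x y; rewrite perm1; congr mk; ring. Qed.

Lemma gp1 : gp 1%R 1%R 0%R 0%R 0%R = 1.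
Proof. exact: acts_uniq (gpP _ _ _ (oner_neq0 K) (oner_neq0 K)) acts1. Qed.

Lemma gp_aut r t a b c : r != 0%R -> t != 0%R -> gp r t a b c \in A.
Proof.
move=> r0 t0; have rt := mulf_neq0 r0 t0.
have E x y x' y' : (r * t * y + r * b * x + c + (r * t * y' + t * a * x' + a * b - c) ==
    (r * x + a) * (t * x' + b))%R = (y + y' == x * x')%R.
  rewrite -subr_eq0 -[RHS]subr_eq0 -[RHS](mulrI_eq0 _ (mulfI rt)); congr (_ == _); ring.
have [H0 H1] := gpP a b c r0 t0; move: (gp r t a b c) H0 H1 => f H0 H1.
rewrite inE; apply/forallP; apply: mk_ind => x y e; apply/forallP; apply: mk_ind => x' y' e'.
case: e; case: e'; rewrite ?H0 ?H1 !adj_mk.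
- by [].
- by rewrite (addrC (_ - c)%R) (mulrC (t * x + b)%R) E (addrC y') (mulrC x').
- by rewrite E.
- by [].
Qed.

Lemma pt_side i v : (pt s i * v).2 = ~~ v.2.
Proof. by case: v => u e; rewrite pt_mul. Qed.

Lemma side_aut f g : f \in A -> (f g).2 = g.2 (+) (f 1).2.
Proof.
move=> Af; move: g; apply: (gen_ind (pt_gen s_span)) => // i g IH.
by rewrite (labE _ _ Af) !pt_side IH addNb.
Qed.

(** This expresses equality of x coordinates on one side through adjacency alone: distinct vertices
    with the same x have no common neighbour, others do. Automorphisms therefore preserve it. *)
Lemma same_fibre g h : g.2 = h.2 ->
  (cX g == cX h) = (g == h) || ~~ [exists k, adj g k && adj h k].
Proof.
move: g h; apply: mk_ind => x y e; apply: mk_ind => x' y' e'; rewrite !mk2 => ->; rewrite !cX_mk.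
have [->|nx] /= := eqVneq x x'.
  have [->|ny] := eqVneq y y'; first by rewrite eqxx.
  apply/esym/orP; right; apply/negP=> /existsP[k /andP[]].
  move: k; apply: mk_ind => x0 y0 e0; rewrite !adj_mk => /andP[_ /eqP<-] /andP[_ /eqP/addIr e1].
  by rewrite e1 eqxx in ny.
apply/esym/negbTE; rewrite negb_or negbK; apply/andP; split.
  by apply: contra nx => /eqP/mk_inj[->].
pose x0 := ((y - y') / (x - x'))%R.
apply/existsP; exists (mk x0 (x * x0 - y)%R (~~ e')); rewrite !adj_mk eqxx /=.
rewrite addrC subrK eqxx /=; apply/eqP.
have : ((x - x') * x0 = y - y')%R by rewrite mulrC divfK // subr_eq0.
by rewrite mulrBl => /eqP; rewrite subr_eq => /eqP ->; ring.
Qed.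

Lemma fibre_aut f g h : f \in A -> g.2 = h.2 -> (cX (f g) == cX (f h)) = (cX g == cX h).
Proof.
move=> Af gh; have fgh : (f g).2 = (f h).2 by rewrite (side_aut g Af) (side_aut h Af) gh.
rewrite (same_fibre gh) (same_fibre fgh) (inj_eq (@perm_inj _ f)); congr (_ || ~~ _).
apply/existsP/existsP => [[k]|[k]]; last by exists (f k); rewrite !(autE Af).
by rewrite -[k](permKV f) !(autE Af); exists (f^-1 k).
Qed.

Lemma additive_Fp (D : K -> K) : (forall x z, D (x + z) = D x + D z)%R ->
  forall x, D x = (x * D 1)%R.
Proof.
move=> DD x; have D0 : D 0%R = 0%R by apply: (addrI (D 0%R)); rewrite -DD !addr0.
rewrite -[x in LHS]natr_Zp -[x in RHS]natr_Zp mulr_natl.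
by elim: (x : nat) => [|k IH]; rewrite ?mulr0n // !mulrS DD IH.
Qed.

(** Preserving the incidence equation gives F x y + H x' (x x' - y) = al x * be x'. Hence (al x - al
    0) (be x' - be 0) is an increment of [F 0] that depends only on the product x x'. Such
    increments are additive, so linear over a prime field, which makes [al], [be] and [F 0]
    affine. *)
Lemma aut_normal_form f : f \in A -> (f 1).2 = false ->
  exists r t a b c, [/\ r != 0%R, t != 0%R & f = gp r t a b c].
Proof.
move=> Af f1; have f_side g : (f g).2 = g.2 by rewrite (side_aut _ Af) f1 addbF.
pose al x := cX (f (mk x 0%R false)); pose be x := cX (f (mk x 0%R true)).
pose F x y := cY (f (mk x y false)); pose H x y := cY (f (mk x y true)).
have f0E x y : f (mk x y false) = mk (al x) (F x y) false.
  rewrite -(mkK (f (mk x y false))) f_side mk2 (_ : cX _ = al x) //.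
  by apply/eqP; rewrite (fibre_aut Af) ?mk2 // !cX_mk.
have f1E x y : f (mk x y true) = mk (be x) (H x y) true.
  rewrite -(mkK (f (mk x y true))) f_side mk2 (_ : cX _ = be x) //.
  by apply/eqP; rewrite (fibre_aut Af) ?mk2 // !cX_mk.
have E x x' y : (F x y + H x' (x * x' - y) = al x * be x')%R.
  have : adj (f (mk x y false)) (f (mk x' (x * x' - y)%R true)).
    by rewrite (autE Af) adj_mk addrC subrK !eqxx.
  by rewrite f0E f1E adj_mk => /andP[_ /eqP].
have FE x y : (F x y = F 0 y + be 0 * (al x - al 0))%R.
  have e1 := E x 0%R y; have e2 := E 0%R 0%R y; rewrite !mulr0 in e1 e2.
  apply: (addIr (H 0 (0 - y)))%R; rewrite e1 addrAC e2; ring.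
have HE x y : (H x y = al 0 * be x - F 0 (- y))%R.
  by have := E 0%R x (- y)%R; rewrite mul0r opprK add0r => <-; rewrite addrC addKr.
have FD x x' y : (F 0 y - F 0 (y - x * x') = (al x - al 0) * (be x' - be 0))%R.
  have e0 : (- (x * x' - y) = y - x * x')%R by ring.
  have := E x x' y; rewrite FE HE e0 => e.
  transitivity (F 0 y + be 0 * (al x - al 0) + (al 0 * be x' - F 0 (y - x * x')) - (be 0 * (al
    x - al 0) + al 0 * be x'))%R; first by ring.
  by rewrite e; ring.
pose r := (al 1 - al 0)%R; pose t := (be 1 - be 0)%R.
have r0 : r != 0%R.
  by rewrite subr_eq0 (fibre_aut (g := mk 1%R 0%R false)) ?mk2 // !cX_mk oner_neq0.
have t0 : t != 0%R.
  by rewrite subr_eq0 (fibre_aut (g := mk 1%R 0%R true)) ?mk2 // !cX_mk oner_neq0.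
pose D x := ((al x - al 0) * t)%R.
have DE x y : (F 0 y - F 0 (y - x) = D x)%R by rewrite -[x in LHS]mulr1 FD.
have DD x z : (D (x + z) = D x + D z)%R.
  by rewrite -(DE _ 0%R) -(DE x 0%R) -(DE z (0 - x)%R) opprD addrA; ring.
have Dlin x : D x = (x * (r * t))%R by rewrite (additive_Fp DD x).
have alE x : (al x = r * x + al 0)%R.
  by apply/eqP; rewrite -subr_eq; apply/eqP/(mulIf t0); rewrite -/(D x) Dlin mulrA (mulrC r).
have beE x : (be x = t * x + be 0)%R.
  apply/eqP; rewrite -subr_eq; apply/eqP/(mulfI r0); rewrite -(FD 1%R x 0%R) mul1r DE Dlin; ring.
have FE0 y : (F 0 y = F 0 0 + r * t * y)%R.
  by have := DE y y; rewrite subrr Dlin => /eqP; rewrite subr_eq => /eqP->; ring.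
exists r, t, (al 0)%R, (be 0)%R, (F 0 0)%R; split=> //.
apply: acts_uniq (gpP _ _ _ r0 t0); split=> x y.
  rewrite f0E FE FE0 alE; congr mk; ring.
rewrite f1E HE FE0 beE; congr mk; ring.
Qed.

Lemma swp_RR : swp \in RR G2. Proof. by rewrite mem_morphim ?inE. Qed.

Lemma swp_aut : swp \in A. Proof. exact: (subsetP (RR_sub _)) swp_RR. Qed.

Lemma swpK : swp * swp = 1.
Proof. by apply/permP; apply: mk_ind => x y e; rewrite permM !swpE negbK perm1. Qed.

Lemma aut_cases f : f \in A ->
  exists r t a b c, [/\ r != 0%R, t != 0%R & f = gp r t a b c \/ f = gp r t a b c * swp].
Proof.
move=> Af; case f1: (f 1).2; last first.
  have [r [t [a [b [c [r0 t0 fE]]]]]] := aut_normal_form Af f1.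
  by exists r, t, a, b, c; split=> //; left.
have Afs : f * swp \in A by rewrite groupM // swp_aut.
have fs1 : ((f * swp) 1).2 = false.
  by rewrite permM -(mkK (f 1)) swpE mk2 f1.
have [r [t [a [b [c [r0 t0 fE]]]]]] := aut_normal_form Afs fs1.
by exists r, t, a, b, c; split=> //; right; rewrite -fE -mulgA swpK mulg1.
Qed.

Lemma gp_base t b : t != 0%R -> gp t t 0%R b 0%R \in baseN (pt s).
Proof.
move=> t0; have Af := gp_aut 0%R b 0%R t0 t0; have [H0 H1] := gpP 0%R b 0%R t0 t0.
apply/baseNP; split=> //; last by rewrite -mk0 H0; congr mk; ring.
apply: (rigid_norm (pt_gen s_span)); apply: (rigid_step (pt_inj s_inj) (pt_gen s_span) Af).
suff lE v i : wt (lab (pt s) (gp t t 0%R b 0%R) v i) = (t * wt i + b)%R.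
  by move=> v i j; apply: wt_inj; rewrite !lE.
rewrite lab_wt //; move: (gp _ _ _ _ _) H0 H1 => f H0 H1; move: v; apply: mk_ind => x y [];
  rewrite pt_mk ?H0 ?H1 !cX_mk; ring.
Qed.

Lemma gp_base_inv r t a b c : r != 0%R -> t != 0%R ->
  gp r t a b c \in baseN (pt s) -> [/\ r = t, a = 0%R & c = 0%R].
Proof.
move=> r0 t0 Bf; have [H0 H1] := gpP a b c r0 t0.
move: (gp _ _ _ _ _) Bf H0 H1 => f Bf H0 H1.
have [Af Nf f1] := baseNP _ _ Bf.
have [a0 c0 _] : [/\ a = 0%R, c = 0%R & true = true].
  move: f1; rewrite -mk0 H0 => /mk_inj[]; rewrite !mulr0 !add0r => -> -> _; by split.
split=> //.
have fM x y := baseN_morph x y Bf.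
have := fM (mk 0%R 0%R true) (mk 1%R 0%R false).
rewrite mk_mul H1 H0 H1 mk_mul => /mk_inj[];
  rewrite a0 !mulr1 !mulr0 !addr0 !add0r mulrN1 addrC => /addrI/oppr_inj->.
by [].
Qed.

Section Cyclic.

Variables (z : K).
Hypothesis z_prim : (4.-primitive_root z)%R.
Hypothesis z_gen : forall u, u != 0%R -> exists k, u = (z ^+ k)%R.

Let z0 : z != 0%R.
Proof.
apply/eqP=> z0; have := prim_expr_order z_prim; rewrite z0 exprS mul0r => /esym/eqP.
by rewrite oner_eq0.
Qed.

Lemma gp_scal_exp k : gp z 1%R 0%R 0%R 0%R ^+ k = gp (z ^+ k)%R 1%R 0%R 0%R 0%R.
Proof.
elim: k => [|k IH]; first by rewrite expg0 expr0 gp1.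
have n1 := oner_neq0 K.
by rewrite expgS IH (gpM _ _ _ _ _ _ z0 n1 (expf_neq0 k z0) n1) -exprS !mulr0 !mulr1 !addr0.
Qed.

(** A translation brings 1 back to 1, which forces a = c = 0. What remains is an element with equal
    scalings, in the normalizer of the translations, times a scaling of one side by the ratio of the
    two, a power of z. *)
Lemma aut_RFC : (RR G2 * baseN (pt s)) * <[gp z 1%R 0%R 0%R 0%R]> = A.
Proof.
have n1 := oner_neq0 K.
apply/eqP; rewrite eqEsubset; apply/andP; split.
  apply: mul_subG; last by rewrite cycle_subG gp_aut.
  by apply: mul_subG; [exact: RR_sub|apply/subsetP=> f /baseNP[]].
apply/subsetP=> f Af; set r := actperm 'R (f^-1 1)^-1.
have Rr : r \in RR G2 by rewrite mem_morphim ?inE.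
have Apsi : r^-1 * f \in A by rewrite groupM // groupV (subsetP (RR_sub _)).
have psi1 : (r^-1 * f) 1 = 1.
  rewrite permM -[RHS](permKV f); congr (f _).
  by apply: (@perm_inj _ r); rewrite permKV actpermE /= mulgV.
have psi2 : ((r^-1 * f) 1).2 = false by rewrite psi1.
have [u [t [a [b [c [u0 t0 E]]]]]] := aut_normal_form Apsi psi2.
have [a0 c0] : a = 0%R /\ c = 0%R.
  have [H0 _] := gpP a b c u0 t0; move: psi1; rewrite E -mk0 H0 => /mk_inj[].
  by rewrite !mulr0 !add0r => -> -> _.
have [k ek] := z_gen (mulf_neq0 u0 (invr_neq0 t0)).
have zk0 : (z ^+ k != 0)%R by rewrite expf_neq0.
have psiE : r^-1 * f = gp t t 0%R b 0%R * gp (z ^+ k)%R 1%R 0%R 0%R 0%R.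
  rewrite (gpM _ _ _ _ _ _ t0 t0 zk0 n1) E a0 c0 -ek !mulr0 !mulr1 !mul1r !addr0.
  by rewrite (mulrC t) divfK.
rewrite -[f](mulKVg r) psiE mulgA -gp_scal_exp.
by apply: mem_mulg (mem_cycle _ _); apply: mem_mulg (Rr) (gp_base _ t0).
Qed.

Lemma scal_order : #[gp z 1%R 0%R 0%R 0%R] = 4.
Proof.
have n1 := oner_neq0 K.
have gpX k : (gp z 1%R 0%R 0%R 0%R ^+ k == 1) = (4 %| k).
  rewrite (prim_order_dvd z_prim) gp_scal_exp -gp1; apply/eqP/eqP => [|->//].
  by case/(gp_inj (expf_neq0 k z0) n1 n1 n1).
apply/eqP; rewrite eqn_dvd; apply/andP; split; first by rewrite order_dvdn gpX.
by rewrite -gpX expg_order.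
Qed.

End Cyclic.

Definition fib (g : G2) : K * bool := (cX g, g.2).

(** The action on the classes of vertices with given x and side. It forgets Y, so its kernel
    consists of the shifts by c. *)
Definition rho (f : {perm G2}) : {perm K * bool} :=
  odflt 1 [pick q : {perm K * bool} | [forall g, q (fib g) == fib (f g)]].

Lemma fib_mk x y e : fib (mk x y e) = (x, e).
Proof. by rewrite /fib cX_mk mk2. Qed.

Lemma rhoE f g : f \in A -> rho f (fib g) = fib (f g).
Proof.
move=> Af; rewrite /rho; case: pickP => [q /forallP/(_ g)/eqP //|noq].
pose F (u : K * bool) := fib (f (mk u.1 0%R u.2)).
have fibf h k : (fib (f h) == fib (f k)) = (fib h == fib k).
  rewrite /fib !xpair_eqE (side_aut h Af) (side_aut k Af).
  rewrite (inj_eq (can_inj (fun b => addbK ((f 1).2) b))).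
  case: (eqVneq h.2 k.2) => [hk|_]; last by rewrite !andbF.
  by rewrite (fibre_aut Af hk).
have F_inj : injective F.
  by move=> [x e] [x' e'] /eqP; rewrite fibf !fib_mk => /eqP.
have := noq (perm F_inj); case/forallP; apply: mk_ind => x y e.
by rewrite permE fib_mk fibf !fib_mk.
Qed.

Lemma rhoM : {in A &, {morph rho : f k / f * k}}.
Proof.
move=> f k Af Ak; apply/permP=> -[x e]; rewrite -(fib_mk x 0%R e).
by rewrite permM !rhoE ?groupM // permM.
Qed.
Canonical rho_morphism := Morphism rhoM.

Lemma rho_gp r t a b c : r != 0%R -> t != 0%R -> aff2 (rho (gp r t a b c)) r t a b.
Proof.
move=> r0 t0; have Af := gp_aut a b c r0 t0; have [H0 H1] := gpP a b c r0 t0.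
by split=> x; rewrite -(fib_mk x 0%R _) rhoE // ?H0 ?H1 fib_mk.
Qed.

Lemma rho_swp : rho swp = flip _.
Proof.
by apply/permP=> -[x e]; rewrite flipE -(fib_mk x 0%R e) rhoE ?swp_aut // swpE fib_mk.
Qed.

Lemma rho_imP q : q \in (rho @* A)%g <->
  exists r t a b, [/\ r != 0%R, t != 0%R & aff2 q r t a b \/ aff2 (q * flip _) r t a b].
Proof.
split=> [/morphimP[f Af _ ->]|[r [t [a [b [r0 t0 [Hq|Hq]]]]]]].
- have [r [t [a [b [c [r0 t0 fE]]]]]] := aut_cases Af.
  exists r, t, a, b; split=> //; case: fE => ->; [left|right]; first exact: rho_gp.
  rewrite /= rhoM ?gp_aut ?swp_aut // rho_swp -mulgA flipK mulg1; exact: rho_gp.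
- rewrite (aff2_uniq Hq (rho_gp a b 0%R r0 t0)).
  by apply: mem_morphim; apply: gp_aut.
rewrite -(mulg1 q) -flipK mulgA (aff2_uniq Hq (rho_gp a b 0%R r0 t0)) -rho_swp.
by rewrite -rhoM ?gp_aut ?swp_aut //; apply: mem_morphim; rewrite groupM ?gp_aut ?swp_aut.
Qed.

Lemma rho_kerP f : f \in 'ker rho <-> exists c, f = gp 1%R 1%R 0%R 0%R c.
Proof.
have o1 := oner_neq0 K.
split=> [|[c ->]]; last first.
  apply/kerP; first exact: gp_aut.
  exact: aff2_uniq (rho_gp _ _ _ o1 o1) (aff2_1 _).
move=> Kf; have Af := dom_ker Kf; have f1 := mker Kf.
have [r [t [a [b [c [r0 t0 [fE|fE]]]]]]] := aut_cases Af.
  exists c; move: f1; rewrite fE => f1; have := rho_gp a b c r0 t0; rewrite f1.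
  by move=> /aff2_inj /(_ (aff2_1 _)) [-> -> -> ->].
have E : rho (gp r t a b c) = flip _.
  have : rho (gp r t a b c) * flip _ = 1 by rewrite -rho_swp -rhoM ?gp_aut ?swp_aut // -fE.
  by move=> e; apply: (mulIg (flip _)); rewrite e flipK.
by have := flip_neq (rho_gp a b c r0 t0); rewrite E eqxx.
Qed.

Hypothesis cK : #|K| = 5.

Lemma rho_ker_Z5 : 'ker rho \isog [set: 'Z_5].
Proof.
have o1 := oner_neq0 K.
have cN : #|'ker rho| = 5.
  have -> : 'ker rho = [set gp 1%R 1%R 0%R 0%R c | c : K].
    by apply/setP=> f; apply/idP/imsetP => [/rho_kerP[c ->]|[c _ ->]];
      [exists c|apply/rho_kerP; exists c].
  by rewrite card_imset ?cK // => c c' /(gp_inj o1 o1 o1 o1)[].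
by apply: cyclic_isog_Zp => //; apply: prime_cyclic; rewrite /= cN.
Qed.

Lemma rho_quotient : is_F20xF20_Z2 (A / 'ker rho).
Proof.
apply: (@is_F20xF20_Z2_isog _ _ (rho @* A)%G (A / 'ker rho)%G).
  exact: affine_wreath rho_imP cK.
by rewrite isog_sym; apply: first_isog.
Qed.

(** The law of the Heisenberg group, with the kernel of [rho] as centre; the term b' a is the source
    of nontrivial commutators. *)
Lemma heisM (a b c a' b' c' : K) :
  gp 1%R 1%R a b c * gp 1%R 1%R a' b' c' =
  gp 1%R 1%R (a + a')%R (b + b')%R (c + b' * a + c')%R.
Proof.
have o1 := oner_neq0 K; have [H0 H1] := gpP a b c o1 o1; have [H0' H1'] := gpP a' b' c' o1 o1.
move: (gp 1%R 1%R a b c) (gp 1%R 1%R a' b' c') H0 H1 H0' H1' => f f' H0 H1 H0' H1'.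
by apply: acts_uniq (gpP _ _ _ o1 o1); split=> x y; rewrite permM ?H0 ?H0' ?H1 ?H1'; congr mk;
  ring.
Qed.

(* In a complement of the kernel, the images of two translations would commute. *)
Lemma rho_nonsplit : ~~ [splits A, over 'ker rho].
Proof.
have o1 := oner_neq0 K.
apply/splitsP=> -[L /complP[tiNL mulNL]].
have NC a b x : x \in 'ker rho -> commute x (gp 1%R 1%R a b 0%R).
  by move=> /rho_kerP[c ->]; rewrite /commute !heisM !add0r !addr0 mulr0 mul0r addr0 add0r.
pose E : {perm G2} := gp 1%R 1%R 1%R 0%R 0%R; pose F : {perm G2} := gp 1%R 1%R 0%R 1%R 0%R.
pose n0 : {perm G2} := gp 1%R 1%R 0%R 0%R 1%R.
have EF : E * F = F * E * n0.
  have -> : F * E = gp 1%R 1%R 1%R 1%R 0%R.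
    by rewrite heisM mul0r !addr0 !add0r.
  by rewrite !heisM mulr1 mul0r !addr0 !add0r.
have N0 : n0 \in 'ker rho by apply/rho_kerP; exists 1%R.
have n01 : n0 != 1.
  by apply/eqP; rewrite -gp1 => /(gp_inj o1 o1 o1 o1)[_ _ _ _ /eqP]; rewrite (negbTE o1).
have NE := NC 1%R 0%R; have NF := NC 0%R 1%R; rewrite -/E in NE; rewrite -/F in NF.
have AE : E \in A by apply: gp_aut.
have AF : F \in A by apply: gp_aut.
clearbody E F n0.
have /mulsgP[n1 l1 N1 L1 E1] : E \in 'ker rho * L by rewrite mulNL.
have /mulsgP[n2 l2 N2 L2 E2] : F \in 'ker rho * L by rewrite mulNL.
have l1E : l1 = n1^-1 * E by rewrite E1 mulKg.
have l2E : l2 = n2^-1 * F by rewrite E2 mulKg.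
have NN x y : x \in 'ker rho -> y \in 'ker rho -> commute x y.
  have abN : abelian ('ker rho).
    by apply: cyclic_abelian; rewrite (isog_cyclic rho_ker_Z5); apply/cyclicP; exists 1%R;
      exact: (@Zp_cycle 4).
  by move=> Nx Ny; apply: (centsP abN).
have l2l1 : l1 * l2 = l2 * l1 * n0.
  apply: (mulgI (n1 * n2)).
  have c1 : commute n2 l1 by rewrite l1E; apply: commuteM (NE _ N2); apply: commuteV; apply: NN.
  have c2 : commute n1 l2 by rewrite l2E; apply: commuteM (NF _ N1); apply: commuteV; apply: NN.
  have -> : n1 * n2 * (l1 * l2) = E * F.
    by rewrite E1 E2 -!mulgA (mulgA n2 l1) c1 -!mulgA.
  by rewrite EF (NN n1 n2) // E1 E2 -!mulgA (mulgA n1 l2) c2 -!mulgA.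
have : n0 \in 'ker rho :&: L.
  rewrite inE N0 (_ : n0 = (l2 * l1)^-1 * (l1 * l2)); first by rewrite groupM ?groupV ?groupM.
  by rewrite l2l1 mulKg.
by rewrite tiNL => /set1P n0E; rewrite n0E eqxx in n01.
Qed.

Lemma baseN_gpP f : f \in baseN (pt s) <-> exists t b, t != 0%R /\ f = gp t t 0%R b 0%R.
Proof.
split=> [Bf|[t [b [t0 ->]]]]; last exact: (gp_base b t0).
have [Af _ f1] := baseNP _ _ Bf.
have f12 : (f 1).2 = false by rewrite f1.
have [r [t [a [b [c [r0 t0 fE]]]]]] := aut_normal_form Af f12.
rewrite fE in Bf; have [rt a0 c0] := gp_base_inv r0 t0 Bf.
exists t, b; split; first exact: t0.
by rewrite fE rt a0 c0.
Qed.

Lemma gp_base_mk (t b x : K) : t != 0%R -> gp t t 0%R b 0%R (mk x 0%R true) = mk (t * x + b)%R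
  0%R true.
Proof.
by move=> t0; rewrite (proj2 (gpP 0%R b 0%R t0 t0)) !mulr0 !mul0r !addr0 subr0.
Qed.

Lemma baseN_F20 : is_F20 (baseN (pt s)).
Proof.
have o1 := oner_neq0 K.
have cB : #|baseN (pt s)| = 20.
  have c0 : #|[set~ 0%R : K]| = 4 by rewrite cardsC1 cK.
  have -> : baseN (pt s) =
      [set gp u.1 u.1 0%R u.2 0%R | u in setX [set~ 0%R] setT] :> {set _}.
    apply/setP=> f; apply/idP/imsetP => [/baseN_gpP[t [b [t0 ->]]]|[u Hu ->]].
      by exists (t, b) => //; rewrite !inE t0.
    by apply/baseN_gpP; exists u.1, u.2; split; first by move: Hu; rewrite !inE andbT.
  rewrite card_in_imset ?cardsX ?c0 ?cardsT ?cK //.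
  move=> [t b] [t' b']; rewrite !inE !andbT => t0 t0' /=.
  by move/(gp_inj t0 t0 t0' t0') => [/= -> _ _ -> _].
pose S := [set mk x 0%R true | x : K].
apply: (@is_F20_perm _ _ S (mk 0%R 0%R true)).
- exact: cB.
- by rewrite card_imset ?cK // => x y /mk_inj[].
- by apply/imsetP; exists 0%R.
- apply/setP=> v; apply/orbitP/imsetP => [[f /baseN_gpP[t [b [t0 ->]]] /= <-]|[x _ ->]].
    by exists (t * 0 + b)%R => //; rewrite /aperm gp_base_mk.
  exists (gp 1%R 1%R 0%R x 0%R); first by apply/baseN_gpP; exists 1%R, x.
  by rewrite /= /aperm gp_base_mk // mulr0 add0r.
move=> f _ _ /baseN_gpP[t [b [t0 ->]]] /imsetP[x _ ->] /imsetP[y _ ->] nxy.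
rewrite !gp_base_mk // => /mk_inj[ex _ _] /mk_inj[ey _ _].
have [] : t = 1%R /\ b = 0%R.
  by apply: (affine_fix2 _ ex ey); apply: contra nxy => /eqP->.
by move=> -> ->; exact: gp1.
Qed.

End Biaffine.

Lemma CGD2_1_aut5 :
  let A := sAut (CGD2_1 (1%R : 'F_5)) in
  let R := RR (GD 5 2) in
  (exists F C : {group {perm GD 5 2}},
     [/\ is_F20 F, R ><| F = 'N_A(R), C \isog [set: 'Z_4] & (R * F) * C = A])
  /\ (exists N : {group {perm GD 5 2}},
        [/\ N <| A, N \isog [set: 'Z_5], is_F20xF20_Z2 (A / N) & ~~ [splits A, over N]]).
Proof.
move=> A R; rewrite /A CGD2_1E {A} /R {R}.
have Hl : Phi5 (1%R : 'F_5) = 0%R by apply/eqP.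
set s := pts2_1 (1%R : 'F_5).
have s_span : spanning s := rows2_spanning _ _.
have s_inj : injective s := pts2_1_inj Hl.
pose wt (i : 'I_5) : 'F_5 := ((i : nat)%:R)%R.
have F2 : (2%:R != 0 :> 'F_5)%R by [].
have wt_inj : injective wt.
  move=> i j /(congr1 (fun k : 'F_5 => (k : nat))); rewrite !val_Fp_nat // !modn_small // => e.
  exact: val_inj.
have wt_surj k : exists i, wt i = k by exists k; exact: natr_Zp.
have sE i : (s i 0 0 = (wt i ^+ 2 + wt i) / 2%:R /\ s i 0 1 = (wt i ^+ 2 - wt i) / 2%:R)%R.
  by rewrite !mxE; move: i; apply: ord5_ind; split; apply/val_inj; vm_compute.
have z_prim : (4.-primitive_root (2%:R : 'F_5))%R.
  by apply/andP; split=> //; apply/forallP=> -[[|[|[|[|//]]]] Hi]; rewrite unity_rootE.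
have z_gen (u : 'F_5) : u != 0%R -> exists k, u = (2%:R ^+ k)%R.
  (* The exponents are the logarithms of 1, 2, 3, 4 to base 2 modulo 5. *)
  by case: u => [[|[|[|[|[|//]]]]] Hu] // _;
    [exists 0%N|exists 1%N|exists 3%N|exists 2%N]; apply/val_inj.
have cK : #|'F_5| = 5 by rewrite card_Fp.
have ARFC := aut_RFC F2 s_span s_inj wt_inj wt_surj sE z_prim z_gen.
have oC := scal_order F2 z_prim.
split.
  exists (baseN (pt s)), <[gp 2%:R%R 1%R 0%R 0%R 0%R]>%G; split.
  - exact: baseN_F20 F2 s_span s_inj wt_inj wt_surj sE cK.
  - exact: baseN_sdprod.
  - apply: (@cyclic_isog_Zp _ _ 2) (cycle_cyclic _) _; exact oC.
  exact ARFC.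
exists ('ker (rho_morphism F2 s_span wt_surj sE))%G; split.
- exact: ker_normal.
- exact: rho_ker_Z5 cK.
- exact: rho_quotient cK.
exact: rho_nonsplit cK.
Qed.

Theorem theorem4p3 (p : nat) (p_pr : prime p) :
  [/\ (* the covers *)
      forall (n : nat) (X : mgraph), 1 < n -> mconnected X ->
        symmetric_cover [set: 'rV['F_p]_n]%G X (dipole 5) ->
        [/\ 2 <= n <= 4,
            n = 2 ->
              (exists2 l : 'F_p, ell_param l & miso X (mgraph_of (CGD2_1 l)))
              \/ (exists2 l : 'F_p, lambda_param l
                                  & miso X (mgraph_of (CGD2_2 l))),
            n = 3 ->
              exists2 l : 'F_p, ell_param l & miso X (mgraph_of (CGD3 l))
          & n = 4 -> miso X (mgraph_of (CGD4 p))],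
      (* n = 2 *)
      [/\ forall l l' : 'F_p, ell_param l -> ell_param l' ->
            miso (mgraph_of (CGD2_1 l)) (mgraph_of (CGD2_1 l')),
          forall l l' : 'F_p, lambda_param l -> lambda_param l' ->
            miso (mgraph_of (CGD2_2 l)) (mgraph_of (CGD2_2 l')),
          (let A := sAut (CGD2_1 (1%R : 'F_5)) in
           let R := RR (GD 5 2) in
           (exists F C : {group {perm GD 5 2}},
              [/\ is_F20 F, R ><| F = 'N_A(R), C \isog [set: 'Z_4]
                & (R * F) * C = A])
           /\ (exists N : {group {perm GD 5 2}},
                 [/\ N <| A, N \isog [set: 'Z_5], is_F20xF20_Z2 (A / N)
                   & ~~ [splits A, over N]])),
          forall l : 'F_p, 5 %| p - 1 -> ell_param l ->
            is_sdprod_by (sAut_group (CGD2_1 l)) (RR (GD p 2)) [set: 'Z_5]%G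
        & forall l : 'F_p, lambda_param l ->
            is_sdprod_by (sAut_group (CGD2_2 l)) (RR (GD p 2)) 'D_10%G],
      (* n = 3 *)
      [/\ forall l l' : 'F_p, ell_param l -> ell_param l' ->
            miso (mgraph_of (CGD3 l)) (mgraph_of (CGD3 l')),
          is_sdprod_by (sAut_group (CGD3 (1%R : 'F_5))) (RR (GD 5 3))
                       [set: 'S_5]%G
        & forall l : 'F_p, 5 %| p - 1 -> ell_param l ->
            is_sdprod_by (sAut_group (CGD3 l)) (RR (GD p 3)) [set: 'Z_5]%G]
    & (* n = 4 *)
      is_sdprod_by (sAut_group (CGD4 p)) (RR (GD p 4)) [set: 'S_5]%G].
Proof.
split; first exact: cover_classification.
- split; [exact: CGD2_1_unique|exact: CGD2_2_unique| |exact: CGD2_1_aut|exact: CGD2_2_aut].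
  exact: CGD2_1_aut5.
- split; [exact: CGD3_unique|exact: CGD3_aut5|exact: CGD3_aut].
exact: CGD4_aut.
Qed.
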